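(* Let $\mathbf{F}$ be a finite field of odd cardinality $q$, let $(G,\mathbf{V})$ be the infinite unitary group over $\mathbf{F}$, and let $\Theta(G;\mathbf{V})$ be its universal measure ring relative to $\mathbf{V}$. Let $$\phi\colon\Theta(G;\mathbf{V})\to\mathbb{Z}[1/q][t],\qquad \phi([X_{a,b}])=P_{a,b}(t)$$ be the ring homomorphism obtained by counting embeddings, as defined in the context. Then $\phi$ is an isomorphism after inverting $q$.
   Context: Let $\mathbf{K}/\mathbf{F}$ be the quadratic extension with non-trivial automorphism $\tau$. A structure is a $\mathbf{K}$-vector space with a biadditive form $\langle,\rangle$ valued in $\mathbf{K}$, conjugate $\mathbf{K}$-linear in the first variable, $\mathbf{K}$-linear in the second, with $\tau\langle x,y\rangle=\langle y,x\rangle$; an embedding is an injective $\mathbf{K}$-linear map preserving forms. $\mathbf{V}$ has $\mathbf{K}$-basis $\{e_i\}_{i\ge1}$ with $\langle e_i,e_j\rangle=\delta_{i,j}$; $G$ is its automorphism group. $V_m=\mathrm{span}(e_1,\dots,e_m)$; $V_{m,n}$ is the orthogonal sum of $V_m$ and an $n$-dimensional space with zero form. $X_{m,n}$ is the set of embeddings $V_{m,n}\to\mathbf{V}$, with its transitive $G$-action by post-composition. A transitive $G$-set is $\mathbf{V}$-smooth if its stabilizers are pointwise stabilizers $G(A)$ of finite subsets $A\subset\mathbf{V}$; these are exactly the $X_{m,n}$ up to isomorphism. $\Theta(G;\mathbf{V})$ is the commutative ring generated by symbols $[f]$, for $f\colon Y\to X$ a map of transitive $\mathbf{V}$-smooth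 $G$-sets, modulo the relations: (a) $[f]=1$ if $f$ is an isomorphism; (b) $[f\circ g]=[f][g]$ for composable maps; (c) $[f]=\sum_i[f'_i]$ whenever $X'\to X$ is a map of transitive $\mathbf{V}$-smooth $G$-sets, $Y\times_XX'=\bigsqcup_iY'_i$ is the orbit decomposition, and $f'_i\colon Y'_i\to X'$ is the projection. For a transitive $\mathbf{V}$-smooth $G$-set $X$, $[X]:=[X\to\mathrm{pt}]$. $P_{a,b}(t)\in\mathbb{Z}[1/q][t]$ is the polynomial such that $P_{a,b}((-q)^m)$ is the number of embeddings $V_{a,b}\to V_m$ for all $m\ge0$; explicitly $P_{a,b}(t)=q^{-(a+b)^2}t^a\prod_{i=0}^{a+2b-1}(t-(-q)^i)$. For a map $f\colon Y\to X$ with $X=X_{a,b}$, $Y=X_{a',b'}$ (so $f$ is restriction along an embedding $V_{a,b}\to V_{a',b'}$), let $\nu_m(f)$ be the number of extensions of an embedding $V_{a,b}\to V_m$ to an embedding $V_{a',b'}\to V_m$ (independent of the chosen embedding; defined for $m$ large). Then $\phi([f])$ is the unique polynomial whose value at $t=(-q)^m$ is $\nu_m(f)$ for all sufficiently large $m$. *)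

(* Defs.v *)
From HB Require Import structures.
From mathcomp Require Import all_boot all_order all_algebra all_field.
From mathcomp Require Import boolp classical_sets functions cardinality.
From mathcomp Require Import ring.

Set Implicit Arguments.
Unset Strict Implicit.
Unset Printing Implicit Defensive.

Import Order.TTheory GRing.Theory Num.Theory.

Local Open Scope quotient_scope.
Local Open Scope ring_scope.

Inductive rterm (G : Type) : Type :=
  | TGen of G
  | TZero
  | TOne
  | TOpp of rterm G
  | TAdd of rterm G & rterm G
  | TMul of rterm G & rterm G.

Arguments TZero {G}.
Arguments TOne {G}.

HB.instance Definition _ (G : Type) := gen_eqMixin (rterm G).
HB.instance Definition _ (G : Type) := gen_choiceMixin (rterm G).

Section Presentation.
Variables (G : Type) (rel : rterm G -> rterm G -> Prop).

(* The smallest commutative ring congruence containing rel. *)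
Inductive rcong : rterm G -> rterm G -> Prop :=
  | rc_rel a b of rel a b : rcong a b
  | rc_refl a : rcong a a
  | rc_sym a b of rcong a b : rcong b a
  | rc_trans a b c of rcong a b & rcong b c : rcong a c
  | rc_opp a b of rcong a b : rcong (TOpp a) (TOpp b)
  | rc_add a b c d of rcong a b & rcong c d : rcong (TAdd a c) (TAdd b d)
  | rc_mul a b c d of rcong a b & rcong c d : rcong (TMul a c) (TMul b d)
  | rc_addA a b c : rcong (TAdd a (TAdd b c)) (TAdd (TAdd a b) c)
  | rc_addC a b : rcong (TAdd a b) (TAdd b a)
  | rc_add0 a : rcong (TAdd TZero a) a
  | rc_addN a : rcong (TAdd (TOpp a) a) TZero
  | rc_mulA a b c : rcong (TMul a (TMul b c)) (TMul (TMul a b) c)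
  | rc_mulC a b : rcong (TMul a b) (TMul b a)
  | rc_mul1 a : rcong (TMul TOne a) a
  | rc_mulD a b c : rcong (TMul (TAdd a b) c) (TAdd (TMul a c) (TMul b c)).

Definition rcongb a b : bool := `[< rcong a b >].

Lemma rcongb_refl : reflexive rcongb.
Proof. by move=> a; apply/asboolP; apply: rc_refl. Qed.

Lemma rcongb_sym : symmetric rcongb.
Proof. by move=> a b; apply/asboolP/asboolP; apply: rc_sym. Qed.

Lemma rcongb_trans : transitive rcongb.
Proof.
by move=> b a c /asboolP ab /asboolP bc; apply/asboolP; apply: rc_trans bc.
Qed.

Canonical rcongb_equiv := EquivRel rcongb rcongb_refl rcongb_sym rcongb_trans.

Definition presented_ring := {eq_quot rcongb}.

HB.instance Definition _ := Choice.on presented_ring.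
HB.instance Definition _ : EqQuotient _ rcongb presented_ring :=
  EqQuotient.on presented_ring.

Definition pr_class (a : rterm G) : presented_ring := \pi a.

Lemma pr_classP a b : pr_class a = pr_class b <-> rcong a b.
Proof. by split=> [/eqquotP /asboolP //|ab]; apply/eqquotP/asboolP. Qed.

Lemma pr_reprK (x : presented_ring) : pr_class (repr x) = x.
Proof. exact: reprK. Qed.

Lemma pr_repr a : rcong (repr (pr_class a)) a.
Proof. by apply/pr_classP; rewrite pr_reprK. Qed.

Definition pr_zero : presented_ring := pr_class TZero.
Definition pr_one : presented_ring := pr_class TOne.
Definition pr_opp (x : presented_ring) := pr_class (TOpp (repr x)).
Definition pr_add (x y : presented_ring) := pr_class (TAdd (repr x) (repr y)).
Definition pr_mul (x y : presented_ring) := pr_class (TMul (repr x) (repr y)).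

Lemma pr_oppE a : pr_opp (pr_class a) = pr_class (TOpp a).
Proof. by apply/pr_classP/rc_opp/pr_repr. Qed.

Lemma pr_addE a b : pr_add (pr_class a) (pr_class b) = pr_class (TAdd a b).
Proof. by apply/pr_classP; apply: rc_add; apply: pr_repr. Qed.

Lemma pr_mulE a b : pr_mul (pr_class a) (pr_class b) = pr_class (TMul a b).
Proof. by apply/pr_classP; apply: rc_mul; apply: pr_repr. Qed.

Let prE := (pr_oppE, pr_addE, pr_mulE).

Lemma pr_addA : associative pr_add.
Proof.
move=> x y z; rewrite -[x]pr_reprK -[y]pr_reprK -[z]pr_reprK !prE.
exact/pr_classP/rc_addA.
Qed.

Lemma pr_addC : commutative pr_add.
Proof.
by move=> x y; rewrite -[x]pr_reprK -[y]pr_reprK !prE; apply/pr_classP/rc_addC.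
Qed.

Lemma pr_add0 : left_id pr_zero pr_add.
Proof. by move=> x; rewrite -[x]pr_reprK !prE; apply/pr_classP/rc_add0. Qed.

Lemma pr_addN : left_inverse pr_zero pr_opp pr_add.
Proof. by move=> x; rewrite -[x]pr_reprK !prE; apply/pr_classP/rc_addN. Qed.

HB.instance Definition _ :=
  GRing.isZmodule.Build presented_ring pr_addA pr_addC pr_add0 pr_addN.

Lemma pr_mulA : associative pr_mul.
Proof.
move=> x y z; rewrite -[x]pr_reprK -[y]pr_reprK -[z]pr_reprK !prE.
exact/pr_classP/rc_mulA.
Qed.

Lemma pr_mulC : commutative pr_mul.
Proof.
by move=> x y; rewrite -[x]pr_reprK -[y]pr_reprK !prE; apply/pr_classP/rc_mulC.
Qed.

Lemma pr_mul1 : left_id pr_one pr_mul.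
Proof. by move=> x; rewrite -[x]pr_reprK !prE; apply/pr_classP/rc_mul1. Qed.

Lemma pr_mulD : left_distributive pr_mul pr_add.
Proof.
move=> x y z; rewrite -[x]pr_reprK -[y]pr_reprK -[z]pr_reprK !prE.
exact/pr_classP/rc_mulD.
Qed.

HB.instance Definition _ := GRing.Zmodule_isComPzRing.Build presented_ring
  pr_mulA pr_mulC pr_mul1 pr_mulD.

End Presentation.

(* The localization R[1/s]: the pair (x, n) stands for x / s ^ n. *)

Section Localization.
Variables (R : comPzRingType) (s : R).
Implicit Types u v w : (R * nat)%type.

Definition loc_eq u v : bool :=
  `[< exists k, s ^+ k * (s ^+ v.2 * u.1) = s ^+ k * (s ^+ u.2 * v.1) >].

Lemma loc_eq_refl : reflexive loc_eq.
Proof. by move=> u; apply/asboolP; exists 0%N. Qed.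

Lemma loc_eq_sym : symmetric loc_eq.
Proof. by move=> u v; apply/asboolP/asboolP => -[k e]; exists k. Qed.

Lemma loc_eq_trans : transitive loc_eq.
Proof.
move=> [y m] [x n] [z p] /asboolP[/= k e1] /asboolP[/= l e2].
apply/asboolP; exists (k + l + m)%N => /=.
transitivity (s ^+ (l + p) * (s ^+ k * (s ^+ m * x))).
  by rewrite !exprD; ring.
rewrite e1; transitivity (s ^+ (k + n) * (s ^+ l * (s ^+ p * y))).
  by rewrite !exprD; ring.
by rewrite e2 !exprD; ring.
Qed.

Canonical loc_equiv := EquivRel loc_eq loc_eq_refl loc_eq_sym loc_eq_trans.

Definition loc := {eq_quot loc_eq}.

HB.instance Definition _ := Choice.on loc.
HB.instance Definition _ : EqQuotient _ loc_eq loc := EqQuotient.on loc.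

Definition loc_frac u : loc := \pi u.

Lemma loc_fracP u v : loc_frac u = loc_frac v <->
  exists k, s ^+ k * (s ^+ v.2 * u.1) = s ^+ k * (s ^+ u.2 * v.1).
Proof. by split=> [/eqquotP /asboolP //|uv]; apply/eqquotP/asboolP. Qed.

Lemma loc_reprK (x : loc) : loc_frac (repr x) = x.
Proof. exact: reprK. Qed.

Lemma loc_ind (P : loc -> Prop) : (forall u, P (loc_frac u)) -> forall x, P x.
Proof. by move=> Pfrac x; rewrite -[x]loc_reprK. Qed.

Lemma loc_repr u : exists k,
  s ^+ k * (s ^+ u.2 * (repr (loc_frac u)).1) =
  s ^+ k * (s ^+ (repr (loc_frac u)).2 * u.1).
Proof. by apply/loc_fracP; rewrite loc_reprK. Qed.

Definition loc_zero : loc := loc_frac (0, 0%N).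
Definition loc_one : loc := loc_frac (1, 0%N).
Definition loc_opp (x : loc) : loc := loc_frac (- (repr x).1, (repr x).2).
Definition loc_add (x y : loc) : loc :=
  loc_frac (s ^+ (repr y).2 * (repr x).1 + s ^+ (repr x).2 * (repr y).1,
            ((repr x).2 + (repr y).2)%N).
Definition loc_mul (x y : loc) : loc :=
  loc_frac ((repr x).1 * (repr y).1, ((repr x).2 + (repr y).2)%N).

Lemma loc_oppE u : loc_opp (loc_frac u) = loc_frac (- u.1, u.2).
Proof.
by apply/loc_fracP; have [k e] := loc_repr u; exists k => /=; rewrite !mulrN e.
Qed.

Lemma loc_addE u v : loc_add (loc_frac u) (loc_frac v) =
  loc_frac (s ^+ v.2 * u.1 + s ^+ u.2 * v.1, (u.2 + v.2)%N).
Proof.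
apply/loc_fracP; have [k e] := loc_repr u; have [l f] := loc_repr v.
exists (k + l)%N => /=.
move: (repr (loc_frac u)) (repr (loc_frac v)) e f => [x n] [y m] /= e f.
transitivity (s ^+ (l + v.2 + m) * (s ^+ k * (s ^+ u.2 * x))
  + s ^+ (k + u.2 + n) * (s ^+ l * (s ^+ v.2 * y))).
  by rewrite !exprD; ring.
by rewrite e f !exprD; ring.
Qed.

Lemma loc_mulE u v : loc_mul (loc_frac u) (loc_frac v) =
  loc_frac (u.1 * v.1, (u.2 + v.2)%N).
Proof.
apply/loc_fracP; have [k e] := loc_repr u; have [l f] := loc_repr v.
exists (k + l)%N => /=.
move: (repr (loc_frac u)) (repr (loc_frac v)) e f => [x n] [y m] /= e f.
transitivity ((s ^+ k * (s ^+ u.2 * x)) * (s ^+ l * (s ^+ v.2 * y))).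
  by rewrite !exprD; ring.
by rewrite e f !exprD; ring.
Qed.

Let locE := (loc_oppE, loc_addE, loc_mulE).

Lemma loc_addA : associative loc_add.
Proof.
elim/loc_ind=> -[x m]; elim/loc_ind=> -[y n]; elim/loc_ind=> -[z p].
rewrite !locE /=.
by apply/loc_fracP; exists 0%N; rewrite /= !exprD ?expr0; ring.
Qed.

Lemma loc_addC : commutative loc_add.
Proof.
by move=> x y; rewrite -[x]loc_reprK -[y]loc_reprK !locE addrC addnC.
Qed.

Lemma loc_add0 : left_id loc_zero loc_add.
Proof.
elim/loc_ind=> -[x m]; rewrite !locE /=.
by apply/loc_fracP; exists 0%N; rewrite /= !exprD ?expr0; ring.
Qed.

Lemma loc_addN : left_inverse loc_zero loc_opp loc_add.
Proof.
elim/loc_ind=> -[x m]; rewrite !locE /=.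
by apply/loc_fracP; exists 0%N; rewrite /= !exprD ?expr0; ring.
Qed.

HB.instance Definition _ :=
  GRing.isZmodule.Build loc loc_addA loc_addC loc_add0 loc_addN.

Lemma loc_mulA : associative loc_mul.
Proof.
elim/loc_ind=> -[x m]; elim/loc_ind=> -[y n]; elim/loc_ind=> -[z p].
rewrite !locE /=.
by rewrite mulrA addnA.
Qed.

Lemma loc_mulC : commutative loc_mul.
Proof.
by move=> x y; rewrite -[x]loc_reprK -[y]loc_reprK !locE mulrC addnC.
Qed.

Lemma loc_mul1 : left_id loc_one loc_mul.
Proof.
by move=> x; rewrite -[x]loc_reprK !locE mul1r add0n -surjective_pairing.
Qed.

Lemma loc_mulD : left_distributive loc_mul loc_add.
Proof.
elim/loc_ind=> -[x m]; elim/loc_ind=> -[y n]; elim/loc_ind=> -[z p].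
rewrite !locE /=.
by apply/loc_fracP; exists 0%N; rewrite /= !exprD ?expr0; ring.
Qed.

HB.instance Definition _ :=
  GRing.Zmodule_isComPzRing.Build loc loc_mulA loc_mulC loc_mul1 loc_mulD.

End Localization.

Section LocalizationMap.
Variables (R S : comPzRingType) (f : {rmorphism R -> S}) (s : R).

(* The map R[1/s] -> S[1/f(s)] induced by f. *)
Definition loc_map (x : loc s) : loc (f s) :=
  loc_frac (f s) (f (repr x).1, (repr x).2).

Lemma loc_mapE u : loc_map (loc_frac s u) = loc_frac (f s) (f u.1, u.2).
Proof.
apply/loc_fracP; have [k e] := loc_repr s u; exists k => /=.
by rewrite -!rmorphXn -!rmorphM e.
Qed.

Lemma loc_map_is_zmod_morphism : zmod_morphism loc_map.
Proof.
move=> x y; rewrite -[x]loc_reprK -[y]loc_reprK.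
rewrite /GRing.add /GRing.opp /= !(loc_oppE, loc_addE, loc_mapE) /=.
by rewrite rmorphD !rmorphM !rmorphN !rmorphXn.
Qed.

Lemma loc_map_is_monoid_morphism : monoid_morphism loc_map.
Proof.
split=> [|x y]; first by rewrite /GRing.one /= loc_mapE rmorph1.
rewrite -[x]loc_reprK -[y]loc_reprK.
by rewrite /GRing.mul /= !(loc_mulE, loc_mapE) /= rmorphM.
Qed.

HB.instance Definition _ := GRing.isZmodMorphism.Build (loc s) (loc (f s))
  loc_map loc_map_is_zmod_morphism.
HB.instance Definition _ := GRing.isMonoidMorphism.Build (loc s) (loc (f s))
  loc_map loc_map_is_monoid_morphism.

End LocalizationMap.

Arguments loc_map {R S} f s x.

(* Z[1/q] is the subring of the rationals x with x * q ^ n integral for some n. *)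
Definition inv_int_pred (q : nat) : {pred rat} :=
  fun x => `[< exists n : nat, x * q%:R ^+ n \is a Num.int >].

Lemma inv_int_subring q : subring_closed (inv_int_pred q).
Proof.
split=> [|x y /asboolP[n xn] /asboolP[m ym]|x y /asboolP[n xn] /asboolP[m ym]];
  apply/asboolP.
- by exists 0%N; rewrite mulr1 rpred1.
- exists (n + m)%N.
  have -> : (x - y) * q%:R ^+ (n + m) =
    x * q%:R ^+ n * q%:R ^+ m - y * q%:R ^+ m * q%:R ^+ n.
    by rewrite exprD; ring.
  by rewrite rpredB // rpredM // rpredX // natr_int.
- exists (n + m)%N.
  have -> : x * y * q%:R ^+ (n + m) = (x * q%:R ^+ n) * (y * q%:R ^+ m).
    by rewrite exprD; ring.
  exact: rpredM.
Qed.

Record Zinv (q : nat) : Type := MkZinv {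
  zinv_val :> rat;
  zinv_valP : zinv_val \in inv_int_pred q }.

HB.instance Definition _ q := [isSub for @zinv_val q].
HB.instance Definition _ q := [Choice of Zinv q by <:].
HB.instance Definition _ q :=
  GRing.SubChoice_isSubComNzRing.Build rat (inv_int_pred q) (Zinv q)
    (inv_int_subring q).

Lemma qinv_subproof q : (q%:R^-1 : rat) \in inv_int_pred q.
Proof.
apply/asboolP; exists 1%N; rewrite expr1.
have [->|q0] := eqVneq (q%:R : rat) 0; first by rewrite mulr0 rpred0.
by rewrite mulVf // rpred1.
Qed.

Definition qinv q : Zinv q := MkZinv (qinv_subproof q).

Record quadExt (F : fieldType) := QuadExt {
  qe_field :> fieldExtType F;
  qe_tau : {lrmorphism qe_field -> qe_field};
  qe_dim : \dim {: qe_field} = 2%N;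
  qe_tau_nontriv : exists x, qe_tau x <> x }.

Notation "'tau" := (@qe_tau _ _) (at level 0).

Lemma tauK (F : fieldType) (K : quadExt F) : involutive ('tau : K -> K).
Proof.
case: (qe_tau_nontriv K) => x /eqP xNx z.
have tauF a : 'tau (a%:A : K) = a%:A by rewrite linearZ rmorph1.
have span z' : exists a b : F, z' = a%:A + b *: x.
  have x1 : x \notin <[1 : K]>%VS.
    by apply: contra xNx => /vlineP[a ->]; rewrite tauF.
  have fullE : (<[1 : K]> + <[x]>)%VS = fullv.
    apply/eqP; rewrite eqEdim subvf (qe_dim K) /=.
    rewrite dimv_disjoint_sum ?dim_vline ?oner_eq0 //.
      have [x0|//] := eqVneq x 0.
      by move: x1; rewrite x0 mem0v.
    apply/eqP; rewrite -subv0; apply/subvP => w.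
    rewrite memv_cap => /andP[/vlineP[a ->] /vlineP[b eab]].
    have [b0|b0] := eqVneq b 0; first by rewrite eab b0 scale0r mem0v.
    case/negP: x1; apply/vlineP; exists (b^-1 * a).
    by rewrite -scalerA eab scalerA mulVf // scale1r.
  have: z' \in (<[1 : K]> + <[x]>)%VS by rewrite fullE memvf.
  by case/memv_addP => _ /vlineP[a ->] [_ /vlineP[b ->] ->]; exists a, b.
have tauE a b : 'tau (a%:A + b *: x : K) = a%:A + b *: 'tau x.
  by rewrite rmorphD /= tauF linearZ.
have [a [b e]] := span (x * x).
have e' : 'tau x * 'tau x = a%:A + b *: 'tau x by rewrite -rmorphM /= e tauE.
have trE : 'tau x = b%:A - x.
  have: ('tau x - x) * ('tau x + x - b%:A) = 0.
    have -> : ('tau x - x) * ('tau x + x - b%:A) =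
      ('tau x * 'tau x - b%:A * 'tau x) - (x * x - b%:A * x) by ring.
    by rewrite e e' -!scalerAl !mul1r !addrK subrr.
  move/eqP; rewrite mulf_eq0 subr_eq0 (negPf xNx) /= subr_eq0 => /eqP <-.
  by rewrite addrK.
have tx : 'tau ('tau x) = x.
  by rewrite {1}trE rmorphB /= tauF trE opprB addrC subrK.
by have [c [d ->]] := span z; rewrite tauE rmorphD /= tauF linearZ /= tx.
Qed.

Section Hermitian.
Variables (F : fieldType) (K : quadExt F).

Record hspace := HSpace {
  hs_sort :> lmodType K;
  hform : hs_sort -> hs_sort -> K;
  hform_linl : forall (a : K) (x y z : hs_sort),
    hform (a *: x + y) z = 'tau a * hform x z + hform y z;
  hform_linr : forall (a : K) (x y z : hs_sort),
    hform x (a *: y + z) = a * hform x y + hform x z;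
  hform_herm : forall x y : hs_sort, 'tau (hform x y) = hform y x }.

Record embedding (U W : hspace) := Embedding {
  emb_fun :> U -> W;
  emb_linear : linear emb_fun;
  emb_inj : injective emb_fun;
  emb_form : forall x y, hform (emb_fun x) (emb_fun y) = hform x y }.

Lemma emb_eqP (U W : hspace) (f g : embedding U W) : f = g <-> f =1 g.
Proof.
split=> [->//|fg]; case: f g fg => [f f1 f2 f3] [g g1 g2 g3] /= /funext fg.
by subst g; congr Embedding; apply: Prop_irrelevance.
Qed.

Lemma emb_comp_linear (U W Z : hspace) (g : embedding W Z)
  (f : embedding U W) : linear (g \o f).
Proof. by move=> a x y /=; rewrite !emb_linear. Qed.

Lemma emb_comp_form (U W Z : hspace) (g : embedding W Z)
  (f : embedding U W) x y : hform ((g \o f) x) ((g \o f) y) = hform x y.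
Proof. by rewrite /= !emb_form. Qed.

Definition emb_comp (U W Z : hspace) (g : embedding W Z) (f : embedding U W) :
  embedding U Z :=
  Embedding (emb_comp_linear g f) (inj_comp (@emb_inj _ _ g) (@emb_inj _ _ f))
    (emb_comp_form g f).

(* V_{m,n} on K^(m+n): the first m coordinate vectors are orthonormal, the last
   n span the radical. The space V_m is V_{m,0}, i.e. span(e_1, ..., e_m) in
   the coordinates given by e_1, ..., e_m. *)
Section Standard.
Variables m n : nat.

Definition std_form (x y : 'rV[K]_(m + n)) : K :=
  \sum_(i < m) 'tau (x 0 (lshift n i)) * y 0 (lshift n i).

Lemma std_form_linl (a : K) (x y z : 'rV[K]_(m + n)) :
  std_form (a *: x + y) z = 'tau a * std_form x z + std_form y z.
Proof.
rewrite /std_form mulr_sumr -big_split /=; apply: eq_bigr => i _.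
by rewrite !mxE rmorphD rmorphM mulrDl mulrA.
Qed.

Lemma std_form_linr (a : K) (x y z : 'rV[K]_(m + n)) :
  std_form x (a *: y + z) = a * std_form x y + std_form x z.
Proof.
rewrite /std_form mulr_sumr -big_split /=; apply: eq_bigr => i _.
by rewrite !mxE mulrDr mulrCA.
Qed.

Lemma std_form_herm (x y : 'rV[K]_(m + n)) : 'tau (std_form x y) = std_form y x.
Proof.
rewrite /std_form rmorph_sum; apply: eq_bigr => i _.
by rewrite rmorphM /= tauK mulrC.
Qed.

Definition stdV : hspace := HSpace std_form_linl std_form_linr std_form_herm.

End Standard.

Definition orthonormal_basis (V : hspace) (e : nat -> V) : Prop :=
  [/\ forall v : V, exists n (c : nat -> K), v = \sum_(i < n) c i *: e i,
      forall n (c : nat -> K), \sum_(i < n) c i *: e i = 0 ->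
        forall i, (i < n)%N -> c i = 0
    & forall i j, hform (e i) (e j) = (i == j)%:R].

Record unitary (V : hspace) := Unitary {
  unit_emb :> embedding V V;
  unit_surj : forall y, exists x, unit_emb x = y }.

HB.instance Definition _ V := gen_eqMixin (unitary V).
HB.instance Definition _ V := gen_choiceMixin (unitary V).

Section UnitaryGroup.
Variable V : hspace.
Implicit Types g h : unitary V.

Lemma unit_eqP g h : g = h <-> g =1 h.
Proof.
split=> [->//|/emb_eqP]; case: g h => [g g1] [h h1] /= gh; subst h.
by congr Unitary; apply: Prop_irrelevance.
Qed.

Definition id_emb : embedding V V :=
  @Embedding V V id (fun _ _ _ => erefl) (fun _ _ => id) (fun _ _ => erefl).

Lemma id_surj y : exists x, id_emb x = y. Proof. by exists y. Qed.

Definition unit_one := Unitary id_surj.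

Lemma comp_surj g h y : exists x, emb_comp g h x = y.
Proof.
have [z <-] := unit_surj g y; have [x <-] := unit_surj h z.
by exists x.
Qed.

Definition unit_mul g h := Unitary (comp_surj g h).

Definition unit_inv_fun g y : V := projT1 (cid (unit_surj g y)).

Lemma unit_inv_funK g : cancel (unit_inv_fun g) g.
Proof. by move=> y; rewrite /unit_inv_fun; case: cid. Qed.

Lemma unit_funK g : cancel g (unit_inv_fun g).
Proof. by move=> x; apply: (@emb_inj _ _ g); rewrite unit_inv_funK. Qed.

Lemma unit_inv_linear g : linear (unit_inv_fun g).
Proof.
by move=> a x y; apply: (@emb_inj _ _ g); rewrite emb_linear !unit_inv_funK.
Qed.

Lemma unit_inv_form g x y :
  hform (unit_inv_fun g x) (unit_inv_fun g y) = hform x y.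
Proof. by rewrite -(emb_form g) !unit_inv_funK. Qed.

Definition unit_inv_emb g := Embedding (unit_inv_linear g)
  (can_inj (unit_inv_funK g)) (unit_inv_form g).

Lemma unit_inv_surj g y : exists x, unit_inv_emb g x = y.
Proof. by exists (g y); apply: unit_funK. Qed.

Definition unit_inv g := Unitary (unit_inv_surj g).

Lemma unit_mulA : associative unit_mul.
Proof. by move=> f g h; apply/unit_eqP. Qed.

Lemma unit_mul1 : left_id unit_one unit_mul.
Proof. by move=> f; apply/unit_eqP. Qed.

Lemma unit_1mul : right_id unit_one unit_mul.
Proof. by move=> f; apply/unit_eqP. Qed.

Lemma unit_mulV : left_inverse unit_one unit_inv unit_mul.
Proof. by move=> f; apply/unit_eqP => x; apply: unit_funK. Qed.

Lemma unit_Vmul : right_inverse unit_one unit_inv unit_mul.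
Proof. by move=> f; apply/unit_eqP => x; apply: unit_inv_funK. Qed.

HB.instance Definition _ := isGroup.Build (unitary V)
  unit_mulA unit_mul1 unit_1mul unit_mulV unit_Vmul.

End UnitaryGroup.

(* Carriers are in Set so that the symbols [f] range over a small type. Since V
   is countable when K is finite, every transitive V-smooth G-set is isomorphic
   to one of this kind. *)
Record smoothset (V : hspace) := SmoothSet {
  ss_sort :> Set;
  ss_act : unitary V -> ss_sort -> ss_sort;
  ss_act1 : forall x, ss_act 1%g x = x;
  ss_actM : forall g h x, ss_act (g * h)%g x = ss_act g (ss_act h x);
  ss_nonempty : inhabited ss_sort;
  ss_trans : forall x y, exists g, ss_act g x = y;
  ss_smooth : forall x, exists A : seq V, forall g,
    ss_act g x = x <-> {in A, forall v, g v = v} }.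

Record gmap (V : hspace) (Y X : smoothset V) := GMap {
  gm_fun :> Y -> X;
  gm_equiv : forall g y, gm_fun (ss_act g y) = ss_act g (gm_fun y) }.

Section GMaps.
Variable V : hspace.
Implicit Types X Y Z : smoothset V.

Lemma gm_comp_equiv X Y Z (f : gmap Y X) (g : gmap Z Y) u z :
  (f \o g) (ss_act u z) = ss_act u ((f \o g) z).
Proof. by rewrite /= !gm_equiv. Qed.

Definition gm_comp X Y Z (f : gmap Y X) (g : gmap Z Y) : gmap Z X :=
  GMap (gm_comp_equiv f g).

Lemma pt_trans (x y : unit) : exists g : unitary V, (fun _ => id) g x = y.
Proof. by exists 1%g; case: x y => [] []. Qed.

Lemma pt_smooth (x : unit) : exists A : seq V, forall g : unitary V,
  (fun _ => id) g x = x <-> {in A, forall v, g v = v}.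
Proof. by exists [::]. Qed.

Definition pt : smoothset V := @SmoothSet V unit (fun _ => id)
  (fun _ => erefl) (fun _ _ _ => erefl) (inhabits tt) pt_trans pt_smooth.

Definition to_pt X : gmap X pt := @GMap V X pt (fun _ => tt) (fun _ _ => erefl).

(* The maps Y' i -> Y and Y' i -> X' identify the disjoint union of the
   transitive G-sets Y' i with the fibre product of f : Y -> X and
   h : X' -> X, i.e. they exhibit its decomposition into orbits. *)
Definition orbit_decomposition X Y X' (f : gmap Y X) (h : gmap X' X) (n : nat)
    (Y' : 'I_n -> smoothset V) (g : forall i, gmap (Y' i) Y)
    (f' : forall i, gmap (Y' i) X') : Prop :=
  (forall i z, f (g i z) = h (f' i z)) /\
  (forall y x', f y = h x' ->
    exists! z : {i : 'I_n & Y' i},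
      g (tag z) (tagged z) = y /\ f' (tag z) (tagged z) = x').

Record symbol := Symbol {
  sy_dom : smoothset V;
  sy_cod : smoothset V;
  sy_map : gmap sy_dom sy_cod }.

Definition tsym X Y (f : gmap Y X) : rterm symbol := TGen (Symbol f).

Inductive theta_rel : rterm symbol -> rterm symbol -> Prop :=
  | theta_iso X Y (f : gmap Y X) of bijective f : theta_rel (tsym f) TOne
  | theta_comp X Y Z (f : gmap Y X) (g : gmap Z Y) :
      theta_rel (tsym (gm_comp f g)) (TMul (tsym f) (tsym g))
  | theta_base X Y X' (f : gmap Y X) (h : gmap X' X) n
      (Y' : 'I_n -> smoothset V) (g : forall i, gmap (Y' i) Y)
      (f' : forall i, gmap (Y' i) X') of orbit_decomposition f h g f' :
      theta_rel (tsym f) (\big[@TAdd _/TZero]_(i < n) tsym (f' i)).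

Definition Theta : comPzRingType := presented_ring theta_rel.

Definition theta_sym X Y (f : gmap Y X) : Theta := pr_class theta_rel (tsym f).

Definition Xset (a b : nat) : Type := embedding (stdV a b) V.

Definition Xact a b (g : unitary V) (u : Xset a b) : Xset a b := emb_comp g u.

Definition iso_Xset a b X (i : X -> Xset a b) : Prop :=
  bijective i /\ forall g x, i (ss_act g x) = Xact g (i x).

(* Identifications of the source and target of f with X_{a',b'} and X_{a,b}
   under which f becomes restriction along j : V_{a,b} -> V_{a',b'}. *)
Record restriction_model X Y (f : gmap Y X) (a b a' b' : nat)
    (j : embedding (stdV a b) (stdV a' b')) := RestrictionModel {
  rm_dom : Y -> Xset a' b';
  rm_cod : X -> Xset a b;
  rm_dom_iso : iso_Xset rm_dom;
  rm_cod_iso : iso_Xset rm_cod;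
  rm_restr : forall y, rm_cod (f y) = emb_comp (rm_dom y) j }.

End GMaps.

(* V_{a,b} embeds in V_m, and every embedding of it extends along j in exactly
   N ways: nu_m(j) is defined and equal to N. *)
Definition nu_is a b a' b' (j : embedding (stdV a b) (stdV a' b'))
    (m N : nat) : Prop :=
  inhabited (embedding (stdV a b) (stdV m 0)) /\
  forall u : embedding (stdV a b) (stdV m 0),
    ([set v : embedding (stdV a' b') (stdV m 0) | emb_comp v j = u] #= `I_N)%card.

Definition counting_poly (q : nat) a b a' b'
    (j : embedding (stdV a b) (stdV a' b')) (p : {poly Zinv q}) : Prop :=
  exists M, forall m, (M <= m)%N ->
    exists2 N, nu_is j m N & p.[(- q%:R) ^+ m] = N%:R.

(* Every f is, up to isomorphism, restriction along some j, and phi [f] is the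
   polynomial interpolating nu_m(j), for any such j. Its values at infinitely
   many points determine phi [f]. *)
Definition is_counting_hom (V : hspace) (q : nat)
    (phi : Theta V -> {poly Zinv q}) : Prop :=
  forall (X Y : smoothset V) (f : gmap Y X),
    (exists a b a' b' (j : embedding (stdV a b) (stdV a' b')),
       inhabited (restriction_model f j)) /\
    (forall a b a' b' (j : embedding (stdV a b) (stdV a' b')),
       restriction_model f j -> counting_poly j (phi (theta_sym f))).

End Hermitian.

Definition Ppoly (q a b : nat) : {poly Zinv q} :=
  qinv q ^+ ((a + b) ^ 2) *:
    ('X^a * \prod_(i < a + 2 * b) ('X - ((- q%:R) ^+ i)%:P)).

(* Main.v *)
From HB Require Import structures.
Require Import Defs.
From mathcomp Require Import all_boot all_order all_algebra all_field.
From mathcomp Require Import boolp classical_sets functions cardinality.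
From mathcomp Require Import ring zify.

Set Implicit Arguments.
Unset Strict Implicit.
Unset Printing Implicit Defensive.

Import Order.TTheory GRing.Theory Num.Theory.

Local Open Scope ring_scope.

(** Count in the finite spaces V_m. A point of a transitive V-smooth G-set X is
    said to live in V_m when it is fixed by every g fixing V_m pointwise. A map
    f : Y -> X then restricts to a map between the finite sets of points in V_m,
    and the defining relations of Theta visibly hold for the sizes of its fibres
    (degree_iso, degree_comp, degree_base), once V_m is large enough. By
    Witt's theorem (witt) the unitary group of V_m is transitive on these points,
    so that all fibres have the same size nu_m(f).  Hence every t in Theta has
    values ev_m(t), well defined for m large (term_count_cong).

    It remains to know Theta. The class of a map G/G(B) -> G/G(A) depends on the
    spans of A and B only, and is a product of classes of one point extensions.
    Let x_N(d), called mu N d below, be the class of adjoining to V_N a vector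
    orthogonal to it and of norm d, the zero vector being allowed.  If A lies in V_N, base change from
    G/G(A) to G/G(V_N) sorts the vectors v of a given type over A according to
    their projection w to V_N, which leaves a vector of norm <v,v> - <w,w>
    orthogonal to V_N (one_point_class).  So all classes are combinations of the
    x_N(d), and x_N(d) only depends on whether d = 0.  Taking A empty relates
    x_N to x_0 through the numbers of vectors of given norm in V_N: with
    s_N = x_N(0) - x_N(1), called sigma N below, one finds
    (-q)^N s_N = s_0 =: T, while x_N(1) is a combination of x_0(1) and s_N with
    powers of q as denominators.  Finally V_2
    is obtained by adjoining either two orthonormal vectors, or an isotropic
    vector and then e_0; equating both classes gives q x_0(1) = T^2 - T
    (quadratic_relation).  Thus T generates Theta over Z[1/q] once q is inverted
    (generated_all).

    As ev_m(T) = (-q)^m, every ev_m(t) is, for m large, the value at (-q)^m of a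
    polynomial over Z[1/q], which is unique. This polynomial is count_hom t, and
    count_hom is a ring morphism because ev_m respects sums and products for m
    large. It maps T to the variable 'X, so that 'X |-> T is its inverse after
    inverting q (loc_count_hom_bij).  The polynomial P_{a,b} is found by adjoining one after
    the other a orthonormal vectors and b vectors spanning the radical, each step
    contributing factors given by one_point_class (count_hom_std_family). *)

(** * Hermitian matrices and Witt's theorem *)

Section HermitianMatrices.
Variables (K : fieldType) (tau : {rmorphism K -> K}).
Hypothesis tauK' : involutive tau.

Definition ctr m n (A : 'M[K]_(m, n)) : 'M[K]_(n, m) := (map_mx tau A)^T.
Local Notation "A ^*" := (ctr A) : ring_scope.

Lemma ctrK m n (A : 'M[K]_(m, n)) : A^*^* = A.
Proof. by apply/matrixP=> i j; rewrite !mxE tauK'. Qed.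

Lemma ctrM m n p (A : 'M[K]_(m, n)) (B : 'M_(n, p)) : (A *m B)^* = B^* *m A^*.
Proof. by rewrite /ctr map_mxM trmx_mul. Qed.

Lemma ctrD m n (A B : 'M[K]_(m, n)) : (A + B)^* = A^* + B^*.
Proof. by apply/matrixP=> i j; rewrite !mxE rmorphD. Qed.

Lemma ctrB m n (A B : 'M[K]_(m, n)) : (A - B)^* = A^* - B^*.
Proof. by apply/matrixP=> i j; rewrite !mxE rmorphB. Qed.

Lemma ctrZ m n (a : K) (A : 'M[K]_(m, n)) : (a *: A)^* = tau a *: A^*.
Proof. by apply/matrixP=> i j; rewrite !mxE rmorphM. Qed.

Lemma ctr0 m n : (0 : 'M[K]_(m, n))^* = 0.
Proof. by apply/matrixP=> i j; rewrite !mxE rmorph0. Qed.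

Lemma ctr1 n : (1%:M : 'M[K]_n)^* = 1%:M.
Proof. by rewrite /ctr map_mx1 trmx1. Qed.

Lemma ctr_col m1 m2 n (A : 'M[K]_(m1, n)) (B : 'M_(m2, n)) :
  (col_mx A B)^* = row_mx A^* B^*.
Proof. by rewrite /ctr map_col_mx tr_col_mx. Qed.

Lemma rank_ctr m n (A : 'M[K]_(m, n)) : \rank A^* = \rank A.
Proof. by rewrite /ctr mxrank_tr mxrank_map. Qed.

Lemma row_free_ctr_solve k m p (A : 'M[K]_(k, m)) (Y : 'M_(k, p)) :
  row_free A -> exists S : 'M_(p, m), A *m S^* = Y.
Proof.
case/row_freeP=> B AB; exists (B *m Y)^*.
by rewrite ctrK mulmxA AB mul1mx.
Qed.

Hypothesis tau_norm : forall c, tau c = c -> exists z, z * tau z = c.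
Hypothesis tau_trace : exists a, a + tau a != 0.

Lemma form_herm n (x y : 'rV[K]_n) : tau ((x *m y^*) 0 0) = (y *m x^*) 0 0.
Proof.
have -> : y *m x^* = (x *m y^*)^* by rewrite ctrM ctrK.
by rewrite !mxE.
Qed.

(** If the form took a nonzero value c at (u, v), the norm of (a / c) u + v would
    be the trace of a, which is nonzero for a suitable a. *)
Lemma isotropic_orthogonal m n (C : 'M[K]_(m, n)) :
  (forall v : 'rV_n, (v <= C)%MS -> v *m v^* = 0) ->
  forall u v : 'rV_n, (u <= C)%MS -> (v <= C)%MS -> u *m v^* = 0.
Proof.
move=> Ciso u v uC vC; case: tau_trace => a a0.
set c := (u *m v^*) 0 0.
suff c0 : c = 0 by apply/matrixP=> i j; rewrite !ord1 -/c c0 mxE.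
apply/eqP; apply: contraT => cN.
have := Ciso _ (addmx_sub (scalemx_sub (a / c) uC) vC).
rewrite ctrD mulmxDl !mulmxDr !ctrZ -!scalemxAl -!scalemxAr.
rewrite (Ciso _ uC) (Ciso _ vC) !scaler0 add0r addr0.
move/matrixP/(_ 0 0); rewrite [LHS]mxE [X in X + _]mxE [X in _ + X]mxE.
rewrite -(form_herm u v) -/c [RHS]mxE.
by rewrite rmorphM fmorphV !divfK ?fmorph_eq0 // => /eqP; rewrite (negPf a0).
Qed.

Definition orthonormal a n (W : 'M[K]_(a, n)) := W *m W^* == 1%:M.

Lemma orthonormal_rank a n (W : 'M[K]_(a, n)) : orthonormal W -> row_free W.
Proof. by move=> /eqP WW; apply/row_freeP; exists W^*. Qed.

Lemma orthonormal_add a n (W : 'M[K]_(a, n)) (v : 'rV_n) :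
  orthonormal W -> orthonormal v -> v *m W^* = 0 -> orthonormal (col_mx W v).
Proof.
move=> /eqP WW /eqP vv vW; rewrite /orthonormal ctr_col mul_col_row WW vv vW.
have -> : W *m v^* = 0 by rewrite -[LHS]ctrK ctrM ctrK vW ctr0.
by rewrite -scalar_mx_block.
Qed.

(** Gram-Schmidt in maximal form: since every nonzero norm is the norm of a
    scalar, an orthonormal family in C which cannot be enlarged leaves nothing
    but isotropic vectors in its orthogonal. *)
Lemma maximal_orthonormal m n (C : 'M[K]_(m, n)) :
  exists a (W : 'M[K]_(a, n)), [/\ orthonormal W, (W <= C)%MS &
    forall u v : 'rV_n, (u <= C)%MS -> (v <= C)%MS ->
      u *m W^* = 0 -> v *m W^* = 0 -> u *m v^* = 0].
Proof.
pose P a := `[< exists W : 'M[K]_(a, n), orthonormal W /\ (W <= C)%MS >].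
have P0 : exists a, P a.
  exists 0%N; apply/asboolP; exists 0; split; last exact: sub0mx.
  by apply/eqP/matrixP=> [] [].
have Pn a : P a -> (a <= n)%N.
  move=> /asboolP[W [/orthonormal_rank + _]]; rewrite /row_free => /eqP <-.
  exact: rank_leq_col.
case: (ex_maxnP P0 Pn) => a /asboolP[W [WW WC]] amax.
exists a, W; split=> // u v uC vC uW vW.
pose D := (C :&: kermx W^*)%MS.
have inD (x : 'rV_n) : (x <= C)%MS -> x *m W^* = 0 -> (x <= D)%MS.
  by move=> xC xW; rewrite sub_capmx xC; apply/sub_kermxP.
apply: (@isotropic_orthogonal _ _ D); try exact: inD.
move=> w; rewrite sub_capmx => /andP[wC /sub_kermxP wW].
apply/eqP; apply: contraT => ww0.
pose c := (w *m w^*) 0 0.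
have c0 : c != 0.
  apply: contraNneq ww0 => c0; apply/eqP/matrixP=> i j.
  by rewrite !ord1 -/c c0 mxE.
have /tau_norm[z zc] : tau c^-1 = c^-1 by rewrite fmorphV form_herm.
suff /amax : P (a + 1)%N by rewrite addn1 ltnn.
apply/asboolP; exists (col_mx W (z *: w)); split; last first.
  by rewrite col_mx_sub WC scalemx_sub.
apply: orthonormal_add => //; last by rewrite -scalemxAl wW scaler0.
apply/eqP; rewrite ctrZ -scalemxAl -scalemxAr scalerA zc.
by apply/matrixP=> i j; rewrite !ord1 mxE -/c mulVf // mxE.
Qed.

(** What a maximal orthonormal family leaves is totally isotropic, hence is the
    radical: every finite dimensional hermitian space has the form V_{a,b}. *)
Lemma hermitian_classification k n (A : 'M[K]_(k, n)) :
  exists a b (W : 'M[K]_(a, n)) (R : 'M[K]_(b, n)),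
    [/\ orthonormal W, R *m W^* = 0, R *m R^* = 0, row_free (col_mx W R)
      & (col_mx W R :=: A)%MS].
Proof.
have [a [W [WW WA Wmax]]] := maximal_orthonormal A.
pose D := (A :&: kermx W^*)%MS.
have [b [R [Rfree RD]]] : exists b (R : 'M_(b, n)), row_free R /\ (R :=: D)%MS.
  by exists _, (row_base D); split; [apply: row_base_free | apply: eq_row_base].
have DA : (R <= A)%MS by rewrite RD capmxSl.
have DW : R *m W^* = 0 by apply/sub_kermxP; rewrite RD capmxSr.
exists a, b, W, R; split => //.
- apply/matrixP=> i j; rewrite [RHS]mxE.
  have -> : (R *m R^*) i j = (row i R *m (row j R)^*) 0 0.
    by rewrite !mxE; apply: eq_bigr => l _; rewrite !mxE.
  have rA l : (row l R <= A)%MS by apply: submx_trans (row_sub _ _) DA.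
  have rW l : row l R *m W^* = 0 by rewrite -row_mul DW row0.
  by rewrite (Wmax _ _ (rA i) (rA j)) ?mxE.
- apply: inj_row_free => v; rewrite -[v]hsubmxK mul_row_col.
  move=> e0; have /eqP : (lsubmx v *m W + rsubmx v *m R) *m W^* = 0.
    by rewrite e0 mul0mx.
  rewrite mulmxDl -!mulmxA DW (eqP WW) mulmx1 mulmx0 addr0 => /eqP l0.
  move: e0; rewrite l0 mul0mx add0r => /eqP.
  by rewrite mulmx_free_eq0 // => /eqP ->; rewrite row_mx0.
- apply/eqmxP/andP; split; first by rewrite col_mx_sub WA.
  apply/row_subP=> i; set u := row i A.
  have uA : (u <= A)%MS := row_sub _ _.
  have -> : u = (u *m W^*) *m W + (u - (u *m W^*) *m W) by rewrite addrCA subrr addr0.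
  apply: addmx_sub; first by rewrite (submx_trans (submxMl _ _)) // -addsmxE addsmxSl.
  apply: submx_trans (_ : (R <= _)%MS); last by rewrite -addsmxE addsmxSr.
  rewrite RD sub_capmx; apply/andP; split.
    by rewrite addmx_sub // -scaleN1r scalemx_sub // (submx_trans (submxMl _ _)).
  by apply/sub_kermxP; rewrite mulmxBl -!mulmxA (eqP WW) mulmx1 subrr.
Qed.

Hypothesis two_neq0 : (2%:R : K) != 0.

(** Since the rows of W and R are free, some S orthogonal to W is dual to R; the
    Gram matrix of S can be changed at will by adding multiples of R. *)
Lemma hyperbolic_completion a b n (W : 'M[K]_(a, n)) (R : 'M[K]_(b, n)) :
  orthonormal W -> R *m W^* = 0 -> R *m R^* = 0 -> row_free (col_mx W R) ->
  exists S : 'M_(b, n), [/\ W *m S^* = 0, R *m S^* = 1%:M & S *m S^* = 0].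
Proof.
move=> WW RW RR fr.
have [S0] := row_free_ctr_solve (col_mx (0 : 'M_(a, b)) 1%:M) fr.
rewrite mul_col_mx => /eq_col_mx[WS RS].
have WR : W *m R^* = 0 by rewrite -[LHS]ctrK ctrM ctrK RW ctr0.
have SR : S0 *m R^* = 1%:M by rewrite -[LHS]ctrK ctrM ctrK RS ctr1.
(* S S^* is removed by subtracting half of it along R, the dual of S *)
pose Z := 2%:R^-1 *: (S0 *m S0^*).
have Zh : Z^* = Z by rewrite /Z ctrZ ctrM ctrK fmorphV rmorph_nat.
exists (S0 - Z *m R); rewrite ctrB ctrM Zh; split.
- by rewrite mulmxBr mulmxA WS WR mul0mx subrr.
- by rewrite mulmxBr mulmxA RS RR mul0mx subr0.
- rewrite mulmxBl !mulmxBr !mulmxA SR -[in Z *m R *m S0^*]mulmxA RS.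
  rewrite -[in Z *m R *m R^*]mulmxA RR mulmx0 mul0mx subr0 mulmx1 mul1mx.
  rewrite -addrA -opprD /Z -scalerDl -[2%:R^-1]div1r -mulrDl.
  by rewrite -(natrD K 1 1) divff // scale1r subrr.
Qed.

(** The rows of W, of R and of the dual S of R have an invertible Gram matrix, so
    an orthonormal basis of their orthogonal completes them to a basis of the
    whole space. Its Gram matrix depends on a, b and c only, which is what makes
    isometric families conjugate. *)
Lemma standard_completion a b n (W : 'M[K]_(a, n)) (R : 'M[K]_(b, n)) :
  orthonormal W -> R *m W^* = 0 -> R *m R^* = 0 -> row_free (col_mx W R) ->
  exists c (X : 'M_(c + (b + (a + b)), n)),
    [/\ dsubmx (dsubmx X) = col_mx W R, c + (b + (a + b)) = n,
     X *m X^* = block_mx 1%:M 0 0 (block_mx 0 (row_mx 0 1%:M)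
        (col_mx 0 1%:M) (block_mx 1%:M 0 0 0))
     & row_free X]%N.
Proof.
move=> WW RW RR fr.
have [S [WS RS SS]] := hyperbolic_completion WW RW RR fr.
have SW : S *m W^* = 0 by rewrite -[LHS]ctrK ctrM ctrK WS ctr0.
have SR : S *m R^* = 1%:M by rewrite -[LHS]ctrK ctrM ctrK RS ctr1.
have WR : W *m R^* = 0 by rewrite -[LHS]ctrK ctrM ctrK RW ctr0.
pose M := col_mx S (col_mx W R).
have MM : M *m M^* = block_mx 0 (row_mx 0 1%:M) (col_mx 0 1%:M)
    (block_mx 1%:M 0 0 0).
  rewrite /M !ctr_col mul_col_row mul_mx_row mul_col_mx SS SW SR WS RS.
  by rewrite mul_col_row (eqP WW) RW RR WR.
have [c [Q [QQ QC Qmax]]] := maximal_orthonormal (kermx M^*).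
have QM : Q *m M^* = 0 by apply/sub_kermxP.
have MQ : M *m Q^* = 0 by rewrite -[LHS]ctrK ctrM ctrK QM ctr0.
exists c, (col_mx Q M).
have GG : col_mx Q M *m (col_mx Q M)^* =
    block_mx 1%:M 0 0 (block_mx 0 (row_mx 0 1%:M)
        (col_mx 0 1%:M) (block_mx 1%:M 0 0 0)).
  by rewrite ctr_col mul_col_row (eqP QQ) QM MQ MM.
have Xfree : row_free (col_mx Q M).
  apply: inj_row_free => v e0.
  have : v *m (col_mx Q M *m (col_mx Q M)^*) = 0 by rewrite mulmxA e0 mul0mx.
  rewrite GG -[v]hsubmxK -[rsubmx v]hsubmxK -[rsubmx (rsubmx v)]hsubmxK.
  move: (lsubmx v) (lsubmx (rsubmx v)) (lsubmx (rsubmx (rsubmx v)))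
    (rsubmx (rsubmx (rsubmx v))) => v1 v2 v3 v4.
  rewrite !mul_row_block !mul_row_col !mul_mx_row !mulmx0 !mulmx1 !add0r !addr0.
  rewrite add_row_mx !add0r !addr0 -[0]hsubmxK => /eq_row_mx[-> ].
  rewrite -[rsubmx 0]hsubmxK => /eq_row_mx[->].
  rewrite -[rsubmx (rsubmx 0)]hsubmxK => /eq_row_mx[-> ->].
  by rewrite !linear0 !row_mx0.
have Xfull : row_full (col_mx Q M).
  (* a vector orthogonal to Q and M is orthogonal to the whole space *)
  rewrite /row_full -rank_ctr -[X in _ == X](mxrank1 K).
  apply/eqP; have : row_free (col_mx Q M)^*.
    apply: inj_row_free => v e0.
    move: e0; rewrite ctr_col mul_mx_row -[0]row_mx0 => /eq_row_mx[vQ vM].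
    have inC (u : 'rV_n) : u *m M^* = 0 -> (u <= kermx M^*)%MS.
      by move=> uM; apply/sub_kermxP.
    suff orth u : v *m (u : 'rV_n)^* = 0.
      apply/rowP=> i; rewrite mxE.
      have /matrixP/(_ 0 0) := orth (delta_mx 0 i).
      rewrite !mxE (bigD1 i) //= big1 ?addr0 => [|j ji].
        by rewrite !mxE !eqxx rmorph1 mulr1.
      by rewrite !mxE (negPf ji) andbF rmorph0 mulr0.
    (* the part of u along M, read off from the Gram matrix of M *)
    have [uc ucE] : exists x : 'rV_(b + (a + b)), (u - x *m M) *m M^* = 0.
      pose y := u *m M^*.
      exists (row_mx (rsubmx (rsubmx y)) (row_mx (lsubmx (rsubmx y)) (lsubmx y))).
      rewrite mulmxBl -mulmxA MM !mul_row_block !mul_row_col !mul_mx_row.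
      rewrite !mulmx0 !mulmx1 !add0r !addr0 add_row_mx !add0r !addr0.
      by rewrite !hsubmxK subrr.
    pose w := u - uc *m M; pose w' := w - (w *m Q^*) *m Q.
    have -> : u = w' + (w *m Q^*) *m Q + uc *m M by rewrite /w' subrK subrK.
    rewrite (ctrD _ (uc *m M)) (ctrD w') !ctrM !mulmxDr.
    rewrite 2!(mulmxA v) vQ vM !mul0mx !addr0.
    apply: Qmax => //; first exact: inC.
      by apply: inC; rewrite mulmxBl ucE -(mulmxA (w *m Q^*)) QM mulmx0 subr0.
    by rewrite mulmxBl -(mulmxA (w *m Q^*)) (eqP QQ) mulmx1 subrr.
  by rewrite /row_free mxrank1 => /eqP.
split=> //; first by rewrite !col_mxKd.
by move: Xfree Xfull; rewrite /row_free /row_full => /eqP -> /eqP.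
Qed.

(** Witt's theorem for families of vectors. Expressed in bases of the spans,
    both families extend to bases with the same Gram matrix G = X X^* = Y Y^*,
    and X^-1 Y is the unitary matrix looked for. *)
Lemma witt_matrix k n (A B : 'M[K]_(k, n)) :
  A *m A^* = B *m B^* -> (forall v : 'rV_k, v *m A = 0 <-> v *m B = 0) ->
  exists U : 'M_n, U *m U^* = 1%:M /\ A *m U = B.
Proof.
move=> AB kAB.
have kerAB p (Z : 'M_(p, k)) : Z *m A = 0 <-> Z *m B = 0.
  split=> e0; apply/row_matrixP=> i; rewrite row_mul row0; apply/kAB;
    by rewrite -row_mul e0 row0.
have [a [b [W [R [WW RW RR fr spanA]]]]] := hermitian_classification A.
have /submxP[L LA] : (col_mx W R <= A)%MS by rewrite spanA.
have /submxP[N AN] : (A <= col_mx W R)%MS by rewrite spanA.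
have BN : B = N *m (L *m B).
  apply/eqP; rewrite -subr_eq0 mulmxA -{1}[B]mul1mx -mulmxBl; apply/eqP.
  by apply/kerAB; rewrite mulmxBl mul1mx -mulmxA -LA -AN subrr.
have frB : row_free (L *m B).
  apply: inj_row_free => v; rewrite mulmxA => /kerAB.
  by rewrite -mulmxA -LA => /eqP; rewrite mulmx_free_eq0 // => /eqP.
pose W' := usubmx (L *m B); pose R' := dsubmx (L *m B).
have LB : L *m B = col_mx W' R' by rewrite vsubmxK.
have : (L *m B) *m (L *m B)^* = (col_mx W R) *m (col_mx W R)^*.
  by rewrite LA !ctrM !mulmxA -[L *m B *m _]mulmxA -AB !mulmxA.
rewrite LB !ctr_col !mul_col_row => /eq_block_mx[WW' WR' RW' RR'].
have oW' : orthonormal W' by rewrite /orthonormal WW'.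
have := @standard_completion _ _ _ W' R' oW'; rewrite -LB RW' RR' => /(_ RW RR frB).
have [c [X [XA cn XX frX]]] := standard_completion WW RW RR fr.
case=> d [Y [YB dn YY frY]].
have cd : c = d by apply/eqP; rewrite -(eqn_add2r (b + (a + b))) cn dn.
subst d.
have XY : X *m X^* = Y *m Y^* by rewrite XX YY.
suff [U [UU XU]] : exists U : 'M_n, U *m U^* = 1%:M /\ X *m U = Y.
  exists U; split=> //.
  have := congr1 (fun Z => dsubmx (dsubmx Z)) XU.
  by rewrite -!mul_dsub_mx XA YB => LU; rewrite {1}AN -mulmxA LU -BN.
clear XX YY XA YB dn.
move: (c + (b + (a + b)))%N cn X Y frX frY XY => p pn.
subst p => X Y; rewrite !row_free_unit => uX uY XY.
exists (invmx X *m Y); split; last by rewrite mulKVmx.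
rewrite ctrM mulmxA -[_ *m Y *m _]mulmxA -XY mulmxA mulVmx // mul1mx.
by rewrite -ctrM mulVmx // ctr1.
Qed.

End HermitianMatrices.

(** * Norms and traces of the quadratic extension *)

Section QuadraticExtension.
Variables (F : finFieldType) (K : quadExt F).
Local Notation q := #|F|.
Local Notation Kf := (finvect_type K).
Local Notation tau := (qe_tau K : K -> K).

Lemma card_quad : #|{: Kf}| = (q ^ 2)%N.
Proof. by rewrite -(card_vspacef (Vector.class Kf)) card_vspace (qe_dim K). Qed.

Lemma tau_base (a : F) : tau a%:A = a%:A.
Proof. by rewrite linearZ rmorph1. Qed.

Lemma tau_moves : exists d : K, d != 0 /\ tau d = - d.
Proof.
case: (qe_tau_nontriv K) => x /eqP xN; exists (x - tau x); split.
  by rewrite subr_eq0 eq_sym.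
by rewrite rmorphB /= tauK opprB.
Qed.

Lemma tau_fixedP (x : K) : tau x = x -> exists a : F, x = a%:A.
Proof.
move=> tx; case: (EM (exists a : F, x = a%:A)) => // xF; case: (qe_tau_nontriv K).
move=> y []; suff [a [b ->]] : exists a b : F, y = a%:A + b *: x.
  by rewrite rmorphD /= tau_base linearZ /= tx.
have x1 : x \notin <[1 : K]>%VS by apply/negP=> /vlineP[a xa]; apply: xF; exists a.
have fullE : (<[1 : K]> + <[x]>)%VS = fullv.
  apply/eqP; rewrite eqEdim subvf (qe_dim K) /=.
  rewrite dimv_disjoint_sum ?dim_vline ?oner_eq0 //.
    by have [x0|//] := eqVneq x 0; move: x1; rewrite x0 mem0v.
  apply/eqP; rewrite -subv0; apply/subvP => w.
  rewrite memv_cap => /andP[/vlineP[a ->] /vlineP[b eab]].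
  have [b0|b0] := eqVneq b 0; first by rewrite eab b0 scale0r mem0v.
  case/negP: x1; apply/vlineP; exists (b^-1 * a).
  by rewrite -scalerA eab scalerA mulVf // scale1r.
have: y \in (<[1 : K]> + <[x]>)%VS by rewrite fullE memvf.
by case/memv_addP => _ /vlineP[a ->] [_ /vlineP[b ->] ->]; exists a, b.
Qed.

Definition fixedK := [set x : Kf | tau x == x].

Lemma in_fixedK (x : Kf) : (x \in fixedK) = (tau x == x).
Proof. by rewrite inE. Qed.

Definition fixedK1 := fixedK :\ (0 : Kf).

Lemma in_fixedK1 (x : Kf) : (x \in fixedK1) = ((x : K) != 0) && (tau x == x).
Proof. by rewrite !inE. Qed.

Lemma card_fixedK : #|fixedK| = q.
Proof.
rewrite -cardsT -(card_imset _ (fmorph_inj (in_alg K) : @injective Kf F (fun a => a%:A))).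
apply: (@eq_card Kf) => x; rewrite in_fixedK.
apply/eqP/imsetP => [/tau_fixedP[a ->]|[a _ ->]]; last exact: tau_base.
by exists a.
Qed.

Lemma card_fixedK1 : #|fixedK1| = q.-1.
Proof. by rewrite -card_fixedK (cardsD1 (0 : Kf) fixedK) in_fixedK raddf0 eqxx. Qed.

Definition trace0 := [set x : Kf | (x : K) + tau x == 0].

Lemma in_trace0 (x : Kf) : (x \in trace0) = ((x : K) + tau x == 0).
Proof. by rewrite inE. Qed.

Lemma card_trace0 : #|trace0| = q.
Proof.
have [d [d0 td]] := tau_moves; rewrite -card_fixedK.
rewrite -[RHS](card_imset _ (mulIf d0 : @injective Kf Kf (fun x => x * d))).
apply: (@eq_card Kf) => x.
rewrite in_trace0 [X in X == _]addrC addr_eq0.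
apply/eqP/imsetP => [tx|[y]].
  exists (x / d); last by rewrite divfK.
  by rewrite in_fixedK rmorphM fmorphV /= td tx invrN mulrNN.
by rewrite in_fixedK => /eqP ty ->; rewrite rmorphM /= td ty mulrN.
Qed.

Definition norm_fibre (c : K) := [set x : Kf | x * tau x == c].

Lemma in_norm_fibre (c : K) (x : Kf) : (x \in norm_fibre c) = (x * tau x == c).
Proof. by rewrite inE. Qed.

(** Hilbert 90: x |-> x / tau x maps the q^2 - 1 units onto the elements of
    norm 1, and its fibres are the lines over the base field. *)
Lemma card_norm1 : #|norm_fibre 1| = q.+1.
Proof.
have q1 : (0 < q.-1)%N by rewrite -subn1 subn_gt0 finNzRing_gt1.
apply/eqP; rewrite -(eqn_pmul2r q1); apply/eqP.
have [d [d0 td]] := tau_moves.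
have units : #|[set x : Kf | x != 0]| = (q ^ 2).-1.
  by rewrite -card_quad -(cardC1 (0 : Kf)); apply: eq_card => x; rewrite !inE.
transitivity (q ^ 2).-1; last by rewrite -!subn1 -[q.+1]addn1 mulnC -subn_sqr exp1n.
rewrite -units -[RHS]sum1_card.
rewrite (partition_big (fun x : Kf => (x / tau x : K) : Kf)
  (fun z => z \in norm_fibre 1)) /=; last first.
  move=> x; rewrite inE in_norm_fibre => x0; apply/eqP.
  by rewrite rmorphM fmorphV /= tauK mulrA divfK ?divff // fmorph_eq0.
rewrite -sum_nat_const; apply: eq_bigr => z; rewrite in_norm_fibre => /eqP zz.
have z0 : z != 0 by apply/eqP => z0; move: zz; rewrite z0 mul0r => /eqP;
  rewrite eq_sym oner_eq0.
have [x1 [x0 x1z]] : exists x1 : K, x1 != 0 /\ x1 = z * tau x1.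
  have [z1|z1] := eqVneq z (-1).
    by exists d; rewrite d0 td z1 mulrN mulN1r opprK.
  exists (1 + z); split; first by rewrite addrC -[1]opprK subr_eq0.
  by rewrite rmorphD rmorph1 mulrDr zz mulr1 addrC.
have tx1 : tau x1 = x1 / z by rewrite -[LHS](mulKf z0) -x1z mulrC.
rewrite sum1dep_card -card_fixedK1; apply: esym.
rewrite -[RHS](card_imset _ (mulIf x0 : @injective Kf Kf (fun x => x * x1))).
apply: (@eq_card Kf) => x; rewrite inE; apply/andP/imsetP => [[]|[y]].
  rewrite inE => x0'.
  move=> /eqP xz; exists (x / x1); last by rewrite divfK.
  rewrite in_fixedK1 mulf_neq0 ?invr_eq0 //; apply/eqP.
  rewrite rmorphM fmorphV /= tx1 -xz.
  have alg (a b c : K) : a != 0 -> b != 0 -> c != 0 -> b / (c / (a / b)) = a / c.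
    by move=> a0 b0 c0; field; rewrite a0 b0 c0.
  by apply: alg; rewrite ?fmorph_eq0.
rewrite in_fixedK1 => /andP[y0 /eqP ty] ->.
rewrite inE mulf_neq0 //; split=> //; apply/eqP.
have alg (a b c : K) : a != 0 -> b != 0 -> c != 0 -> a * b / (a * (b / c)) = c.
  by move=> a0 b0 c0; field; rewrite a0 b0 c0.
by rewrite rmorphM /= ty tx1; apply: alg.
Qed.

(** There are q - 1 nonzero candidates for norms of the q^2 - 1 units, and each
    is attained at most q + 1 times: hence exactly so many times. *)
Lemma card_norm_fibre (c : K) :
  tau c = c -> c != 0 -> #|norm_fibre c| = q.+1.
Proof.
have le d : d != 0 -> (#|norm_fibre d| <= q.+1)%N.
  move=> d0; case: (set_0Vmem (norm_fibre d)) => [->|[x]]; first by rewrite cards0.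
  rewrite in_norm_fibre => /eqP xd; rewrite -card_norm1.
  have x0 : x != 0 by apply: contraNneq d0 => x0; rewrite -xd x0 mul0r.
  have xi : x^-1 != 0 by rewrite invr_eq0.
  rewrite -(card_imset _ (mulIf xi : @injective Kf Kf (fun y => y * x^-1))).
  apply/subset_leq_card/fintype.subsetP => _ /imsetP[y + ->].
  rewrite !in_norm_fibre => /eqP yd; apply/eqP.
  rewrite rmorphM fmorphV /= mulrACA yd -xd -invfM divff // mulf_neq0 ?fmorph_eq0 //.
move=> tc c0.
have sumE : \sum_(d in fixedK1) #|norm_fibre d|
    = \sum_(d in fixedK1) q.+1.
  rewrite sum_nat_const card_fixedK1.
  transitivity (q ^ 2).-1; last by rewrite -!subn1 -[q.+1]addn1 -subn_sqr exp1n.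
  rewrite -card_quad -(cardC1 (0 : Kf)) -[RHS]sum1_card.
  rewrite [RHS](partition_big (fun x : Kf => (x * tau x : K) : Kf)
    (fun z => z \in fixedK1)) /=; last first.
    move=> x; rewrite in_fixedK1 => x0.
    by rewrite mulf_neq0 ?fmorph_eq0 //= rmorphM /= tauK mulrC.
  apply: eq_bigr => z; rewrite in_fixedK1 => /andP[z0 _].
  rewrite sum1dep_card; apply: (@eq_card Kf) => x; rewrite in_norm_fibre inE.
  rewrite inE /=; case: eqP => [xz|]; rewrite ?andbF ?andbT //.
  by apply/esym; apply: contraNneq z0 => x0; rewrite -xz x0 mul0r.
have : leqif (\sum_(d in fixedK1) #|norm_fibre d|)
    (\sum_(d in fixedK1) q.+1)
    [forall (d | d \in fixedK1), #|norm_fibre d| == q.+1].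
  apply: leqif_sum => d; rewrite in_fixedK1 => /andP[d0 _].
  by split; rewrite ?le.
move=> [_]; rewrite sumE eqxx => /esym /forall_inP/(_ c) h; apply/eqP/h.
by rewrite in_fixedK1 c0 tc eqxx.
Qed.

Lemma norm_surj (c : K) : tau c = c -> exists z : K, z * tau z = c.
Proof.
move=> tc; have [->|c0] := eqVneq c 0; first by exists 0; rewrite mul0r.
have : (0 < #|norm_fibre c|)%N by rewrite card_norm_fibre.
by case/card_gt0P=> x; rewrite in_norm_fibre => /eqP; exists x.
Qed.

Lemma trace_nontriv : exists a : K, a + tau a != 0.
Proof.
case: (EM (exists a : K, a + tau a != 0)) => // no.
have : (#|trace0| < #|{: Kf}|)%N.
  by rewrite card_trace0 card_quad -[X in (X < _)%N]expn1 ltn_exp2l // finNzRing_gt1.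
rewrite (_ : #|trace0| = #|{: Kf}|) ?ltnn //; apply: eq_card => x.
rewrite in_trace0 [RHS]inE; apply: contra_notT no => h.
by exists x.
Qed.

Lemma quad_two_neq0 : odd q -> (2%:R : K) != 0.
Proof.
move=> oq; apply/eqP => two.
have : (1%R : F) *+ q = 0.
  (* translation by 1 permutes F *)
  have : \sum_(x : F) (x + 1) = \sum_(x : F) x.
    by rewrite [RHS](reindex_inj (addIr (1 : F))).
  by rewrite big_split /= sumr_const -[RHS]addr0 => /addrI.
rewrite -(odd_double_half q) oq -mul2n mulrnDr mulrnA.
have -> : (1%R : F) *+ 2 = 0.
  by apply: (fmorph_inj (in_alg K)); rewrite rmorph_nat two raddf0.
by rewrite mul0rn addr0 => /eqP; rewrite oner_eq0.
Qed.

End QuadraticExtension.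

(** * The hermitian space V and its unitary group *)

Section HermitianSpace.
Variables (F : finFieldType) (oddF : odd #|F|) (K : quadExt F).
Variables (V : hspace K) (e : nat -> V) (eP : orthonormal_basis e).
Local Notation q := #|F|.
Local Notation tau := (qe_tau K : K -> K).
Local Notation "A ^*" := (ctr (qe_tau K) A) : ring_scope.
Implicit Types (v w : V) (A B : seq V) (g h : unitary V).

Lemma hformDl x y z : hform (x + y : V) z = hform x z + hform y z.
Proof. by rewrite -[x in LHS]scale1r hform_linl rmorph1 mul1r. Qed.

Lemma hformDr x y z : hform (z : V) (x + y) = hform z x + hform z y.
Proof. by rewrite -[x in LHS]scale1r hform_linr mul1r. Qed.

Lemma hform0l z : hform (0 : V) z = 0.
Proof. by apply: (addrI (hform 0 z)); rewrite -hformDl !addr0. Qed.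

Lemma hform0r z : hform (z : V) 0 = 0.
Proof. by apply: (addrI (hform z 0)); rewrite -hformDr !addr0. Qed.

Lemma hformZl a x z : hform (a *: x : V) z = tau a * hform x z.
Proof. by rewrite -[a *: x]addr0 hform_linl hform0l addr0. Qed.

Lemma hformZr a x z : hform (z : V) (a *: x) = a * hform z x.
Proof. by rewrite -[a *: x]addr0 hform_linr hform0r addr0. Qed.

Lemma hform_suml I r (P : pred I) (f : I -> V) z :
  hform (\sum_(i <- r | P i) f i) z = \sum_(i <- r | P i) hform (f i) z.
Proof. exact: (big_morph (fun x => hform x z) (fun x y => hformDl x y z) (hform0l z)). Qed.

Lemma hform_sumr I r (P : pred I) (f : I -> V) z :
  hform z (\sum_(i <- r | P i) f i) = \sum_(i <- r | P i) hform z (f i).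
Proof. exact: (big_morph (hform z) (fun x y => hformDr x y z) (hform0r z)). Qed.

Lemma basis_form i j : hform (e i) (e j) = (i == j)%:R.
Proof. by case: eP. Qed.

Definition vec m (x : 'rV[K]_m) : V := \sum_(i < m) x 0 i *: e i.
Definition coord m (v : V) : 'rV[K]_m := \row_i hform (e i) v.

Lemma vec_linear m : linear (@vec m).
Proof.
move=> a x y; rewrite /vec scaler_sumr -big_split /=; apply: eq_bigr => i _.
by rewrite !mxE scalerDl scalerA.
Qed.
HB.instance Definition _ m :=
  GRing.isLinear.Build K 'rV[K]_m V *:%R (@vec m) (@vec_linear m).

Lemma coord_linear m : linear (@coord m).
Proof. by move=> a x y; apply/rowP=> i; rewrite !mxE hform_linr. Qed.
HB.instance Definition _ m :=
  GRing.isLinear.Build K V 'rV[K]_m *:%R (@coord m) (@coord_linear m).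

Lemma hform_basis_vec m i (x : 'rV[K]_m) :
  hform (e i) (vec x) = if insub i is Some k then x 0 k else 0.
Proof.
rewrite hform_sumr; under eq_bigr => k _ do rewrite hformZr basis_form.
case: insubP => [k _ <-|im].
  rewrite (bigD1 k) //= eqxx mulr1 big1 ?addr0 // => l.
  by rewrite -val_eqE eq_sym => /negPf ->; rewrite mulr0.
apply: big1 => k _; case: eqP => [ik|_]; last by rewrite mulr0.
by rewrite ik ltn_ord in im.
Qed.

Lemma vecK m : cancel (@vec m) (@coord m).
Proof. by move=> x; apply/rowP=> i; rewrite mxE hform_basis_vec valK. Qed.

Lemma vec_inj m : injective (@vec m).
Proof. exact: can_inj (@vecK m). Qed.

Lemma hform_vec m (x : 'rV[K]_m) v : hform (vec x) v = (coord m v *m x^*) 0 0.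
Proof.
rewrite hform_suml mxE; apply: eq_bigr => i _.
by rewrite hformZl !mxE mulrC.
Qed.

Lemma hform_vecr m (x : 'rV[K]_m) v : hform v (vec x) = (x *m (coord m v)^*) 0 0.
Proof.
by rewrite -(hform_herm (vec x)) hform_vec (form_herm (@tauK _ _)).
Qed.

Definition inV m v := vec (coord m v) = v.

Lemma vecE m (x : 'rV[K]_m) : vec x = \sum_(i < m) x 0 i *: e i.
Proof. by []. Qed.

Lemma inV0 m : inV m 0.
Proof. by rewrite /inV !linear0. Qed.

Lemma inV_vec m (x : 'rV[K]_m) : inV m (vec x).
Proof. by rewrite /inV vecK. Qed.

Lemma inV_form m v i : inV m v -> (m <= i)%N -> hform (e i) v = 0.
Proof. by move=> <- mi; rewrite hform_basis_vec insubF // ltnNge mi. Qed.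

Lemma expand_basis v : exists m, inV m v.
Proof.
case: eP => /(_ v)[m [c ->]] _ _; exists m.
have -> : \sum_(i < m) c i *: e i = vec (\row_(i < m) c i).
  by apply: eq_bigr => i _; rewrite mxE.
exact: inV_vec.
Qed.

Lemma basis_nondeg v : (forall i, hform (e i) v = 0) -> v = 0.
Proof.
case: (expand_basis v) => m vm v0; rewrite -vm.
have -> : coord m v = 0 by apply/rowP=> i; rewrite !mxE.
exact: linear0.
Qed.

Lemma inVP m v : inV m v <-> forall i, (m <= i)%N -> hform (e i) v = 0.
Proof.
split=> [vm i|v0]; first exact: inV_form.
apply/eqP; rewrite -subr_eq0; apply/eqP/basis_nondeg => i.
rewrite hformDr -scaleN1r hformZr mulN1r hform_basis_vec.
by case: insubP => [k _ <-|]; rewrite ?mxE ?subrr // -leqNgt => /v0 ->; rewrite subrr.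
Qed.

Lemma inV_le m n v : (m <= n)%N -> inV m v -> inV n v.
Proof. by move=> mn /inVP vm; apply/inVP => i ni; apply: vm; apply: leq_trans ni. Qed.

Lemma inV_basis m i : inV m (e i) <-> (i < m)%N.
Proof.
split=> [/inVP vm|im].
  by rewrite ltnNge; apply/negP=> /vm/eqP; rewrite basis_form eqxx oner_eq0.
by apply/inVP=> j mj; rewrite basis_form gtn_eqF // (leq_trans im).
Qed.

Lemma inV_seq A : exists m, {in A, forall v, inV m v}.
Proof.
elim: A => [|v A [m IH]]; first by exists 0%N.
have [n vn] := expand_basis v; exists (maxn m n) => w.
rewrite inE => /predU1P[->|/IH wm]; first by apply: inV_le vn; apply: leq_maxr.
by apply: inV_le wm; apply: leq_maxl.
Qed.

Section UnitaryMatrix.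
Variables (m : nat) (U : 'M[K]_m).
(** The operator with matrix U on V_m which is the identity on the orthogonal of
    V_m, in one formula for both. *)
Definition mxact (v : V) : V := v + vec (coord m v *m (U - 1%:M)).

Lemma mxact_linear : linear mxact.
Proof.
move=> a v w; rewrite /mxact linearP mulmxDl -scalemxAl linearP /=.
by rewrite scalerDr addrACA.
Qed.

Lemma coord_mxact v : coord m (mxact v) = coord m v *m U.
Proof. by rewrite /mxact linearD /= vecK mulmxBr mulmx1 addrC subrK. Qed.

Lemma mxact_form v w : U *m U^* = 1%:M -> hform (mxact v) (mxact w) = hform v w.
Proof.
move=> UU; rewrite /mxact; set x := coord m v; set y := coord m w.
rewrite hformDl !hformDr !hform_vec !hform_vecr vecK -!addrA.
rewrite -[RHS]addr0; congr (_ + _).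
have addE (M N : 'M[K]_1) : M 0 0 + N 0 0 = (M + N) 0 0 by rewrite mxE.
rewrite !addE -/x -/y; set D := U - 1%:M.
suff -> : y *m D *m x^* + (y *m (x *m D)^* + y *m D *m (x *m D)^*) = 0.
  by rewrite mxE.
have DD : D + (D^* + D *m D^*) = 0.
  rewrite /D ctrB ctr1 mulmxBr mulmxBl UU mulmx1 mul1mx.
  by rewrite -[1%:M - _]opprB -opprD addrA [_ + (U - _)]addrC subrr.
move: D DD => D DD.
transitivity (y *m (D + (D^* + D *m D^*)) *m x^*).
  by rewrite ctrM !mulmxDr !mulmxDl !mulmxA.
by rewrite DD mulmx0 mul0mx.
Qed.
End UnitaryMatrix.


Lemma mxactK m (U U' : 'M[K]_m) : U *m U' = 1%:M -> cancel (mxact U) (mxact U').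
Proof.
move=> UU v; rewrite {1}/mxact coord_mxact /mxact -addrA -linearD /=.
rewrite -(mulmxA _ U) -mulmxDr (_ : U - 1%:M + _ = 0).
  by rewrite mulmx0 linear0 addr0.
by rewrite mulmxBr UU mulmx1 addrA subrK subrr.
Qed.

Lemma unitary_of_mx m (U : 'M[K]_m) : U *m U^* = 1%:M ->
  exists g : unitary V, forall v, g v = mxact U v.
Proof.
move=> UU; have UU' := mulmx1C UU.
have surj y : exists x, Embedding (mxact_linear U) (can_inj (mxactK UU))
    (fun v w => mxact_form v w UU) x = y.
  by exists (mxact U^* y); rewrite /= mxactK.
by exists (Unitary surj).
Qed.

Lemma mxact_vec m (U : 'M[K]_m) (x : 'rV[K]_m) : mxact U (vec x) = vec (x *m U).
Proof. by rewrite /mxact vecK -linearD /= mulmxBr mulmx1 addrC subrK. Qed.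

Lemma mxact_fix m (U : 'M[K]_m) v : coord m v = 0 -> mxact U v = v.
Proof. by rewrite /mxact => ->; rewrite mul0mx linear0 addr0. Qed.

Lemma coord_basis m i : (m <= i)%N -> coord m (e i) = 0.
Proof.
by move=> mi; apply/rowP=> k; rewrite !mxE basis_form ltn_eqF // (leq_trans _ mi).
Qed.

Definition lincomb A (c : nat -> K) : V := \sum_(i < size A) c i *: A`_i.
Definition span A v := exists c, v = lincomb A c.
Definition fixes A g := {in A, forall v, g v = v}.

(** Coordinates in V_m reduce this to matrices. The operator found also fixes the
    basis vectors outside V_m, so that it preserves V_m: this matters for counting
    in V_m. *)
Lemma witt m A B : size A = size B ->
  {in A, forall v, inV m v} -> {in B, forall v, inV m v} ->
  (forall i j, (i < size A)%N -> (j < size A)%N ->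
    hform A`_i A`_j = hform B`_i B`_j) ->
  (forall c, lincomb A c = 0 <-> lincomb B c = 0) ->
  exists g, map g A = B /\ forall i, (m <= i)%N -> g (e i) = e i.
Proof.
move=> sAB Am Bm gramAB kerAB; set k := size A.
pose mx (C : seq V) := (\matrix_(i < k) coord m C`_i).
have formE C i j : {in C, forall v, inV m v} -> (i < size C)%N ->
    hform C`_i C`_j = (coord m C`_j *m (coord m C`_i)^*) 0 0.
  by move=> Cm iC; rewrite -{1}(Cm _ (mem_nth 0 iC)) hform_vec.
have gramE C (i j : 'I_k) : size C = k -> {in C, forall v, inV m v} ->
    (mx C *m (mx C)^*) i j = hform C`_j C`_i.
  move=> sC Cm; rewrite formE ?sC // !mxE; apply: eq_bigr => l _.
  by rewrite !mxE.
have lincombE C (x : 'rV[K]_k) (c : nat -> K) : size C = k -> {in C, forall v, inV m v} ->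
    (forall i : 'I_k, x 0 i = c i) -> lincomb C c = vec (x *m mx C).
  move=> sC Cm xc; rewrite /lincomb sC mulmx_sum_row linear_sum.
  apply: eq_bigr => i _; rewrite linearZ /= rowK xc.
  by rewrite (Cm _ (mem_nth 0 _)) // sC.
have norm' (c : K) : tau c = c -> exists z : K, z * tau z = c := @norm_surj _ _ c.
have [||U [UU AU]] := @witt_matrix K (qe_tau K) (@tauK _ _) norm'
    (@trace_nontriv _ K) (quad_two_neq0 K oddF) k m (mx A) (mx B).
- apply/matrixP=> i j; rewrite !gramE //; exact: gramAB.
- move=> x; pose c i := if insub i is Some j then x 0 (j : 'I_k) else 0.
  have xc (i : 'I_k) : x 0 i = c i by rewrite /c valK.
  have := kerAB c; rewrite !(lincombE _ x) //.
  case=> AB0 BA0; split=> x0; apply: (@vec_inj m); rewrite linear0.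
    by apply: AB0; rewrite x0 linear0.
  by apply: BA0; rewrite x0 linear0.
have [g gE] := unitary_of_mx UU; exists g; split.
  apply: (@eq_from_nth _ 0); rewrite size_map // => i iA.
  rewrite (nth_map 0) // gE -(Am _ (mem_nth 0 iA)) mxact_vec.
  have := congr1 (fun M => row (Ordinal iA) M) AU.
  rewrite row_mul !rowK /= => ->; apply: Bm; rewrite mem_nth // -sAB //.
by move=> i mi; rewrite gE mxact_fix // coord_basis.
Qed.


Lemma embD (U W : hspace K) (f : embedding U W) x y : f (x + y) = f x + f y.
Proof. by have := emb_linear f 1 x y; rewrite !scale1r. Qed.

Lemma emb0 (U W : hspace K) (f : embedding U W) : f 0 = 0.
Proof. by apply: (addrI (f 0)); rewrite -embD !addr0. Qed.

Lemma embZ (U W : hspace K) (f : embedding U W) a x : f (a *: x) = a *: f x.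
Proof. by have := emb_linear f a x 0; rewrite emb0 !addr0. Qed.

Lemma emb_lincomb g A c : g (lincomb A c) = lincomb (map g A) c.
Proof.
rewrite /lincomb (big_morph g (embD g) (emb0 g)) size_map.
by apply: eq_bigr => i _; rewrite embZ (nth_map 0).
Qed.

Lemma lincomb_cons v A c : lincomb (v :: A) c = c 0%N *: v + lincomb A (c \o S).
Proof. by rewrite /lincomb /= big_ord_recl. Qed.

Lemma lincombD A c c' : lincomb A (fun i => c i + c' i) = lincomb A c + lincomb A c'.
Proof. by rewrite /lincomb -big_split; apply: eq_bigr => i _; rewrite scalerDl. Qed.

Lemma lincombZ A a c : lincomb A (fun i => a * c i) = a *: lincomb A c.
Proof. by rewrite /lincomb scaler_sumr; apply: eq_bigr => i _; rewrite scalerA. Qed.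

Lemma span0 A : span A 0.
Proof.
exists (fun=> 0); rewrite /lincomb big1 // => i _; exact: scale0r.
Qed.

Lemma spanD A v w : span A v -> span A w -> span A (v + w).
Proof. by case=> c -> [c' ->]; eexists; rewrite -lincombD. Qed.

Lemma spanZ A a v : span A v -> span A (a *: v).
Proof. by case=> c ->; eexists; rewrite -lincombZ. Qed.

Lemma span_consP v A w : span (v :: A) w <-> exists a, span A (w - a *: v).
Proof.
split=> [[c ->]|[a [c wE]]].
  by exists (c 0%N), (c \o S); rewrite lincomb_cons addrC addKr.
exists (fun i => if i is j.+1 then c j else a); rewrite lincomb_cons /=.
by rewrite -[X in _ + X](_ : lincomb A c = _) // -wE addrC subrK.
Qed.

Lemma span_mem A v : v \in A -> span A v.
Proof.
elim: A => // w A IH; rewrite inE span_consP => /predU1P[->|/IH vA].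
  by exists 1; rewrite scale1r subrr; apply: span0.
by exists 0; rewrite scale0r subr0.
Qed.

Lemma lincomb_span A B c : {in A, forall v, span B v} -> span B (lincomb A c).
Proof.
elim: A c => [|v A IH] c AB; first by rewrite /lincomb big_ord0; apply: span0.
rewrite lincomb_cons; apply: spanD; first by apply/spanZ/AB/mem_head.
by apply: IH => w wA; apply: AB; rewrite inE wA orbT.
Qed.

Lemma span_sub A B v : {in A, forall v, span B v} -> span A v -> span B v.
Proof. by move=> AB [c ->]; apply: lincomb_span. Qed.

Lemma fixes_span A g v : fixes A g -> span A v -> g v = v.
Proof.
by move=> gA [c ->]; rewrite emb_lincomb (_ : map g A = A) // map_id_in.
Qed.

Lemma inV_span m A v : {in A, forall v, inV m v} -> span A v -> inV m v.
Proof.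
move=> Am [c ->]; apply/inVP => i mi; rewrite hform_sumr big1 // => j _.
by rewrite hformZr (inV_form (Am _ (mem_nth 0 (ltn_ord j)))) ?mulr0.
Qed.

(** Outside the span of A, a vector of given type is free of linear relations with
    A, so that v :: A and w :: A are isometric families: one point extensions are
    classified by their type. *)
Lemma same_type_conjugate A v w : ~ span A v -> ~ span A w ->
  {in A, forall a, hform a v = hform a w} -> hform v v = hform w w ->
  exists g, fixes A g /\ g v = w.
Proof.
move=> vA wA same_products norm.
have [m vwm] := inV_seq (v :: w :: A).
have free x c : ~ span A x -> lincomb (x :: A) c = 0 -> c 0%N = 0.
  move=> xA; rewrite lincomb_cons => /eqP; rewrite addrC addr_eq0 => /eqP cE.
  apply/eqP; apply: contra_notT xA => c0.
  rewrite -[x]scale1r -(mulVf c0) -scalerA -[c 0%N *: x]opprK -cE -scaleN1r.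
  by do 2!apply: spanZ; exists (c \o S).
have typ' : {in A, forall a, hform v a = hform w a}.
  by move=> a aA; rewrite -[LHS]hform_herm -[RHS]hform_herm same_products.
have [|||||g [[gv gA] _]] := @witt m (v :: A) (w :: A).
- by [].
- by move=> x; rewrite inE => /predU1P[->|xA]; apply: vwm; rewrite !inE ?eqxx ?xA ?orbT.
- by move=> x; rewrite inE => /predU1P[->|xA]; apply: vwm; rewrite !inE ?eqxx ?xA ?orbT.
- move=> [|i] [|j] //= iA jA; first by apply: typ'; rewrite mem_nth.
  by apply: same_products; rewrite mem_nth.
- move=> c; split=> c0.
    by move: (c0); rewrite !lincomb_cons (free v) // !scale0r.
  by move: (c0); rewrite !lincomb_cons (free w) // !scale0r.
exists g; split=> // a aA; rewrite -[in LHS](nth_index 0 aA).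
by rewrite -(nth_map 0 0 g) ?index_mem // gA nth_index.
Qed.

Lemma norm_real v : tau (hform v v) = hform v v.
Proof. exact: hform_herm. Qed.

(** A multiple of e_N has any given nonzero norm, and e_N + z e_(N+1) is isotropic
    when z has norm -1. *)
Lemma perp_vector N d : tau d = d ->
  exists v, [/\ v != 0, coord N v = 0 & hform v v = d].
Proof.
move=> td; suff [a [b [ab abd]]] : exists a b : K, a != 0 /\ a * tau a + b * tau b = d.
  exists (a *: e N + b *: e N.+1).
  have h i : hform (e i) (a *: e N + b *: e N.+1) = a * (i == N)%:R + b * (i == N.+1)%:R.
    by rewrite hformDr !hformZr !basis_form.
  split.
  - apply: contraNneq ab => v0; apply/eqP.
    by have := h N; rewrite v0 hform0r eqxx ltn_eqF // mulr1 mulr0 addr0.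
  - apply/rowP=> i; rewrite !mxE h !ltn_eqF ?mulr0 ?addr0 //.
    by rewrite ltnS ltnW.
  - have Nn : (N == N.+1) = false by rewrite ltn_eqF.
    rewrite hformDl !hformZl !h !eqxx [N.+1 == N]eq_sym Nn.
    by rewrite !mulr1 !mulr0 addr0 add0r -abd ![tau _ * _]mulrC.
have [->|d0] := eqVneq d 0.
  have /norm_surj[z zz] : tau (-1) = -1 :> K by rewrite rmorphN1.
  by exists 1, z; rewrite oner_eq0 rmorph1 mulr1 zz subrr.
have [z zd] := norm_surj td; exists z, 0; rewrite mul0r addr0 zd; split=> //.
by apply: contraNneq d0 => z0; rewrite -zd z0 mul0r.
Qed.

Lemma perp_form N u v : inV N u -> coord N v = 0 -> hform u v = 0.
Proof. by move=> <- v0; rewrite hform_vec v0 mul0mx mxE. Qed.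

Lemma perp_form' N u v : inV N u -> coord N v = 0 -> hform v u = 0.
Proof. by move=> uN v0; rewrite -hform_herm (perp_form uN v0) raddf0. Qed.

Lemma perp_notin N u v : coord N v = 0 -> v != 0 -> inV N u -> ~ inV N (u + v).
Proof.
move=> v0 vN0 uN; rewrite /inV !linearD /= uN v0 linear0 => /addrI v00.
by rewrite -v00 eqxx in vN0.
Qed.

(** Adding to v an isotropic vector orthogonal to A and v does not change its type
    over A, so v is moved by G(A) if it is outside the span. *)
Lemma span_of_fixed A v : (forall g, fixes A g -> g v = v) -> span A v.
Proof.
move=> vfix; case: (EM (span A v)) => // vA.
have [N AN] := inV_seq (v :: A).
have vN : inV N v by apply: AN; rewrite mem_head.
have AN' : {in A, forall a, inV N a} by move=> a aA; apply: AN; rewrite inE aA orbT.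
have [n [n0 Nn nn]] : exists n, [/\ n != 0, coord N n = 0 & hform n n = 0].
  by apply: perp_vector; rewrite raddf0.
have vnA : ~ span A (v + n) by move=> /(inV_span AN'); apply: perp_notin.
have [||g [gA gv]] := same_type_conjugate vA vnA.
- by move=> a /AN' aN; rewrite hformDr (perp_form aN Nn) addr0.
- by rewrite hformDl !hformDr (perp_form vN Nn) (perp_form' vN Nn) nn !addr0.
by move: gv; rewrite vfix // -[LHS]addr0 => /addrI n00; rewrite -n00 eqxx in n0.
Qed.

Definition basis m : seq V := mkseq e m.

Lemma inV_basis_seq m : {in basis m, forall v, inV m v}.
Proof. by move=> v /mapP[i]; rewrite mem_iota => im ->; apply/inV_basis. Qed.

Lemma span_basisP m v : span (basis m) v <-> inV m v.
Proof.
split=> [|<-]; first exact/inV_span/inV_basis_seq.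
exists (fun i => hform (e i) v); rewrite /lincomb size_mkseq.
by apply: eq_bigr => i _; rewrite mxE nth_mkseq.
Qed.

Lemma fixed_inV m v : (forall g, fixes (basis m) g -> g v = v) <-> inV m v.
Proof.
split=> [/span_of_fixed/span_basisP //|vm g gm].
by apply: fixes_span gm _; apply/span_basisP.
Qed.

Lemma fixes_subP A B : (forall g, fixes A g -> fixes B g) <->
  {in B, forall v, span A v}.
Proof.
split=> [AB v vB|BA g gA v /BA vA]; last exact: fixes_span gA vA.
by apply: span_of_fixed => g /AB; apply.
Qed.

End HermitianSpace.

(** * Classes of maps between orbits *)

Section OrbitClasses.
Variables (F : finFieldType) (oddF : odd #|F|) (K : quadExt F).
Variables (V : hspace K) (e : nat -> V) (eP : orthonormal_basis e).
Local Notation Kf := (finvect_type K).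
Implicit Types (v w : V) (A B C : seq V) (g h k : unitary V).

Lemma umulE g h v : (g * h)%g v = g (h v). Proof. by []. Qed.

Lemma map_umul g h A : map (g * h)%g A = map g (map h A).
Proof. by rewrite -map_comp. Qed.

Lemma map_u1 A : map (1%g : unitary V) A = A.
Proof. exact: map_id. Qed.

Lemma map_uinvK g A : map g^-1%g (map g A) = A.
Proof. by rewrite -map_umul mulVg map_u1. Qed.

Lemma map_uKinv g A : map g (map g^-1%g A) = A.
Proof. by rewrite -map_umul mulgV map_u1. Qed.

Lemma fixes_mapP A g : fixes A g <-> map g A = A.
Proof.
split=> [gA|gA]; first by rewrite map_id_in.
by apply/eq_in_map; rewrite gA map_id.
Qed.

Lemma fixesV A g : fixes A g -> fixes A g^-1%g.
Proof. by rewrite !fixes_mapP => {1}<-; rewrite map_uinvK. Qed.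

Lemma fixes_cat A B g : fixes (A ++ B) g <-> fixes A g /\ fixes B g.
Proof.
split=> [gAB|[gA gB] v]; last by rewrite mem_cat => /orP[/gA|/gB].
by split=> v vA; apply: gAB; rewrite mem_cat vA ?orbT.
Qed.

Lemma fixes_cons v A g : fixes (v :: A) g <-> g v = v /\ fixes A g.
Proof.
split=> [gvA|[gv gA] w]; last by rewrite inE => /predU1P[->|/gA].
by split=> [|w wA]; apply: gvA; rewrite inE ?eqxx ?wA ?orbT.
Qed.

Lemma countable_vectors : exists c : V -> nat, injective c.
Proof.
pose m v := projT1 (cid (expand_basis eP v)).
have mP v : inV e (m v) v by rewrite /m; case: cid.
exists (fun v => pickle [seq (hform (e i) v : Kf) | i <- iota 0 (m v)]) => v w.
move/(pcan_inj pickleK) => vw.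
have mvw : m v = m w by have := congr1 size vw; rewrite !size_map !size_iota.
rewrite -(mP v) -(mP w) -mvw; congr vec; apply/rowP=> i; rewrite !mxE.
by rewrite -mvw in vw; move/eq_in_map: vw; apply; rewrite mem_iota /=.
Qed.

Lemma countable_families : exists c : seq V -> nat, injective c.
Proof.
have [c ci] := countable_vectors; exists (fun A => pickle (map c A)) => A B.
by move/(pcan_inj pickleK)/(inj_map ci).
Qed.

Definition stab (X : smoothset V) (x : X) A :=
  forall g, ss_act g x = x <-> fixes A g.

(** The orbit of a finite family is coded by natural numbers, its members being
    determined by finitely many coordinates in a finite field. *)
Lemma orbit_exists A : exists (X : smoothset V) (x : X), stab x A.
Proof.
have [c ci] := countable_families.
pose P n := exists g, c (map g A) = n.
pose T : Set := {n : nat | P n}.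
have Tinj (x y : T) : sval x = sval y -> x = y.
  by case: x y => [x px] [y py] /= xy; subst y; congr exist; apply: Prop_irrelevance.
pose wit (x : T) := projT1 (cid (svalP x)).
have witP x : c (map (wit x) A) = sval x by rewrite /wit; case: cid.
pose act g (x : T) : T :=
  exist P (c (map (g * wit x)%g A)) (ex_intro _ (g * wit x)%g erefl).
have svalA g x : sval (act g x) = c (map (g * wit x)%g A) by [].
have witA g x : map (wit (act g x)) A = map g (map (wit x) A).
  by apply: ci; rewrite witP svalA map_umul.
have act1 x : act 1%g x = x by apply: Tinj; rewrite svalA mul1g witP.
have actM g h x : act (g * h)%g x = act g (act h x).
  by apply: Tinj; rewrite !svalA -mulgA !map_umul witA.
pose bp : T := exist P (c A) (ex_intro _ 1%g (congr1 c (map_u1 A))).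
have bpA : map (wit bp) A = A by apply: ci; rewrite witP.
have tr0 x : act (wit x) bp = x.
  by apply: Tinj; rewrite svalA map_umul bpA witP.
have tr x y : exists g, act g x = y.
  by exists (wit y * (wit x)^-1)%g; rewrite -{2}(tr0 x) -actM mulgVK tr0.
have stabP x g : act g x = x <-> fixes (map (wit x) A) g.
  rewrite fixes_mapP -witA; split=> [->//|xE].
  by apply: Tinj; rewrite -[in RHS]witP -xE witP.
exists (@SmoothSet _ _ V T act act1 actM (inhabits bp) tr
  (fun x => ex_intro _ (map (wit x) A) (stabP x))), bp.
by move=> g; rewrite -{3}bpA; apply: stabP.
Qed.

Lemma stab_exists (X : smoothset V) (x : X) : exists A, stab x A.
Proof. exact: ss_smooth. Qed.

Lemma stab_act (X : smoothset V) (x : X) A g : stab x A -> stab (ss_act g x) (map g A).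
Proof.
move=> xA h; rewrite fixes_mapP -map_umul -ss_actM.
have -> : ss_act (h * g)%g x = ss_act g x <-> ss_act (g^-1 * (h * g))%g x = x.
  rewrite [X in _ <-> X = _]ss_actM; split=> [->|gx].
    by rewrite -ss_actM mulVg ss_act1.
  by rewrite -[in RHS]gx -[RHS]ss_actM mulgV ss_act1.
rewrite xA fixes_mapP (map_umul g^-1%g); split=> [|->]; last exact: map_uinvK.
by move=> /(congr1 (map g)); rewrite map_uKinv.
Qed.

Lemma stab_eq (X : smoothset V) (x : X) A g h : stab x A ->
  ss_act g x = ss_act h x <-> map g A = map h A.
Proof.
move=> xA; have := xA (h^-1 * g)%g; rewrite fixes_mapP map_umul ss_actM => hg.
split=> [ghx|ghA].
  have gA : map h^-1%g (map g A) = A.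
    by apply/hg; rewrite ghx -ss_actM mulVg ss_act1.
  by rewrite -[in RHS]gA map_uKinv.
have gx : ss_act h^-1%g (ss_act g x) = x by apply/hg; rewrite ghA map_uinvK.
by rewrite -[in RHS]gx -[RHS]ss_actM mulgV ss_act1.
Qed.

Lemma gmap_exists (Y X : smoothset V) (y : Y) (x : X) A B :
  stab y B -> stab x A -> (forall g, fixes B g -> fixes A g) ->
  exists f : gmap Y X, f y = x.
Proof.
move=> yB xA BA.
pose wit z := projT1 (cid (ss_trans y z)).
have witP z : ss_act (wit z) y = z by rewrite /wit; case: cid.
have eq_act g h : ss_act g y = ss_act h y -> ss_act g x = ss_act h x.
  move=> gh; have : ss_act (h^-1 * g)%g y = y.
    by rewrite ss_actM gh -ss_actM mulVg ss_act1.
  move=> /yB/BA/xA; rewrite ss_actM => {2}<-.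
  by rewrite -ss_actM mulgV ss_act1.
have equi g z : ss_act (wit (ss_act g z)) x = ss_act g (ss_act (wit z) x).
  by rewrite -ss_actM; apply: eq_act; rewrite ss_actM !witP.
exists (GMap equi) => /=; rewrite -[RHS]ss_act1; apply: eq_act.
by rewrite witP ss_act1.
Qed.

Lemma gmap_eqP (Y X : smoothset V) (f f' : gmap Y X) : f =1 f' -> f = f'.
Proof.
case: f f' => [f fe] [f' fe'] /= /funext ff'; subst f'.
by congr GMap; apply: Prop_irrelevance.
Qed.

Lemma gmap_unique (Y X : smoothset V) (f f' : gmap Y X) y : f y = f' y -> f = f'.
Proof.
move=> ff'; apply: gmap_eqP => z; have [g <-] := ss_trans y z.
by rewrite !gm_equiv ff'.
Qed.

Lemma stab_map (Y X : smoothset V) (f : gmap Y X) y A B :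
  stab y B -> stab (f y) A -> forall g, fixes B g -> fixes A g.
Proof. by move=> yB xA g /yB gy; apply/xA; rewrite -gm_equiv gy. Qed.

Lemma theta_sym_iso (Y X : smoothset V) (f : gmap Y X) :
  bijective f -> theta_sym f = 1.
Proof. by move=> bf; apply/pr_classP/rc_rel/theta_iso. Qed.

Lemma theta_sym_comp (X Y Z : smoothset V) (f : gmap Y X) (g : gmap Z Y) :
  theta_sym (gm_comp f g) = theta_sym f * theta_sym g.
Proof. by rewrite [RHS]pr_mulE; apply/pr_classP/rc_rel/theta_comp. Qed.

Lemma pr_class_sum n (t : 'I_n -> rterm (symbol V)) :
  pr_class (@theta_rel _ _ V) (\big[@TAdd _/TZero]_(i < n) t i) =
  \sum_(i < n) (pr_class (@theta_rel _ _ V) (t i) : Theta V).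
Proof.
elim: n t => [|n IH] t; first by rewrite !big_ord0.
by rewrite !big_ord_recl -IH [RHS]pr_addE.
Qed.

Lemma theta_sym_base (X Y X' : smoothset V) (f : gmap Y X) (h : gmap X' X) n
    (Y' : 'I_n -> smoothset V) (g : forall i, gmap (Y' i) Y)
    (f' : forall i, gmap (Y' i) X') : orbit_decomposition f h g f' ->
  theta_sym f = \sum_(i < n) theta_sym (f' i).
Proof.
by move=> dec; rewrite -pr_class_sum; apply/pr_classP/rc_rel/(theta_base dec).
Qed.

Lemma bijective_of (Y X : smoothset V) (f : gmap Y X) y A B :
  stab y B -> stab (f y) A -> (forall g, fixes A g -> fixes B g) -> bijective f.
Proof.
move=> yB xA AB; have [f' f'y] := gmap_exists xA yB AB.
have e1 : gm_comp f' f = GMap (fun g (y : Y) => erefl (ss_act g y)).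
  by apply: (@gmap_unique _ _ _ _ y).
have e2 : gm_comp f f' = GMap (fun g (y : X) => erefl (ss_act g y)).
  by apply: (@gmap_unique _ _ _ _ (f y)); rewrite /= f'y.
exists f' => z; first exact: (congr1 (fun k : gmap _ _ => k z) e1).
exact: (congr1 (fun k : gmap _ _ => k z) e2).
Qed.

(** The class of the map of orbits G/G(B) -> G/G(A). Being chosen among the classes
    of all its presentations, it depends on the two stabilizers only. The default
    0 is taken when G(B) is not contained in G(A). *)
Definition orbit_class A B : Theta V := xget 0 [set t | exists (X Y : smoothset V)
  (f : gmap Y X) (y : Y), [/\ stab y B, stab (f y) A & t = theta_sym f]]%classic.

(** Orbits with the same stabilizer are isomorphic, and isomorphisms have class 1. *)
Lemma theta_sym_stab (X Y X' Y' : smoothset V) (f : gmap Y X) (f' : gmap Y' X')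
  y y' A B : stab y B -> stab (f y) A -> stab y' B -> stab (f' y') A ->
  theta_sym f = theta_sym f'.
Proof.
move=> yB xA yB' xA'.
have [a ay] := gmap_exists yB yB' (fun g => id).
have [b bx] := gmap_exists xA xA' (fun g => id).
have comm : gm_comp f' a = gm_comp b f.
  by apply: (@gmap_unique _ _ _ _ y); rewrite /= ay bx.
have := congr1 (@theta_sym _ _ _ _ _) comm; rewrite !theta_sym_comp.
rewrite (theta_sym_iso (f := a)); last by apply: (bijective_of yB (A := B)); rewrite ?ay.
rewrite (theta_sym_iso (f := b)); last by apply: (bijective_of xA (A := A)); rewrite ?bx.
by rewrite mulr1 mul1r.
Qed.

Lemma orbit_classE (X Y : smoothset V) (f : gmap Y X) y A B :
  stab y B -> stab (f y) A -> orbit_class A B = theta_sym f.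
Proof.
move=> yB xA; apply: xget_unique; first by exists X, Y, f, y.
move=> _ [X' [Y' [f' [y' [yB' xA' ->]]]]].
exact: theta_sym_stab yB' xA' yB xA.
Qed.

Lemma theta_symE (X Y : smoothset V) (f : gmap Y X) : exists A B,
  (forall g, fixes B g -> fixes A g) /\ theta_sym f = orbit_class A B.
Proof.
case: (ss_nonempty Y) => y.
have [A xA] := stab_exists (f y); have [B yB] := stab_exists y.
by exists A, B; split; [apply: stab_map yB xA | rewrite (orbit_classE yB xA)].
Qed.

Lemma orbit_class_model A B : (forall g, fixes B g -> fixes A g) ->
  exists (X Y : smoothset V) (f : gmap Y X) (y : Y), stab y B /\ stab (f y) A.
Proof.
move=> BA; have [Y [y yB]] := orbit_exists B; have [X [x xA]] := orbit_exists A.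
by have [f fy] := gmap_exists yB xA BA; exists X, Y, f, y; rewrite fy.
Qed.

Lemma eq_stab (X : smoothset V) (x : X) A A' :
  (forall g, fixes A g <-> fixes A' g) -> stab x A -> stab x A'.
Proof. by move=> AA xA g; rewrite xA. Qed.

Lemma eq_orbit_class A A' B B' : (forall g, fixes B g -> fixes A g) ->
  (forall g, fixes A g <-> fixes A' g) -> (forall g, fixes B g <-> fixes B' g) ->
  orbit_class A B = orbit_class A' B'.
Proof.
move=> /orbit_class_model[X [Y [f [y [yB xA]]]]] AA BB.
by rewrite (orbit_classE yB xA) (orbit_classE (eq_stab BB yB) (eq_stab AA xA)).
Qed.

Lemma orbit_class_conj A B g : (forall h, fixes B h -> fixes A h) ->
  orbit_class (map g A) (map g B) = orbit_class A B.
Proof.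
move=> /orbit_class_model[X [Y [f [y [yB xA]]]]].
rewrite (orbit_classE yB xA) (@orbit_classE _ _ f (ss_act g y)) //; first exact: stab_act.
by rewrite gm_equiv; apply: stab_act.
Qed.

Lemma orbit_class_iso A B : (forall g, fixes A g <-> fixes B g) -> orbit_class A B = 1.
Proof.
move=> AB; have [|X [Y [f [y [yB xA]]]]] := @orbit_class_model A B; first by move=> g /AB.
by rewrite (orbit_classE yB xA) theta_sym_iso //; apply: bijective_of yB xA _ => g /AB.
Qed.

Lemma orbit_class_comp A B C : (forall g, fixes B g -> fixes A g) ->
  (forall g, fixes C g -> fixes B g) -> orbit_class A C = orbit_class A B * orbit_class B C.
Proof.
move=> BA CB; have [Z [z zC]] := orbit_exists C.
have [Y [y yB]] := orbit_exists B; have [X [x xA]] := orbit_exists A.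
have [f fy] := gmap_exists yB xA BA; have [g gz] := gmap_exists zC yB CB.
rewrite (@orbit_classE _ _ f y A B) ?fy // (@orbit_classE _ _ g z B C) ?gz //.
by rewrite -theta_sym_comp (@orbit_classE _ _ (gm_comp f g) z A C) //= gz fy.
Qed.

(** Base change along G/G(C) -> G/G(A): the orbits of the fibre product with
    G/G(B) -> G/G(A) are those of the families g_i B together with C, where the
    g_i B represent the G(C)-orbits on the G(A)-orbit of B. *)
Lemma base_change A B C (I : finType) (r : I -> unitary V) :
  (forall g, fixes B g -> fixes A g) -> (forall g, fixes C g -> fixes A g) ->
  (forall i, fixes A (r i)) ->
  (forall g, fixes A g -> exists! i, exists k,
    fixes C k /\ map k (map (r i) B) = map g B) ->
  orbit_class A B = \sum_i orbit_class C (map (r i) B ++ C).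
Proof.
move=> BA CA rA orb.
have [Y [y yB]] := orbit_exists B; have [X [x xA]] := orbit_exists A.
have [X' [x' xC]] := orbit_exists C.
have [f fy] := gmap_exists yB xA BA; have [h hx] := gmap_exists xC xA CA.
pose D (j : 'I_#|I|) := map (r (enum_val j)) B ++ C.
have Y'ex j : {Y' : smoothset V & {z : Y' | stab z (D j)}}.
  by have /cid[Y' /cid yz] := orbit_exists (D j); exists Y'.
pose Y' j := projT1 (Y'ex j); pose z j : Y' j := sval (projT2 (Y'ex j)).
have zD j : stab (z j) (D j) := svalP (projT2 (Y'ex j)).
pose s (j : 'I_#|I|) := ss_act (r (enum_val j)) y.
have sB j : stab (s j) (map (r (enum_val j)) B) by apply: stab_act.
have gex j : {g : gmap (Y' j) Y | g (z j) = s j}.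
  apply: cid; apply: gmap_exists (zD j) (sB j) _ => g.
  by rewrite fixes_cat => -[].
have f'ex j : {f' : gmap (Y' j) X' | f' (z j) = x'}.
  apply: cid; apply: gmap_exists (zD j) xC _ => g.
  by rewrite fixes_cat => -[].
pose g j := sval (gex j); pose f' j := sval (f'ex j).
have gz j : g j (z j) = s j := svalP (gex j).
have f'z j : f' j (z j) = x' := svalP (f'ex j).
rewrite (@orbit_classE _ _ f y) ?fy // (@theta_sym_base _ _ _ f h _ Y' g f').
  rewrite (reindex _ (onW_bij _ (enum_val_bij I))); apply: eq_bigr => j _.
  by apply/esym/(orbit_classE (zD j)); rewrite f'z.
split=> [j w|y1 x1].
  have [k <-] := ss_trans (z j) w; rewrite !gm_equiv gz f'z hx /s gm_equiv fy.
  by congr ss_act; apply/xA.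
have [k0 <-] := ss_trans x' x1; have [g1 gy1] := ss_trans y y1.
rewrite gm_equiv hx => fy1.
have [g0 g1E] : exists g0, g1 = (k0 * g0)%g by exists (k0^-1 * g1)%g; rewrite mulVKg.
have y1E : y1 = ss_act (k0 * g0)%g y by rewrite -g1E.
have /orb[i [[k [kC kB]] iu]] : fixes A g0.
  apply/xA; rewrite -[LHS]ss_act1 -(mulVg k0) ss_actM -[ss_act k0 _]ss_actM -g1E.
  by rewrite -{1}fy -gm_equiv gy1 fy1 -ss_actM mulVg ss_act1.
pose j := enum_rank i.
have sE m j' : ss_act m (s j') = ss_act (m * r (enum_val j'))%g y by rewrite ss_actM.
exists (existT _ j (ss_act (k0 * k)%g (z j))); split=> /=.
  rewrite !gm_equiv gz f'z sE y1E; split.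
    by apply/(stab_eq _ _ yB); rewrite !map_umul enum_rankK kB.
  by apply/(stab_eq _ _ xC); rewrite map_umul (proj1 (fixes_mapP _ _) kC).
case=> j' w' /=; have [m <-] := ss_trans (z j') w'.
rewrite !gm_equiv gz f'z sE y1E => -[/(stab_eq _ _ yB) mB /(stab_eq _ _ xC) mC].
have ij : i = enum_val j'.
  apply: iu; exists (k0^-1 * m)%g; split.
    by apply/fixes_mapP; rewrite map_umul mC map_uinvK.
  by rewrite -map_umul -mulgA map_umul mB -map_umul mulKg.
have jj : j = j' by rewrite /j ij enum_valK.
subst j'; congr existT; apply/(stab_eq _ _ (zD j)); rewrite /D !map_cat.
congr (_ ++ _); last by rewrite map_umul (proj1 (fixes_mapP _ _) kC) mC.
by rewrite -[RHS]map_umul mB !map_umul {1}/j enum_rankK kB.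
Qed.

End OrbitClasses.

(** * Classes of one point extensions *)

Section OnePointClasses.
Variables (F : finFieldType) (oddF : odd #|F|) (K : quadExt F).
Variables (V : hspace K) (e : nat -> V) (eP : orthonormal_basis e).
Local Notation q := #|F|.
Local Notation Kf := (finvect_type K).
Local Notation tau := (qe_tau K : K -> K).
Local Notation coord := (coord e).
Local Notation vec := (vec e).
Local Notation inV := (inV e).
Local Notation E := (basis e).
Implicit Types (v : V) (A B C : seq V) (g h k : unitary V).

Lemma uinvK g v : (g^-1)%g (g v) = v.
Proof. by rewrite -umulE mulVg. Qed.

(** The default 0 is taken when d is not a norm. *)
Definition perp_vec N (d : K) : V :=
  if pselect (tau d = d) is left td then sval (cid (perp_vector eP N td)) else 0.

Lemma perp_vecP N d : tau d = d ->
  [/\ perp_vec N d != 0, coord N (perp_vec N d) =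
    0 & hform (perp_vec N d) (perp_vec N d) = d].
Proof. by move=> td; rewrite /perp_vec; case: pselect => // td'; case: cid. Qed.

Lemma fixes_coord N k v : fixes (E N) k -> coord N (k v) = coord N v.
Proof.
move=> kN; apply/rowP=> i; rewrite !mxE -{1}(kN (e i)) ?emb_form //.
by apply/mapP; exists (val i); rewrite // mem_iota /=.
Qed.

Lemma fixes_inV N k v : fixes (E N) k -> inV N v -> k v = v.
Proof. by move=> kN vN; apply: fixes_span kN _; apply/(span_basisP eP). Qed.

Lemma perp_decomp N v : coord N (v - vec (coord N v)) = 0.
Proof. by rewrite linearB /= (vecK eP) subrr. Qed.

Lemma perp_conj N w n n' : coord N n = 0 -> coord N n' = 0 ->
  n != 0 -> n' != 0 -> inV N w -> hform n n = hform n' n' ->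
  exists k, fixes (E N) k /\ k (w + n) = w + n'.
Proof.
move=> nN nN' n0 n0' wN nn.
have inE a : a \in E N -> inV N a by move/(inV_basis_seq eP).
apply: (same_type_conjugate oddF eP).
- by move/(span_basisP eP); apply: perp_notin.
- by move/(span_basisP eP); apply: perp_notin.
- by move=> a /inE aN; rewrite !hformDr (perp_form aN nN) (perp_form aN nN').
- rewrite !hformDl !hformDr (perp_form wN nN) (perp_form wN nN').
  by rewrite (perp_form' wN nN) (perp_form' wN nN') nn.
Qed.

(** The class of adjoining to V_N a nonzero vector of norm d orthogonal to it. *)
Definition perp_class N d : Theta V := orbit_class (E N) (perp_vec N d :: E N).

(** Adding the zero vector when d = 0 makes mu a measure of the whole set of
   vectors of norm d orthogonal to V_N. *)
Definition mu N d : Theta V := perp_class N d + (d == 0)%:R.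

Lemma muE N d : mu N d = perp_class N d + (d == 0)%:R.
Proof. by []. Qed.

Lemma perp_classE N v : v != 0 -> coord N v = 0 ->
  orbit_class (E N) (v :: E N) = perp_class N (hform v v).
Proof.
move=> v0 vN; have [p0 pN pp] := perp_vecP N (norm_real v).
have zN : inV N 0 by rewrite /inV !linear0.
have [k [kN]] := perp_conj vN pN v0 p0 zN (esym pp).
rewrite !add0r => kv; rewrite /perp_class -(orbit_class_conj eP k); last first.
  by move=> h /fixes_cons[].
by rewrite /= kv (proj1 (fixes_mapP _ _) kN).
Qed.

Definition vec_norm N (w : 'rV[Kf]_N) : K := hform (vec (w : 'rV[K]_N)) (vec (w :
  'rV[K]_N)).
Definition same_products N A v (w : 'rV[Kf]_N) : bool :=
  all (fun a => hform a (vec (w : 'rV[K]_N)) == hform a v) A.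
Definition in_span N A (w : 'rV[Kf]_N) : bool := `[< span A (vec (w : 'rV[K]_N)) >].

(** The class of adjoining v to A is computed after base change to V_N, where a
    vector of the type of v is the sum of some w in V_N of the same type and of a
    vector orthogonal to V_N making up for the norm. *)
Lemma one_point_class N A v : {in A, forall a, inV N a} -> ~ span A v ->
  orbit_class A (v :: A) = \sum_(w : 'rV[Kf]_N | same_products A v w) mu N (hform v v -
    vec_norm w)
    - #|[pred w : 'rV[Kf]_N | [&& same_products A v w,
      vec_norm w == hform v v & in_span A w]]|%:R.
Proof.
move=> AN vA; set c := hform v v.
pose P (wb : 'rV[Kf]_N * bool) :=
  same_products A v wb.1 && (wb.2 || (vec_norm wb.1 == c) && ~~ in_span A wb.1).
pose u (wb : 'rV[Kf]_N * bool) : V :=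
  vec (wb.1 : 'rV[K]_N) + (if wb.2 then perp_vec N (c - vec_norm wb.1) else 0).
have real_c (w : 'rV[Kf]_N) : tau (c - vec_norm w) =
  c - vec_norm w by rewrite rmorphB /= !norm_real.
have wN (w : 'rV[Kf]_N) : inV N (vec (w : 'rV[K]_N)) := inV_vec eP w.
have typE a wb : a \in A -> P wb -> hform a (u wb) = hform a v.
  move=> aA /andP[/allP/(_ a aA)/eqP <- _]; rewrite hformDr.
  case: wb.2; last by rewrite hform0r addr0.
  have [_ pN _] := perp_vecP N (real_c wb.1).
  by rewrite (perp_form (AN a aA) pN) addr0.
have normE wb : P wb -> hform (u wb) (u wb) = c.
  case: wb => w [] /andP[_] /=; last by rewrite /u /= addr0 => /andP[/eqP].
  move=> _; have [_ pN pp] := perp_vecP N (real_c w); rewrite /u /= hformDl !hformDr.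
  rewrite (perp_form (wN w) pN) (perp_form' (wN w) pN) pp addr0 add0r.
  by rewrite addrC subrK.
have spanE wb : P wb -> ~ span A (u wb).
  case: wb => w [] /andP[_] /=.
    move=> _ /(inV_span eP AN); have [p0 pN _] := perp_vecP N (real_c w).
    exact: perp_notin.
  by rewrite /u /= addr0 => /andP[_] /asboolP.
pose I : finType := {wb : 'rV[Kf]_N * bool | P wb}.
have rex (i : I) : {r : unitary V | fixes A r /\ r v = u (val i)}.
  apply: cid; apply: (same_type_conjugate oddF eP) => //.
  - exact: spanE (valP i).
  - by move=> a aA; rewrite typE // (valP i).
  - by rewrite normE // (valP i).
pose r i := sval (rex i).
have rA i : fixes A (r i) by case: (svalP (rex i)).
have rv i : r i v = u (val i) by case: (svalP (rex i)).
have subA g : fixes (v :: A) g -> fixes A g by case/fixes_cons.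
have subE g : fixes (E N) g -> fixes A g.
  by move=> gN a /AN; apply: fixes_inV.
have mapE g : fixes A g -> map g A = A by move/fixes_mapP.
rewrite (base_change eP subA subE rA); last first.
  move=> g gA; pose w := coord N (g v).
  have [n [gvE nN]] : exists n, g v = vec w + n /\ coord N n = 0.
    by exists (g v - vec w); rewrite perp_decomp [vec w + _]addrC subrK.
  have nn : hform n n = c - vec_norm w.
    rewrite /c -(emb_form g v v) gvE hformDl !hformDr (perp_form (wN w) nN).
    by rewrite (perp_form' (wN w) nN) addr0 add0r addrC addKr.
  have Pi : P (w, n != 0).
    apply/andP; split.
      apply/allP=> a aA /=; rewrite -(emb_form g a v) (gA a aA) gvE hformDr.
      by rewrite (perp_form (AN a aA) nN) addr0.
    case: eqVneq nn => //= n0; rewrite n0 hform0l => /esym/eqP.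
    rewrite subr_eq0 eq_sym => -> /=; apply/asboolP.
    have -> : vec w = g v by rewrite gvE n0 addr0.
    by move=> gvA; apply: vA; rewrite -[v](uinvK g) (fixes_span (fixesV gA) gvA).
  exists (exist (fun wb => P wb) (w, n != 0) Pi); split.
    suff [k [kN ku]] : exists k, fixes (E N) k /\ k (u (w, n != 0)) = g v.
      exists k; split=> //=; rewrite rv -[u _]/(u (w, n != 0)) ku.
      by rewrite (mapE _ gA) (mapE _ (rA _)) (mapE _ (subE _ kN)).
    rewrite /u gvE /=; case: (eqVneq n 0) => [->|n0] /=.
      by exists 1%g.
    have [p0 pN pp] := perp_vecP N (real_c w).
    by apply: perp_conj; rewrite ?pp.
  case=> -[w' b'] Pi' [k [kN /= [ku _]]]; apply: val_inj => /=.
  rewrite rv /u /= in ku.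
  have [p0 pN pp] := perp_vecP N (real_c w').
  have ww : w = w'.
    rewrite /w -ku fixes_coord // linearD /= (vecK eP).
    by case: (b'); rewrite ?pN ?linear0 addr0.
  subst w'; congr pair.
  move: ku; rewrite gvE embD (fixes_inV kN (wN w)) => /addrI <-.
  by case: (b'); rewrite ?emb0 ?eqxx // -(emb0 k) (inj_eq (@emb_inj _ _ _ _ k)).
have clE (i : I) : orbit_class (E N) (map (r i) (v :: A) ++ E N) =
    if (val i).2 then perp_class N (c - vec_norm (val i).1) else 1.
  case: i => -[w b] Pi /=; rewrite rv -[u _]/(u (w, b)) (mapE _ (rA _)).
  have fixE k : fixes (u (w, b) :: A ++ E N) k <->
      k (u (w, b)) = u (w, b) /\ fixes (E N) k.
    rewrite fixes_cons fixes_cat; split=> [[ku [_ kN]]|[ku kN]] //.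
    by split=> //; split=> //; apply: subE.
  have [p0 pN pp] := perp_vecP N (real_c w); case: b Pi fixE => /= Pi fixE.
    apply: (eq_orbit_class eP) => // k; first by case/fixE.
    rewrite fixE fixes_cons /u /=; split=> -[ku kN]; split=> //.
      by move: ku; rewrite embD (fixes_inV kN (wN w)) => /addrI.
    by rewrite embD ku (fixes_inV kN (wN w)).
  apply: (orbit_class_iso eP) => k; rewrite fixE /u /= addr0; split=> [kN|[]//].
  by split=> //; apply: fixes_inV kN (wN w).
rewrite (eq_bigr _ (fun i _ => clE i)) -(big_sub [pred wb | P wb]
  (fun wb => if wb.2 then perp_class N (c - vec_norm wb.1) else 1)) /=.
transitivity (\sum_(w : 'rV[Kf]_N | same_products A v w) \sum_(b :
  bool | b || (vec_norm w == c) && ~~ in_span A w)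
   if b then perp_class N (c - vec_norm w) else 1).
  by rewrite pair_big_dep /=; apply: eq_bigl => -[w b].
rewrite -sum1_card natr_sum -[LHS]addr0 -[RHS]addr0; apply/eqP.
rewrite !addr0 eq_sym subr_eq; apply/eqP.
rewrite [X in _ + X](_ : _ = \sum_(w : 'rV[Kf]_N | same_products A v w) ((vec_norm w ==
  c) && in_span A w)%:R); last first.
  by rewrite big_mkcondr /=; apply: eq_bigr => w _; case: ifP.
rewrite -big_split /=; apply: eq_bigr => w _.
rewrite /mu big_mkcond big_bool /= -addrA; congr (_ + _).
rewrite subr_eq0 eq_sym; case: eqP => //= _; last by rewrite addr0.
by case: in_span; rewrite ?addr0 ?add0r.
Qed.
End OnePointClasses.

(** * Generators of Theta after inverting q *)

Section Generation.
Variables (F : finFieldType) (oddF : odd #|F|) (K : quadExt F).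
Variables (V : hspace K) (e : nat -> V) (eP : orthonormal_basis e).
Local Notation q := #|F|.
Local Notation Kf := (finvect_type K).
Local Notation tau := (qe_tau K : K -> K).
Local Notation coord := (coord e).
Local Notation vec := (vec e).
Local Notation inV := (inV e).
Local Notation E := (basis e).
Implicit Types (v : V) (A B C : seq V) (g h k : unitary V).

Definition vec_count N d := #|[pred w : 'rV[Kf]_N | vec_norm e w == d]|.

Lemma vec_normE N (w : 'rV[Kf]_N) : vec_norm e w = \sum_i tau ((w :
  'rV[K]_N) 0 i) * (w : 'rV[K]_N) 0 i.
Proof.
rewrite /vec_norm hform_vec (vecK eP) mxE; apply: eq_bigr => i _.
by rewrite !mxE mulrC.
Qed.

Lemma vec_normZ N (a : K) (w : 'rV[Kf]_N) :
  vec_norm e ((a *: (w : 'rV[K]_N)) : 'rV[Kf]_N) = a * tau a * vec_norm e w.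
Proof. by rewrite /vec_norm linearZ /= hformZl hformZr mulrA [tau a * a]mulrC. Qed.

Lemma vec_count_scale N d : tau d = d -> d != 0 -> vec_count N d = vec_count N 1.
Proof.
move=> td d0; have [a ad] := norm_surj td.
have a0 : a != 0 by apply: contraNneq d0 => a0; rewrite -ad a0 mul0r.
have ai : injective (fun w : 'rV[Kf]_N => (a *: (w : 'rV[K]_N)) : 'rV[Kf]_N).
  exact: scalerI.
rewrite /vec_count -(on_card_preimset (f := fun w : 'rV[Kf]_N =>
  (a *: (w : 'rV[K]_N)) : 'rV[Kf]_N)); last exact: onW_bij (injF_bij ai).
apply: eq_card => w; rewrite !inE vec_normZ ad -[X in _ == X]mulr1.
exact: (inj_eq (mulfI d0)).
Qed.

(** The sum is over the first coordinate z of the vectors counted. *)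
Lemma vec_count_rec N d :
  vec_count N.+1 d = (\sum_(z : Kf) vec_count N (d - (z : K) * tau z)%R)%N.
Proof.
pose f (p : Kf * 'rV[Kf]_N) : 'rV[Kf]_(1 + N) :=
  @row_mx K _ _ _ ((p.1 : K)%:M) (p.2 : 'rV[K]_N).
pose f' (w : 'rV[Kf]_(1 + N)) : Kf * 'rV[Kf]_N :=
  (@lsubmx K _ _ _ w 0 0, @rsubmx K _ _ _ w).
have fK : cancel f f'.
  by case=> z w; rewrite /f /f' row_mxKl row_mxKr mxE eqxx.
have f'K : cancel f' f.
  by move=> w; rewrite /f /f' /= -mx11_scalar hsubmxK.
have nf p : vec_norm e (f p : 'rV[Kf]_N.+1) = (p.1 : K) * tau p.1 + vec_norm e p.2.
  rewrite !vec_normE big_ord_recl /=; congr (_ + _).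
    have -> : (f p : 'rV[K]_N.+1) 0 ord0 = p.1.
      have -> : ord0 = lshift N (0 : 'I_1) by apply: val_inj.
      by apply: etrans (@row_mxEl K 1 1 N _ _ 0 0) _; rewrite mxE eqxx.
    by rewrite mulrC.
  apply: eq_bigr => i _; have -> : (f p : 'rV[K]_N.+1) 0 (lift ord0 i) = (p.2 :
    'rV[K]_N) 0 i.
    have -> : lift ord0 i = rshift 1 i by apply: val_inj.
    exact: (@row_mxEr K 1 1 N).
  by [].
rewrite /vec_count -sum1_card (reindex f) /=; last by exists f' => w _.
rewrite (eq_bigl (fun p => vec_norm e p.2 == d - (p.1 : K) * tau p.1)); last first.
  by move=> p; rewrite [LHS]inE nf addrC eq_sym -subr_eq eq_sym.
rewrite -(pair_big_dep xpredT (fun (z : Kf) w => vec_norm e w == d - (z : K) * tau z)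
  (fun _ _ => 1%N)); apply: eq_bigr => z _.
by rewrite sum1_card; apply: eq_card => w; rewrite !inE.
Qed.


Lemma card_norm_fibre0 : #|norm_fibre (0 : K)| = 1%N.
Proof.
rewrite -(cards1 (0 : Kf)); apply: (@eq_card Kf) => z.
by rewrite in_norm_fibre mulf_eq0 fmorph_eq0 orbb inE.
Qed.

Lemma two_valued_sum (R : pzRingType) (I : finType) (P : pred I) (f : K -> R)
    (h : I -> K) (c : K) :
  (forall d, tau d = d -> d != 0 -> f d = f 1) ->
  (forall i, tau (h i) = h i) -> tau c = c ->
  \sum_(i | P i) f (c - h i) =
    #|P|%:R * f 1 + #|[pred i | P i && (h i == c)]|%:R * (f 0 - f 1).
Proof.
move=> f1 th tc; rewrite -!sum1_card !natr_sum !mulr_suml big_mkcondr -big_split /=.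
apply: eq_bigr => i _; rewrite mul1r; case: eqP => [->|hc].
  by rewrite subrr mul1r addrC subrK.
rewrite addr0; apply: f1; first by rewrite rmorphB /= th tc.
by rewrite subr_eq0 eq_sym; apply/eqP.
Qed.

Lemma norm_of_real (z : K) : tau (z * tau z) = z * tau z.
Proof. by rewrite rmorphM /= tauK mulrC. Qed.

Lemma vec_count_recE N d : tau d = d ->
  (vec_count N.+1 d)%:R = q%:R ^+ 2 * (vec_count N 1%R)%:R +
    #|norm_fibre d|%:R * ((vec_count N 0%R)%:R - (vec_count N 1%R)%:R) :> int.
Proof.
move=> td; rewrite vec_count_rec natr_sum.
rewrite (two_valued_sum (I := Kf) xpredT (f := fun d => (vec_count N d)%:R)
  (h := fun z => (z : K) * tau z)) //; last exact: norm_of_real.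
  rewrite -natrX -(card_quad K); congr (_ + _ * _); congr (_%:R).
  by apply: eq_card => z; rewrite in_norm_fibre inE.
by move=> d' td' d0; rewrite vec_count_scale.
Qed.

Lemma vec_count0 d : vec_count 0 d = (d == 0).
Proof.
have n0 (w : 'rV[Kf]_0) : vec_norm e w = 0 by rewrite vec_normE big_ord0.
rewrite /vec_count eq_sym; case: eqP => [d0|/eqP d0].
  rewrite eq_cardT -?cardE ?card_mx ?muln0 ?expn0 //.
  by move=> w; rewrite !inE n0 -d0 eqxx.
by rewrite (eq_card0) // => w; rewrite !inE n0 (negPf d0).
Qed.

(** The recursion multiplies n(0) - n(1) by -q and n(0) + (q - 1) n(1), the number
    of all vectors, by q^2. *)
Lemma vec_countE N :
  (vec_count N 0%R)%:R - (vec_count N 1%R)%:R = (- q%:R) ^+ N :> int /\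
  q%:R * (vec_count N 1%R)%:R = q%:R ^+ (2 * N) - (- q%:R) ^+ N :> int.
Proof.
elim: N => [|N [IH1 IH2]].
  by rewrite !vec_count0 eqxx oner_eq0 !expr0 subr0 subrr mulr0.
have e0 := @vec_count_recE N 0 (raddf0 _); have e1 := @vec_count_recE N 1 (rmorph1 _).
rewrite card_norm_fibre0 in e0; rewrite (card_norm1 K) in e1.
rewrite e0 e1 IH1 -[q.+1%:R]natr1 {e0 e1 IH1}.
move: (q%:R : int) ((vec_count N 1%R)%:R : int) IH2 => Q n IH.
rewrite mulnS exprD [(- Q) ^+ N.+1]exprS; move: ((- Q) ^+ N) (Q ^+ (2 * N)) IH => D QN IH.
split; first by ring.
rewrite mulrDr mulrCA IH; ring.
Qed.

Lemma fixes_span_eq A B : {in A, forall v, span B v} -> {in B, forall v, span A v} ->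
  forall g, fixes A g <-> fixes B g.
Proof.
move=> AB BA g; split=> gf v vin; apply: (fixes_span gf); [exact: BA|exact: AB].
Qed.

Lemma span_cat A B v : span A v -> span (B ++ A) v.
Proof. by apply: span_sub => w wA; apply: span_mem; rewrite mem_cat wA orbT. Qed.

Lemma span_cons A w v : span A v -> span (w :: A) v.
Proof. exact: (@span_cat A [:: w]). Qed.

Local Notation mu := (mu eP).
Local Notation pcl := (perp_class eP).

(** Rescaling a vector does not change what it spans together with V_N. *)
Lemma mu_scale N d : tau d = d -> d != 0 -> mu N d = mu N 1.
Proof.
move=> td d0; rewrite !muE (negPf d0) oner_eq0; congr (_ + _).
have [p0 pN pp] := perp_vecP eP N (rmorph1 (qe_tau K)).
have [a ad] := norm_surj td.
have a0 : a != 0 by apply: contraNneq d0 => a0; rewrite -ad a0 mul0r.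
set p := perp_vec eP N 1 in p0 pN pp *.
have -> : pcl N d = orbit_class (E N) (a *: p :: E N).
  rewrite (perp_classE oddF eP) ?linearZ /= ?pN ?scaler0 ?scaler_eq0 ?negb_or ?a0 //.
  by rewrite hformZl hformZr pp mulr1 mulrC ad.
have -> : pcl N 1 = orbit_class (E N) (p :: E N) by [].
apply: (eq_orbit_class eP) => [g /fixes_cons[]//|//|]; apply: fixes_span_eq => v;
  rewrite inE => /predU1P[->|vE]; try exact/span_cons/span_mem.
  by apply: spanZ; apply: span_mem; rewrite mem_head.
by rewrite -[p in span _ p](scalerK a0); apply: spanZ; apply: span_mem; rewrite mem_head.
Qed.

Definition sigma N : Theta V := mu N 0 - mu N 1.

Lemma one_point_classE N A v : {in A, forall a, inV N a} -> ~ span A v ->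
  orbit_class A (v :: A) = #|[pred w : 'rV[Kf]_N | same_products e A v w]|%:R * mu N 1
   + #|[pred w : 'rV[Kf]_N | same_products e A v w && (vec_norm e w == hform v v)]|%:R
     * sigma N
   - #|[pred w : 'rV[Kf]_N | [&& same_products e A v w,
     vec_norm e w == hform v v & in_span e A w]]|%:R.
Proof.
move=> AN vA; rewrite (one_point_class oddF eP AN vA); congr (_ - _).
apply: two_valued_sum; [exact: mu_scale | | exact: norm_real].
by move=> w; apply: norm_real.
Qed.

Lemma span_nil v : span [::] v <-> v = 0.
Proof. by split=> [[c ->]|->]; [rewrite /lincomb big_ord0 | apply: span0]. Qed.

Lemma mu0E N c : tau c = c ->
  mu 0 c = q%:R ^+ (2 * N) * mu N 1 + (vec_count N c)%:R * sigma N.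
Proof.
move=> tc; have [p0 _ pp] := perp_vecP eP 0 tc.
have pA : ~ span [::] (perp_vec eP 0 c).
  by case=> f; rewrite /lincomb big_ord0 => pv0; rewrite pv0 eqxx in p0.
rewrite muE -[pcl 0 c]/(orbit_class [::] [:: perp_vec eP 0 c]) (@one_point_classE N) // pp.
rewrite (_ : #|[pred w | same_products e _ _ w]| = (q ^ (2 * N))%N); last first.
  rewrite expnM -(card_quad K) -[X in (_ ^ X)%N]mul1n -card_mx.
  by apply: eq_card => w; rewrite !inE.
rewrite natrX (_ : #|[pred w | same_products e _ _ w && _]| = vec_count N c); last first.
  by apply: eq_card => w; rewrite !inE.
rewrite [X in _ - X%:R](_ : _ = nat_of_bool (c == 0)) ?subrK //; have [->|c0] := eqVneq c 0.
  rewrite -[RHS](card1 (0 : 'rV[Kf]_N)); apply: eq_card => w;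
    rewrite !inE /same_products /=.
  apply/andP/eqP => [[_ /asboolP/span_nil w0]|->].
    by apply: (vec_inj eP); rewrite w0 linear0.
  by rewrite /vec_norm linear0 hform0l; split=> //; apply/asboolP/span_nil; rewrite linear0.
apply: eq_card0 => w; rewrite !inE /same_products /=;
  apply/negP=> /andP[/eqP wc /asboolP/span_nil w0].
by rewrite -wc /vec_norm w0 hform0l eqxx in c0.
Qed.

Lemma vec_count_diff (R : pzRingType) N :
  (vec_count N 0)%:R - (vec_count N 1)%:R = (- q%:R) ^+ N :> R.
Proof.
have [/(congr1 (intmul (1 : R))) + _] := vec_countE N.
by rewrite rmorphB rmorphXn rmorphN !rmorph_nat.
Qed.

Lemma vec_count_one (R : pzRingType) N :
  q%:R * (vec_count N 1)%:R = q%:R ^+ (2 * N) - (- q%:R) ^+ N :> R.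
Proof.
have [_ /(congr1 (intmul (1 : R)))] := vec_countE N.
by rewrite rmorphM rmorphB !rmorphXn rmorphN !rmorph_nat.
Qed.

Lemma sigma_scale N : (- q%:R) ^+ N * sigma N = sigma 0.
Proof.
rewrite {2}/sigma (mu0E N (raddf0 _)) (mu0E N (rmorph1 _)) -vec_count_diff.
by rewrite opprD addrACA subrr add0r mulrBl.
Qed.

Lemma adjoin_basis N : orbit_class (E N) (e N :: E N) = mu N 1.
Proof.
rewrite (perp_classE oddF eP) ?coord_basis //.
  by rewrite basis_form // eqxx muE oner_eq0 addr0.
by apply/eqP=> eN; have := basis_form eP N N; rewrite eN hform0l eqxx => /esym/eqP;
  rewrite oner_eq0.
Qed.

(** V_2 is reached through e_0 and e_1, and through an isotropic r and e_0. The
    resulting equation makes the class sigma + q mu(0, 1) of all vectors of V the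
    square of sigma, as the number q^(2m) of vectors of V_m is the square of
    (-q)^m. *)
Lemma quadratic_relation : q%:R * mu 0 1 = sigma 0 ^+ 2 - sigma 0.
Proof.
have [z zz] : exists z : K, z * tau z = -1 by apply: norm_surj; rewrite rmorphN1.
have z0 : z != 0.
  by apply: contraTneq isT => z0; move/eqP: zz; rewrite z0 mul0r eq_sym oppr_eq0 oner_eq0.
pose r := e 0 + z *: e 1.
have rE v : hform r v = hform (e 0) v + tau z * hform (e 1) v.
  by rewrite hformDl hformZl.
have r0 : hform r (e 0) = 1 by rewrite rE !basis_form // mulr0 addr0.
have r1 : hform r (e 1) = tau z by rewrite rE !basis_form // mulr1 add0r.
have rr : hform r r = 0.
  by rewrite {2}/r hformDr hformZr r0 r1 zz subrr.
have rN0 : r != 0 by apply/eqP=> rz; move/eqP: r0; rewrite rz hform0l eq_sym oner_eq0.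
have rV2 : {in [:: r], forall a, inV 2 a}.
  move=> _ /[!inE] /eqP ->; apply/(inVP eP) => i i2.
  by rewrite hformDr hformZr !basis_form // !gtn_eqF ?mulr0 ?addr0 // (leq_trans _ i2).
have e0r : ~ span [:: r] (e 0).
  move/span_consP=> [a /span_nil/eqP]; rewrite subr_eq0 => /eqP e0a.
  by move/eqP: r0; rewrite e0a hformZr rr mulr0 eq_sym oner_eq0.
pose W (c : Kf) : 'rV[Kf]_2 := \row_i (if i == 0 then 1 - (c : K) else - (z * c)).
have Winj : injective W.
  move=> c d /rowP/(_ 0); rewrite !mxE eqxx => /addrI; exact: oppr_inj.
have formr (w : 'rV[Kf]_2) : hform r (vec (w : 'rV[K]_2)) =
    (w : 'rV[K]_2) 0 0 + tau z * (w : 'rV[K]_2) 0 1.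
  have ce (i : 'I_2) : hform (e i) (vec (w : 'rV[K]_2)) = (w : 'rV[K]_2) 0 i.
    by have := congr1 (fun u : 'rV[K]_2 => u 0 i) (vecK eP (w : 'rV[K]_2)); rewrite mxE.
  by rewrite rE (ce 0) (ce 1).
have W0 c : (W c : 'rV[K]_2) 0 0 = 1 - (c : K) by rewrite mxE.
have W1 c : (W c : 'rV[K]_2) 0 1 = - (z * c) by rewrite mxE.
have typW (w : 'rV[Kf]_2) : same_products e [:: r] (e 0) w = (w \in [seq W c | c in Kf]).
  rewrite /same_products /= andbT r0 formr; apply/eqP/fintype.imageP => [w1|[c _ ->]];
    last first.
    by rewrite W0 W1 mulrN mulrA [_ * z]mulrC zz mulN1r opprK subrK.
  exists (1 - (w : 'rV[K]_2) 0 0) => //; apply/rowP=> i.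
  have [->|->] : i = 0 \/ i = 1 by case: i => -[|[|//]] ?; [left|right]; apply: val_inj.
    by rewrite W0 opprB addrC subrK.
  rewrite W1 -w1 addrC addKr mulrA zz mulN1r opprK //.
have nrmW c : vec_norm e (W c) = 1 - ((c : K) + tau c).
  rewrite vec_normE big_ord_recl big_ord1 W0.
  have -> : lift ord0 ord0 = 1 :> 'I_2 by apply: val_inj.
  rewrite W1 rmorphB rmorph1 rmorphN rmorphM /= mulrNN mulrACA [tau z * z]mulrC zz.
  move: (c : K) (tau c) => a b; ring.
have y : orbit_class [:: r] [:: e 0; r] = q%:R ^+ 2 * mu 2 1 + q%:R * sigma 2.
  rewrite (one_point_classE rV2 e0r) basis_form // eqxx.
  rewrite [X in _ - X](_ : _ = 0) ?subr0; last first.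
    rewrite eq_card0 // => w; rewrite !inE; apply/negP=> /and3P[tw _ /asboolP].
    move/span_consP=> [a /span_nil/eqP]; rewrite subr_eq0 => /eqP wa.
    move: tw; rewrite /same_products /= andbT wa hformZr rr mulr0 r0 eq_sym.
    by rewrite oner_eq0.
  rewrite -natrX -(card_quad K) -(fintype.card_image Winj); congr (_ * _ + _ * _).
    by congr (_%:R); apply: eq_card => w; rewrite !inE typW.
  rewrite -(card_trace0 K) -(fintype.card_image Winj); congr (_%:R).
  apply: eq_card => w; rewrite !inE typW; apply/andP/fintype.imageP.
    move=> [/fintype.imageP[c _ ->]]; rewrite nrmW => /eqP nc; exists c => //.
    by rewrite in_trace0; apply/eqP/oppr_inj/(addrI 1); rewrite nc oppr0 addr0.
  move=> [c]; rewrite in_trace0 => /eqP c0 ->; split; first exact: fintype.image_f.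
  by rewrite nrmW c0 subr0.
have V2 : mu 0 1 * mu 1 1 = (mu 0 0 - 1) * (q%:R ^+ 2 * mu 2 1 + q%:R * sigma 2).
  have subl A w g : fixes (w :: A) g -> fixes A g by case/fixes_cons.
  rewrite -y -!adjoin_basis -(orbit_class_comp eP) //; try exact: subl.
  have -> : mu 0 0 - 1 = orbit_class [::] [:: r].
    rewrite muE eqxx addrK -rr -(perp_classE oddF eP) //.
    by apply/rowP=> -[].
  rewrite -(orbit_class_comp eP) //; try exact: subl.
  have e0in : span [:: e 0; r] (e 0) by apply: span_mem; rewrite mem_head.
  have e0in' : span [:: e 1; e 0] (e 0) by apply: span_mem; rewrite !inE eqxx orbT.
  apply: (eq_orbit_class eP) => //; apply: fixes_span_eq => v;
    rewrite !inE => /orP[] /eqP -> //.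
    rewrite -[e 1](scalerK z0); apply: spanZ; rewrite -[z *: e 1](addKr (e 0)).
    apply: spanD; last by apply: span_mem; rewrite !inE eqxx orbT.
    by rewrite -scaleN1r; apply: spanZ.
  by apply: spanD => //; apply: spanZ; apply: span_mem; rewrite mem_head.
have m1 := mu0E 1 (rmorph1 (qe_tau K)); have m2 := mu0E 2 (rmorph1 (qe_tau K)).
have c1 := vec_count_one (Theta V) 1; have c2 := vec_count_one (Theta V) 2.
have s1 := sigma_scale 1; have s2 := sigma_scale 2.
have m0 : mu 0 0 = mu 0 1 + sigma 0 by rewrite /sigma addrC subrK.
rewrite !muln1 in m1 c1; rewrite !expr1 in c1 s1.
move: (mu 0 0) (mu 0 1) (mu 1 1) (mu 2 1) (sigma 0) (sigma 1) (sigma 2) m0 m1 m2 s1 s2 V2.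
move: (q%:R : Theta V) ((vec_count 1 1)%:R : Theta V) ((vec_count 2 1)%:R : Theta V) c1 c2.
move=> Q n1 n2 c1 c2 b a x1 x2 T s1 s2 m0 m1 m2 T1 T2 V2.
have x1E : Q ^+ 3 * x1 = Q * a + (Q + 1) * T.
  have : Q * a = Q * (Q ^+ 2 * x1) + Q * n1 * s1 by rewrite m1; ring.
  rewrite c1 => ->; rewrite -T1; ring.
have x2E : Q ^+ 5 * x2 = Q * a - (Q ^+ 2 - 1) * T.
  have : Q * a = Q * (Q ^+ 4 * x2) + Q * n2 * s2 by rewrite m2; ring.
  rewrite c2 => ->; rewrite -T2; ring.
have : a * (Q ^+ 3 * x1) = (a + T - 1) * (Q ^+ 5 * x2 + Q ^+ 2 * ((- Q) ^+ 2 * s2)).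
  transitivity (Q ^+ 3 * (a * x1)); first by ring.
  rewrite V2 m0; ring.
rewrite x1E x2E T2 => eqT; apply/eqP; rewrite -subr_eq0; apply/eqP.
transitivity (a * (Q * a + (Q + 1) * T) -
  (a + T - 1) * (Q * a - (Q ^+ 2 - 1) * T + Q ^+ 2 * T)); first by ring.
by rewrite -eqT subrr.
Qed.


Lemma mu_one N :
  q%:R ^+ (2 * N).+1 * mu N 1 = sigma 0 ^+ 2 - (- q%:R) ^+ N * sigma 0.
Proof.
have m := mu0E N (rmorph1 (qe_tau K)); have c := vec_count_one (Theta V) N.
have s := sigma_scale N; have := quadratic_relation.
have q2 : (q%:R : Theta V) ^+ (2 * N) = (- q%:R) ^+ N * (- q%:R) ^+ N.
  by rewrite -exprMn mulrNN mulnC exprM -expr2 exprAC.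
rewrite [q%:R ^+ (2 * N).+1]exprS m; move: (q%:R : Theta V) (q%:R ^+ (2 * N) :
  Theta V) ((- q%:R) ^+ N : Theta V)
  ((vec_count N 1)%:R : Theta V) c q2 s => Q Q2 D n c q2 s rel.
have {rel} : Q * (Q2 * mu N 1) + (Q2 - D) * sigma N = sigma 0 ^+ 2 - sigma 0.
  by rewrite -rel -c; ring.
rewrite q2 -s => rel; transitivity (Q * (D * D * mu N 1) + (D * D - D) * sigma N -
  (D * D - D) * sigma N); first by ring.
rewrite rel; ring.
Qed.

Section Evaluation.
Variables (R : comPzRingType) (t : R).

(** An explicit sum makes sense also if 1 = 0 in R, which for Theta is excluded
    only by the existence of the counting morphism. *)
Definition int_eval (Q : {poly int}) : R := \sum_(i < size Q) (Q`_i)%:~R * t ^+ i.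

Lemma int_eval_wide n (Q : {poly int}) : (size Q <= n)%N ->
  int_eval Q = \sum_(i < n) (Q`_i)%:~R * t ^+ i.
Proof.
move=> Qn; rewrite /int_eval (big_ord_widen n (fun i => (Q`_i)%:~R * t ^+ i)) //.
rewrite big_mkcond; apply: eq_bigr => i _; case: ltnP => // iQ.
by rewrite nth_default ?mul0r.
Qed.

Lemma int_eval_is_zmod_morphism : zmod_morphism int_eval.
Proof.
move=> P Q; pose n := maxn (size P) (size Q).
rewrite !(@int_eval_wide n) ?leq_maxl ?leq_maxr //; last first.
  by apply: leq_trans (size_polyD _ _) _; rewrite size_polyN.
rewrite -sumrB; apply: eq_bigr => i _.
by rewrite coefB rmorphB mulrBl.
Qed.
HB.instance Definition _ :=
  GRing.isZmodMorphism.Build {poly int} R int_eval int_eval_is_zmod_morphism.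

Lemma int_evalC c : int_eval c%:P = c%:~R.
Proof.
rewrite (@int_eval_wide 1) ?size_polyC_leq1 // big_ord1 coefC eqxx expr0.
exact: mulr1.
Qed.

Lemma int_evalMX Q : int_eval (Q * 'X) = int_eval Q * t.
Proof.
rewrite (@int_eval_wide (size Q).+1) ?(leq_trans (size_polyMleq _ _)) ?size_polyX ?addn2 //.
rewrite big_ord_recl coefMX eqxx mul0r add0r mulr_suml; apply: eq_bigr => i _.
by rewrite coefMX /= exprSr mulrA.
Qed.

Lemma int_evalCM c Q : int_eval (c%:P * Q) = c%:~R * int_eval Q.
Proof.
rewrite (@int_eval_wide (size Q)); last by rewrite mul_polyC size_scale_leq.
rewrite mulr_sumr; apply: eq_bigr => i _.
by rewrite coefCM rmorphM mulrA.
Qed.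

Lemma int_eval_is_monoid_morphism : monoid_morphism int_eval.
Proof.
split; first by rewrite -[1]/(1%:P) int_evalC.
move=> P Q; elim/poly_ind: P => [|P c IH]; first by rewrite mul0r raddf0 mul0r.
rewrite mulrDl !raddfD /= -mulrA [_ * Q]mulrC mulrA !int_evalMX int_evalCM int_evalC.
by rewrite IH mulrDl mulrAC.
Qed.
HB.instance Definition _ :=
  GRing.isMonoidMorphism.Build {poly int} R int_eval int_eval_is_monoid_morphism.

Lemma int_evalX : int_eval 'X = t.
Proof. by rewrite -['X]mul1r int_evalMX rmorph1 mul1r. Qed.

End Evaluation.

(** Membership in Z[1/q][sigma 0], stated without leaving Theta. *)
Definition generated (t : Theta V) :=
  exists (k : nat) Q, q%:R ^+ k * t = int_eval (sigma 0) Q.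

Lemma generated_eval Q : generated (int_eval (sigma 0) Q).
Proof. by exists 0%N, Q; rewrite mul1r. Qed.

Lemma generated_nat n : generated n%:R.
Proof. by rewrite -(rmorph_nat (int_eval (sigma 0))); apply: generated_eval. Qed.

Lemma generatedD t u : generated t -> generated u -> generated (t + u).
Proof.
move=> [k [P tP]] [l [Q uQ]]; exists (k + l)%N, (q%:R ^+ l * P + q%:R ^+ k * Q).
rewrite rmorphD !rmorphM !rmorphXn !rmorph_nat /= -tP -uQ exprD mulrDr.
by congr (_ + _); [rewrite [_ ^+ k * _]mulrC -mulrA|rewrite -mulrA].
Qed.

Lemma generatedM t u : generated t -> generated u -> generated (t * u).
Proof.
move=> [k [P tP]] [l [Q uQ]]; exists (k + l)%N, (P * Q).
by rewrite rmorphM /= -tP -uQ exprD mulrACA.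
Qed.

Lemma generatedN t : generated t -> generated (- t).
Proof. by move=> [k [P tP]]; exists k, (- P); rewrite rmorphN /= -tP mulrN. Qed.

Lemma generated_div (k : nat) t : generated (q%:R ^+ k * t) -> generated t.
Proof. by move=> [l [P tP]]; exists (l + k)%N, P; rewrite exprD -mulrA. Qed.

Lemma generated_sigma N : generated (sigma N).
Proof.
apply: (@generated_div N); exists 0%N, ((-1) ^+ N * 'X).
rewrite mul1r rmorphM rmorphXn rmorphN rmorph1 /= int_evalX -(sigma_scale N).
by rewrite mulrA -exprMn mulN1r opprK.
Qed.

Lemma generated_mu1 N : generated (mu N 1).
Proof.
apply: (@generated_div (2 * N).+1); rewrite mu_one.
exists 0%N, ('X ^+ 2 - (- q%:R) ^+ N * 'X); rewrite mul1r rmorphB [X in _ =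
  _ - X]rmorphM !rmorphXn.
by rewrite rmorphN rmorph_nat /= int_evalX.
Qed.

Lemma generated_one_point A v : generated (orbit_class A (v :: A)).
Proof.
case: (EM (span A v)) => vA.
  rewrite (orbit_class_iso eP); first exact: (generated_nat 1).
  apply: fixes_span_eq => w; first by move=> wA; apply/span_cons/span_mem.
  by rewrite inE => /predU1P[->//|wA]; apply: span_mem.
have [N AN] := inV_seq eP A.
rewrite (one_point_classE AN vA).
apply: (generatedD (generatedD _ _) (generatedN (generated_nat _))).
  exact: generatedM (generated_nat _) (generated_mu1 N).
exact: generatedM (generated_nat _) (generated_sigma N).
Qed.

Lemma generated_orbit_class A B : (forall g, fixes B g -> fixes A g) ->
  generated (orbit_class A B).
Proof.
move=> BA; have -> : orbit_class A B = orbit_class A (B ++ A).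
  by apply: (eq_orbit_class eP) => // g; rewrite fixes_cat; split=> [gB|[]//];
    split=> //; apply: BA.
elim: B {BA} => [|v B IH] /=; first by rewrite (orbit_class_iso eP) //;
  apply: (generated_nat 1).
rewrite (@orbit_class_comp _ _ _ _ eP A (B ++ A));
  first exact/generatedM/generated_one_point.
  by move=> g /fixes_cat[].
by move=> g /fixes_cons[].
Qed.

(** Every element of Theta becomes a polynomial in sigma 0 after inverting q:
    a symbol factors into one point extensions. *)
Lemma generated_all (t : Theta V) : generated t.
Proof.
rewrite -[t]pr_reprK; elim: (repr t) => {t} [[Y X f]| | |a IH|a IHa b IHb|a IHa b IHb].
- have [A [B [BA fE]]] := theta_symE f.
  by rewrite -[pr_class _ _]/(theta_sym f) fE; apply: generated_orbit_class.
- exact: (generated_nat 0).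
- exact: (generated_nat 1).
- by rewrite -pr_oppE; apply: (generatedN IH).
- by rewrite -pr_addE; apply: (generatedD IHa IHb).
- by rewrite -pr_mulE; apply: (generatedM IHa IHb).
Qed.

End Generation.

(** * Counting points in V_m *)

Section Counting.
Implicit Types (T : Type) (N : nat).

(** The sets to be counted carry no decidable equality, hence the enumeration by a
    finite type. *)
Definition counts T (P : T -> Prop) N := exists (I : finType) (h : I -> T),
  [/\ #|I| = N, injective h & forall y, P y <-> exists i, h i = y].

Lemma counts_unique T (P : T -> Prop) N N' : counts P N -> counts P N' -> N = N'.
Proof.
have le M M' : counts P M -> counts P M' -> (M <= M')%N.
  move=> [I [h [<- hi hP]]] [J [k [<- ki kP]]].
  have ex i : {j | k j = h i} by apply/cid/kP/hP; exists i.
  apply: (leq_card (fun i => sval (ex i))) => i j ij; apply: hi.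
  by rewrite -(svalP (ex i)) -(svalP (ex j)) ij.
by move=> PN PN'; apply/eqP; rewrite eqn_leq !le.
Qed.

Lemma counts_card T (P : T -> Prop) (I : finType) (h : I -> T) :
  injective h -> (forall y, P y <-> exists i, h i = y) -> counts P #|I|.
Proof. by move=> hi hP; exists I, h. Qed.

Lemma counts_code T (P : T -> Prop) (J : finType) (c : T -> J) :
  (forall y z, P y -> P z -> c y = c z -> y = z) -> exists N, counts P N.
Proof.
move=> ci; pose I : finType := {j : J | `[< exists y, P y /\ c y = j >]}.
have ex (i : I) : {y | P y /\ c y = val i} by apply/cid/asboolP/(valP i).
exists #|I|; apply: (@counts_card _ _ _ (fun i : I => sval (ex i))).
  move=> i j ij; apply: val_inj.
  by rewrite -(proj2 (svalP (ex i))) -(proj2 (svalP (ex j))) ij.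
move=> y; split=> [Py|[i <-]]; last by case: (svalP (ex i)).
have Pi : `[< exists z, P z /\ c z = c y >] by apply/asboolP; exists y.
exists (exist (fun j => `[< exists z, P z /\ c z = j >]) (c y) Pi).
case: (ex _) => z /= [Pz cz]; exact: ci.
Qed.

Lemma counts_image T T' (P : T -> Prop) (P' : T' -> Prop) (f : T -> T') N :
  (forall y z, P y -> P z -> f y = f z -> y = z) ->
  (forall y', P' y' <-> exists y, P y /\ f y = y') -> counts P N -> counts P' N.
Proof.
move=> fi fP [I [h [<- hi hP]]]; apply: (counts_card (h := f \o h)).
  by move=> i j /fi ij; apply/hi/ij; apply/hP; [exists i|exists j].
move=> y'; rewrite fP; split=> [[y [/hP[i <-] <-]]|[i <-]]; first by exists i.
by exists (h i); split=> //; apply/hP; exists i.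
Qed.

Lemma counts_union T (I : finType) (P : T -> Prop) (Q : I -> T -> Prop) (N : I -> nat) :
  (forall y, P y <-> exists i, Q i y) ->
  (forall i j y, Q i y -> Q j y -> i = j) ->
  (forall i, counts (Q i) (N i)) -> counts P (\sum_i N i).
Proof.
move=> PQ disj QN; pose J i := projT1 (cid (QN i)).
have hex i : {h : J i -> T | [/\ #|J i| = N i, injective h &
    forall y, Q i y <-> exists j, h j = y]}.
  by apply: cid; rewrite /J; case: (cid (QN i)).
pose h (z : {i : I & J i}) := sval (hex (tag z)) (tagged z).
have -> : (\sum_i N i = #|{: {i : I & J i}}|)%N.
  rewrite card_tagged sumnE big_map big_enum; apply: eq_bigr => i _.
  by case: (svalP (hex i)).
apply: (counts_card (h := h)) => [[i a] [j b]|y].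
  rewrite /h /= => ab; have ij : i = j.
    apply: (disj _ _ (sval (hex i) a)); first by case: (svalP (hex i)) => _ _ ->; exists a.
    by rewrite ab; case: (svalP (hex j)) => _ _ ->; exists b.
  subst j; congr Tagged; case: (svalP (hex i)) => _ hi _; exact: hi.
rewrite PQ; split=> [[i]|[[i a] <-]].
  by case: (svalP (hex i)) => _ _ -> [a <-]; exists (Tagged J a).
by exists i; case: (svalP (hex i)) => _ _ ->; exists a.
Qed.

Lemma existT_inj (I : Type) (P : I -> Type) i (a b : P i) :
  existT P i a = existT P i b -> a = b.
Proof.
move=> ab; have := projT2_eq ab.
by rewrite (Prop_irrelevance (projT1_eq ab) erefl).
Qed.

End Counting.

Section Levels.
Variables (F : finFieldType) (oddF : odd #|F|) (K : quadExt F).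
Variables (V : hspace K) (e : nat -> V) (eP : orthonormal_basis e).
Local Notation q := #|F|.
Local Notation Kf := (finvect_type K).
Local Notation tau := (qe_tau K : K -> K).
Local Notation coord := (coord e).
Local Notation vec := (vec e).
Local Notation inV := (inV e).
Local Notation E := (basis e).
Implicit Types (v : V) (A B C : seq V) (g h : unitary V) (X Y Z : smoothset V).

(** The fixed points of G(V_m). When X is the set of embeddings of V_{a,b} in V,
    these are the embeddings into V_m. *)
Definition in_level m X (x : X) := forall g, fixes (E m) g -> ss_act g x = x.

Lemma in_level_stab m X (x : X) A : stab x A -> in_level m x <-> {in A, forall v, inV m v}.
Proof.
move=> xA; split=> [xm v vA|Am g gm].
  by apply/(fixed_inV oddF eP) => g /xm/xA; apply.
by apply/xA => v vA; apply/(fixed_inV oddF eP): g gm; apply: Am.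
Qed.

Lemma in_level_map m X Y (f : gmap Y X) y : in_level m y -> in_level m (f y).
Proof. by move=> ym g /ym gy; rewrite -gm_equiv gy. Qed.

Lemma level_nonempty X : exists M, forall m, (M <= m)%N -> exists x : X, in_level m x.
Proof.
case: (ss_nonempty X) => x; have [A xA] := stab_exists x.
have [M AM] := inV_seq eP A; exists M => m Mm; exists x.
by apply/(in_level_stab _ xA) => v vA; apply: (inV_le eP Mm); apply: AM.
Qed.

(** By Witt's theorem in V_m, the points of X in V_m are permuted transitively
    by unitary operators preserving V_m. *)
Lemma level_transitive m X (x x' : X) : in_level m x -> in_level m x' ->
  exists g, ss_act g x = x' /\ forall Y (y : Y), in_level m y <-> in_level m (ss_act g y).
Proof.
move=> xm x'm; have [h hx] := ss_trans x x'; have [A xA] := stab_exists x.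
have hA := stab_act h xA; rewrite hx in hA.
have Am := proj1 (in_level_stab _ xA) xm; have hAm := proj1 (in_level_stab _ hA) x'm.
have [|||g [gA ge]] := witt oddF eP _ Am hAm.
- by rewrite size_map.
- by move=> i j iA jA; rewrite !(nth_map 0) // emb_form.
- move=> c; rewrite -emb_lincomb; split=> [->|]; first exact: emb0.
  by move=> h0; apply: (@emb_inj _ _ _ _ h); rewrite h0 emb0.
exists g; split; first by rewrite -hx; apply/(stab_eq _ _ xA).
move=> Y y; have [B yB] := stab_exists y.
rewrite (in_level_stab _ yB) (in_level_stab _ (stab_act g yB)).
have gm v : inV m v <-> inV m (g v).
  rewrite !(inVP eP); split=> vm i mi; have := vm i mi.
    by rewrite -{1}(emb_form g) ge.
  by rewrite -{1}(ge i mi) emb_form.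
split=> [Bm _ /mapP[v vB ->]|Bm v vB]; first exact: (proj1 (gm v) (Bm v vB)).
exact: (proj2 (gm v) (Bm _ (map_f g vB))).
Qed.

Lemma level_finite m X : exists N, counts (fun x : X => in_level m x) N.
Proof.
case: (ss_nonempty X) => x; have [A xA] := stab_exists x.
have ex y : {g | ss_act g x = y} by apply/cid/ss_trans.
pose c y := [ffun i : 'I_(size A) => coord m (sval (ex y) A`_i) : 'rV[Kf]_m].
apply: (counts_code (c := c)) => y z ym zm /ffunP yz.
rewrite -(svalP (ex y)) -(svalP (ex z)); apply/(stab_eq _ _ xA).
have im w : in_level m w -> forall i, (i < size A)%N -> inV m (sval (ex w) A`_i).
  move=> wm i iA; have := stab_act (sval (ex w)) xA; rewrite (svalP (ex w)) => wA.
  by apply: (proj1 (in_level_stab _ wA) wm); rewrite map_f // mem_nth.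
apply: (@eq_from_nth _ 0); rewrite !size_map // => i iA.
rewrite !(nth_map 0) // -(im _ ym i iA) -(im _ zm i iA).
by have := yz (Ordinal iA); rewrite !ffunE => ->.
Qed.

(** nu_m(f) = N. The first clause excludes the levels m at which the second one is
    void. *)
Definition is_degree m X Y (f : gmap Y X) N := (exists x : X, in_level m x) /\
  forall x, in_level m x -> counts (fun y => in_level m y /\ f y = x) N.

Lemma degree_exists m X Y (f : gmap Y X) :
  (exists x : X, in_level m x) -> exists N, is_degree m f N.
Proof.
move=> [x xm]; have [M [I [k [_ ki kP]]]] := level_finite m Y.
have [N cN] : exists N, counts (fun y => in_level m y /\ f y = x) N.
  have cex y : exists o : option I, in_level m y -> omap k o = Some y.
    case: (EM (in_level m y)) => [/kP[i <-]|no]; first by exists (Some i).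
    by exists None.
  apply: (counts_code (c := fun y => projT1 (cid (cex y)))) => y z [ym _] [zm _].
  case: (cid (cex y)) => o /= /(_ ym) oy; case: (cid (cex z)) => o' /= /(_ zm) oz eqo.
  by move: oz; rewrite -eqo oy => -[].
exists N; split=> [|x' x'm]; first by exists x.
have [g [gx gm]] := level_transitive xm x'm.
apply: (counts_image (f := ss_act g)) cN => [y z _ _|y'].
  by move/(congr1 (ss_act g^-1%g)); rewrite -!ss_actM mulVg !ss_act1.
split=> [[ym fy]|[y [[ym fy] <-]]]; last by rewrite gm_equiv fy gx -gm.
exists (ss_act g^-1%g y'); split; last by rewrite -ss_actM mulgV ss_act1.
split; first by rewrite gm -ss_actM mulgV ss_act1.
by rewrite gm_equiv fy -gx -ss_actM mulVg ss_act1.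
Qed.

Lemma degree_unique m X Y (f : gmap Y X) N N' :
  is_degree m f N -> is_degree m f N' -> N = N'.
Proof. by move=> [[x xm] /(_ x xm) c] [_ /(_ x xm)]; apply: counts_unique. Qed.

Definition degree m X Y (f : gmap Y X) : nat :=
  xget 0%N [set N | is_degree m f N]%classic.

Lemma degreeE m X Y (f : gmap Y X) N : is_degree m f N -> degree m f = N.
Proof.
by move=> fN; apply: xget_unique => // N' fN'; apply: degree_unique fN' fN.
Qed.

Lemma degreeP m X Y (f : gmap Y X) :
  (exists x : X, in_level m x) -> is_degree m f (degree m f).
Proof. by move=> /(degree_exists f)[N fN]; rewrite (degreeE fN). Qed.

Lemma degree_iso m X Y (f : gmap Y X) :
  bijective f -> (exists x : X, in_level m x) -> degree m f = 1%N.
Proof.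
move=> [f' fK f'K] xm; apply: degreeE; split=> // x /= lx.
rewrite -card_unit; apply: (counts_card (h := fun=> f' x)) => [[] [] //|y].
split=> [[_ <-]|[_ <-]]; first by exists tt; rewrite fK.
rewrite f'K; split=> // g /lx gx; apply: (can_inj fK).
by rewrite gm_equiv f'K.
Qed.

Lemma degree_comp m X Y Z (f : gmap Y X) (g : gmap Z Y) :
  (exists z : Z, in_level m z) -> degree m (gm_comp f g) = (degree m f * degree m g)%N.
Proof.
move=> [z zm]; have ym : exists y : Y, in_level m y by exists (g z); apply: in_level_map.
have xm : exists x : X, in_level m x by exists (f (g z)); do 2!apply: in_level_map.
apply: degreeE; split=> // x lx.
have [_ /(_ x lx)[I [k [cI ki kP]]]] := degreeP f xm.
rewrite -cI -sum_nat_const.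
apply: (counts_union (Q := fun i z => in_level m z /\ g z = k i)) => [w|i j w|i].
- split=> [[wm fw]|[i [wm gw]]].
    have /kP[i ki'] : in_level m (g w) /\ f (g w) = x by split=> //; apply: in_level_map.
    by exists i.
  by have /kP[_ fk] := ex_intro (fun j => k j = k i) i erefl; rewrite /= gw.
- by move=> [_ gi] [_ gj]; apply: ki; rewrite -gi gj.
- have [_] := degreeP g ym; apply.
  by have /kP[] := ex_intro (fun j => k j = k i) i erefl.
Qed.

(** A point y of Y and the point x' of X', with the same image in X, come from a
    single point of the fibre product, which is fixed by whatever fixes both. *)
Lemma degree_base m X Y X' (f : gmap Y X) (h : gmap X' X) n
    (Y' : 'I_n -> smoothset V) (g : forall i, gmap (Y' i) Y)
    (f' : forall i, gmap (Y' i) X') : orbit_decomposition f h g f' ->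
  (exists x' : X', in_level m x') -> degree m f = (\sum_(i < n) degree m (f' i))%N.
Proof.
move=> [fg dec] [x' x'm].
have xm : in_level m (h x') by apply: in_level_map.
have [_ /(_ _ xm) cf] := degreeP f (ex_intro _ _ xm).
apply: counts_unique cf _.
apply: (counts_union (Q := fun i y => exists z : Y' i,
  [/\ in_level m z, f' i z = x' & g i z = y])) => [y|i j y|i].
- split=> [[ym fy]|[i [z [zm fz <-]]]]; last first.
    by split; [apply: in_level_map | rewrite fg fz].
  have [[i z] [[/= gz fz] zu]] := dec _ _ fy.
  exists i, z; split=> // k km.
  have := zu (existT _ i (ss_act k z)); rewrite /= !gm_equiv gz fz ym // x'm //.
  by move=> zk; apply: esym; apply: existT_inj (zk (conj erefl erefl)).
- move=> [z [_ fz gz]] [z' [_ fz' gz']].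
  have fy : f y = h x' by rewrite -gz fg fz.
  have [w [_ wu]] := dec _ _ fy.
  have e1 := wu (existT _ i z) (conj gz fz); have e2 := wu (existT _ j z') (conj gz' fz').
  by rewrite -[i]/(tag (existT (fun i => Y' i : Type) i z)) -e1 e2.
- have [_ /(_ _ x'm) c] := degreeP (f' i) (ex_intro _ _ x'm).
  apply: (counts_image (f := g i)) c => [z z' [_ fz] [_ fz'] gzz|y].
    have fy : f (g i z) = h x' by rewrite fg fz.
    have [w [_ wu]] := dec _ _ fy.
    have e1 := wu (existT _ i z) (conj erefl fz).
    have e2 := wu (existT _ i z') (conj (esym gzz) fz').
    exact: existT_inj (etrans (esym e1) e2).
  by split=> [[z [zm fz gz]]|[z [[zm fz] gz]]]; exists z.
Qed.

Section Evaluation.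
Variable R : comPzRingType.

(** For a fixed m this does not factor through Theta, since the degree of f means
    nothing while V_m is too small for f. *)
Fixpoint term_count m (t : rterm (symbol V)) : R := match t with
  | TGen s => (degree m (sy_map s))%:R
  | TZero => 0
  | TOne => 1
  | TOpp a => - term_count m a
  | TAdd a b => term_count m a + term_count m b
  | TMul a b => term_count m a * term_count m b
  end.

Definition eventually_eq (f f' : nat -> R) :=
  exists M, forall m, (M <= m)%N -> f m = f' m.

Lemma eventually_op2 (op : R -> R -> R) f1 f1' f2 f2' :
  eventually_eq f1 f1' -> eventually_eq f2 f2' ->
  eventually_eq (fun m => op (f1 m) (f2 m)) (fun m => op (f1' m) (f2' m)).
Proof.
move=> [M1 e1] [M2 e2]; exists (maxn M1 M2) => m; rewrite geq_max => /andP[m1 m2].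
by rewrite e1 ?e2.
Qed.

Lemma eventually_trans f1 f2 f3 :
  eventually_eq f1 f2 -> eventually_eq f2 f3 -> eventually_eq f1 f3.
Proof.
move=> [M1 e1] [M2 e2]; exists (maxn M1 M2) => m; rewrite geq_max => /andP[m1 m2].
by rewrite e1 ?e2.
Qed.

Lemma eventually_sym f1 f2 : eventually_eq f1 f2 -> eventually_eq f2 f1.
Proof. by move=> [M h]; exists M => m /h. Qed.

Lemma term_count_sum m n (t : 'I_n -> rterm (symbol V)) :
  term_count m (\big[@TAdd _/TZero]_(i < n) t i) = \sum_(i < n) term_count m (t i).
Proof. by apply: (big_morph (term_count m)). Qed.

(** Counting in V_m respects every relation of Theta as soon as V_m is large
    enough for the G-sets involved. *)
Lemma term_count_cong a b : rcong (@theta_rel _ _ V) a b ->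
  eventually_eq (term_count^~ a) (term_count^~ b).
Proof.
elim=> {a b} [a b []|a|a b _|a b c _ ab _ bc|a b _ [M ab]|a b c d _ ab _ cd|
  a b c d _ ab _ cd|a b c|a b|a|a|a b c|a b|a|a b c].
- move=> X Y f bf; have [M XM] := level_nonempty X; exists M => m /XM xm /=.
  by rewrite degree_iso.
- move=> X Y Z f g; have [M ZM] := level_nonempty Z; exists M => m /ZM zm /=.
  by rewrite degree_comp // natrM.
- move=> X Y X' f h n Y' g f' dec; have [M XM] := level_nonempty X'.
  by exists M => m /XM xm; rewrite term_count_sum /= (degree_base dec xm) natr_sum.
- by exists 0%N.
- exact: eventually_sym.
- exact: eventually_trans ab bc.
- by exists M => m /ab /= ->.
- exact: eventually_op2.
- exact: eventually_op2.
- by exists 0%N => m _ /=; rewrite addrA.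
- by exists 0%N => m _ /=; rewrite addrC.
- by exists 0%N => m _ /=; rewrite add0r.
- by exists 0%N => m _ /=; rewrite addNr.
- by exists 0%N => m _ /=; rewrite mulrA.
- by exists 0%N => m _ /=; rewrite mulrC.
- by exists 0%N => m _ /=; rewrite mul1r.
- by exists 0%N => m _ /=; rewrite mulrDl.
Qed.

End Evaluation.
End Levels.

Section CountingVectors.
Variables (F : finFieldType) (oddF : odd #|F|) (K : quadExt F).
Variables (V : hspace K) (e : nat -> V) (eP : orthonormal_basis e).
Variable R : comPzRingType.
Local Notation q := #|F|.
Local Notation Kf := (finvect_type K).
Local Notation tau := (qe_tau K : K -> K).
Local Notation mu := (mu eP).

(** By Witt's theorem the orbit of a nonzero vector consists of all the nonzero
    vectors of the same norm. *)
Lemma degree_vectors m d (X : smoothset V) (x : X) :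
  tau d = d -> stab x [:: perp_vec eP 0 d] ->
  (degree e m (to_pt X) + (d == 0)%R)%N = vec_count e m d.
Proof.
move=> td xv; set v := perp_vec eP 0 d in xv; have [v0 _ vv] := perp_vecP eP 0 td.
pose P (w : 'rV[Kf]_m) := (vec_norm e w == d) && ((w : 'rV[K]_m) != 0).
pose I : finType := {w : 'rV[Kf]_m | P w}.
have nil_span (w : V) : w != 0 -> ~ span [::] w.
  by move=> w0 /span_nil ww; rewrite ww eqxx in w0.
have wE (i : I) : vec e (val i : 'rV[K]_m) != 0.
  have /andP[_] := valP i; apply: contraNneq => w0.
  by apply/eqP/(vec_inj eP); rewrite w0 linear0.
have rex (i : I) : {r : unitary V | r v = vec e (val i : 'rV[K]_m)}.
  apply: cid; have [||r [_ rv]] := same_type_conjugate oddF eP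
    (nil_span v v0) (nil_span _ (wE i)).
  - by [].
  - by rewrite vv; have /andP[/eqP <-] := valP i.
  by exists r.
pose r i := sval (rex i).
have rv i : r i v = vec e (val i : 'rV[K]_m) := svalP (rex i).
have -> : degree e m (to_pt X) = #|I|.
  apply: degreeE; split=> [|[] _]; first by exists tt.
  apply: (counts_card (h := fun i => ss_act (r i) x)) => [i j|y].
    move/(stab_eq _ _ xv) => /= -[]; rewrite !rv => /(vec_inj eP) ij; exact: val_inj.
  split=> [[ym _]|[i <-]]; last first.
    split=> //; apply/(in_level_stab oddF eP _ (stab_act (r i) xv)) => w.
    by rewrite inE => /eqP ->; rewrite rv; apply: inV_vec.
  have [g gx] := ss_trans x y.
  have gvm : inV e m (g v).
    have := stab_act g xv; rewrite gx => yv.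
    by apply: (proj1 (in_level_stab oddF eP _ yv) ym); rewrite mem_head.
  have Pg : P (coord e m (g v)).
    rewrite /P /vec_norm gvm emb_form vv eqxx /=; apply: contraNneq v0 => gv0.
    by apply/eqP/(@emb_inj _ _ _ _ g); rewrite emb0 -gvm gv0 linear0.
  exists (exist (fun w => P w) _ Pg); rewrite -gx; apply/(stab_eq _ _ xv) => /=.
  by rewrite rv /= gvm.
rewrite card_sig /vec_count.
have [d0|d0] := eqVneq d 0; last first.
  rewrite addn0; apply: eq_card => w; rewrite !inE /P; case: eqP => //= wd.
  by apply: contraNneq d0 => w0; rewrite -wd /vec_norm w0 linear0 hform0l.
rewrite [RHS](cardD1 (0 : 'rV[Kf]_m)) addnC; congr (_ + _)%N.
  by rewrite inE /vec_norm linear0 hform0l d0 eqxx.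
by apply: eq_card => w; rewrite !inE /P andbC.
Qed.

Definition class_count (t : Theta V) m : R := term_count e R m (repr t).

Lemma class_count_class a : eventually_eq (class_count (pr_class (@theta_rel _ _ V) a))
  (fun m => term_count e R m a).
Proof. exact/(term_count_cong oddF eP)/pr_repr. Qed.

Lemma class_countD t u : eventually_eq (class_count (t + u)) (fun m =>
  class_count t m + class_count u m).
Proof. exact: class_count_class (TAdd (repr t) (repr u)). Qed.

Lemma class_countM t u : eventually_eq (class_count (t * u)) (fun m =>
  class_count t m * class_count u m).
Proof. exact: class_count_class (TMul (repr t) (repr u)). Qed.

Lemma class_countN t : eventually_eq (class_count (- t)) (fun m => - class_count t m).
Proof. exact: class_count_class (TOpp (repr t)). Qed.

Lemma class_count0 : eventually_eq (class_count 0) (fun=> 0).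
Proof. exact: class_count_class TZero. Qed.

Lemma class_count1 : eventually_eq (class_count 1) (fun=> 1).
Proof. exact: class_count_class TOne. Qed.

Lemma class_count_sym (X Y : smoothset V) (f : gmap Y X) :
  eventually_eq (class_count (theta_sym f)) (fun m => (degree e m f)%:R).
Proof. exact: class_count_class (tsym f). Qed.

Lemma eventually_D (f1 f1' f2 f2' : nat -> R) :
  eventually_eq f1 f1' -> eventually_eq f2 f2' ->
  eventually_eq (fun m => f1 m + f2 m) (fun m => f1' m + f2' m).
Proof. exact: (@eventually_op2 R +%R f1 f1' f2 f2'). Qed.

Lemma eventually_M (f1 f1' f2 f2' : nat -> R) :
  eventually_eq f1 f1' -> eventually_eq f2 f2' ->
  eventually_eq (fun m => f1 m * f2 m) (fun m => f1' m * f2' m).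
Proof. exact: (@eventually_op2 R *%R f1 f1' f2 f2'). Qed.

Lemma class_count_nat n : eventually_eq (class_count n%:R) (fun=> n%:R).
Proof.
elim: n => [|n IH]; first exact: class_count0.
rewrite -natr1; apply: eventually_trans (class_countD _ _) _.
apply: eventually_trans (eventually_D IH class_count1) _.
by exists 0%N => m _; rewrite natr1.
Qed.

Lemma class_count_int (c : int) : eventually_eq (class_count c%:~R) (fun=> c%:~R).
Proof.
case: c => n; first exact: class_count_nat.
rewrite NegzE rmorphN; apply: eventually_trans (class_countN _) _.
by have [M nM] := class_count_nat n.+1; exists M => m /nM ->; rewrite -[RHS]/(_) rmorphN.
Qed.

Lemma class_count_mu d : tau d = d ->
  eventually_eq (class_count (mu 0 d)) (fun m => (vec_count e m d)%:R).
Proof.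
move=> td; have [X [x xv]] := orbit_exists eP [:: perp_vec eP 0 d].
apply: eventually_trans (class_countD _ _) _.
have -> : perp_class eP 0 d = theta_sym (to_pt X).
  have ptx : stab (to_pt X x) [::] by move=> g; split.
  exact: orbit_classE xv ptx.
apply: eventually_trans (eventually_D (class_count_sym (to_pt X)) (class_count_nat (d
  == 0))) _.
by exists 0%N => m _; rewrite -natrD (degree_vectors m td xv).
Qed.

Lemma class_count_sigma : eventually_eq (class_count (sigma eP 0)) (fun m => (- q%:R) ^+ m).
Proof.
apply: eventually_trans (class_countD _ _) _.
have e0 := class_count_mu (raddf0 _); have e1 := class_count_mu (rmorph1 (qe_tau K)).
have [M m1] := eventually_trans (class_countN _) (eventually_op2 (fun a _ => - a) e1 e1).
have [M0 m0] := e0; exists (maxn M M0) => m; rewrite geq_max => /andP[mM mM0].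
by rewrite m0 // m1 // (vec_count_diff eP).
Qed.

End CountingVectors.

(** * The counting homomorphism *)

Section InvertedIntegers.
Variable q : nat.
Hypothesis q1 : (1 < q)%N.
Local Notation Zq := (Zinv q).

Lemma qinvK : qinv q * q%:R = 1 :> Zq.
Proof.
apply: val_inj; rewrite rmorphM rmorph_nat rmorph1 /= mulVf //.
by rewrite pnatr_eq0 -lt0n ltnW.
Qed.

Lemma zinv_intr_inj : injective (intmul (1 : Zq)).
Proof.
move=> a b /(congr1 (fun z : Zq => (\val z : rat))); rewrite !rmorph_int.
exact: intr_inj.
Qed.

Lemma zinv_integral (c : Zq) : exists (k : nat) (z : int), q%:R ^+ k * c = z%:~R.
Proof.
have /asboolP[k /intrP[z zE]] := zinv_valP c; exists k, z; apply: val_inj.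
by rewrite rmorphM rmorphXn rmorph_nat rmorph_int -zE mulrC.
Qed.

Lemma poly_integral (p : {poly Zq}) :
  exists (k : nat) (Q : {poly int}), q%:R ^+ k * p = map_poly intr Q.
Proof.
elim/poly_ind: p => [|p c [k [Q pQ]]].
  by exists 0%N, 0; rewrite mulr0 rmorph0.
have [l [z cz]] := zinv_integral c.
exists (k + l)%N, (Q *+ q ^ l * 'X + (z *+ q ^ k)%:P).
rewrite rmorphD /= map_polyC /= [map_poly _ (_ * 'X)]rmorphM /= map_polyX.
rewrite !rmorphMn /= -pQ -cz -[_ *+ q ^ l]mulr_natl -[_ *+ q ^ k]mulr_natl !natrX
  !polyCM !rmorphXn !rmorph_nat exprD.
move: (q%:R ^+ k : {poly Zq}) (q%:R ^+ l : {poly Zq}) => a b; ring.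
Qed.

(** The points (-q)^m are pairwise distinct. *)
Lemma poly_eventually_eq (p p' : {poly Zq}) :
  eventually_eq (fun m => p.[(- q%:R) ^+ m]) (fun m => p'.[(- q%:R) ^+ m]) -> p = p'.
Proof.
move=> [M pp]; apply: (map_inj_poly (f := \val : Zq -> rat) val_inj); first exact: rmorph0.
apply/eqP; rewrite -subr_eq0; set r := _ - _.
pose x m : rat := (- q%:R) ^+ m.
have xi : injective x.
  move=> i j /(congr1 Num.norm); rewrite !normrX normrN ger0_norm ?ler0n // => /eqP.
  by rewrite -!natrX eqr_nat eqn_exp2l // => /eqP.
have xE m : x m = \val ((- q%:R) ^+ m : Zq) by rewrite rmorphXn rmorphN rmorph_nat.
apply/eqP; apply: (@roots_geq_poly_eq0 _ r [seq x m | m <- iota M (size r)]).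
- apply/allP=> y /mapP[m + ->]; rewrite mem_iota => /andP[Mm _].
  by rewrite rootE !hornerE xE !horner_map /= pp // subrr.
- by rewrite map_inj_uniq // iota_uniq.
- by rewrite size_map size_iota.
Qed.

End InvertedIntegers.

Section CountingHomomorphism.
Variables (F : finFieldType) (oddF : odd #|F|) (K : quadExt F).
Variables (V : hspace K) (e : nat -> V) (eP : orthonormal_basis e).
Local Notation q := #|F|.
Local Notation Zq := (Zinv #|F|).
Local Notation class_count := (class_count e Zq).

Let q1 : (1 < q)%N. Proof. exact: finNzRing_gt1. Qed.

Definition interpolates (p : {poly Zq}) (t : Theta V) :=
  eventually_eq (class_count t) (fun m => p.[(- q%:R) ^+ m]).

Lemma interpolates_eval Q : interpolates (map_poly intr Q) (int_eval (sigma eP 0) Q).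
Proof.
elim/poly_ind: Q => [|Q c IH].
  rewrite !rmorph0; apply: eventually_trans (class_count0 oddF eP Zq) _.
  by exists 0%N => m _; rewrite horner0.
rewrite /interpolates !rmorphD !rmorphM /= map_polyX map_polyC int_evalX int_evalC.
apply: eventually_trans (class_countD oddF eP Zq _ _) _.
have := eventually_D (eventually_trans (class_countM oddF eP Zq _ _)
  (eventually_M IH (class_count_sigma oddF eP Zq))) (class_count_int oddF eP Zq c).
move=> [M h]; exists M => m /h ->; rewrite !hornerE.
by [].
Qed.

(** The counting functions are polynomial because t is, up to a power of q, a
    polynomial in sigma 0, which counts to (-q)^m. *)
Lemma interpolation (t : Theta V) : exists p, interpolates p t.
Proof.
have [k [Q tQ]] := generated_all oddF eP t.
exists (qinv q ^+ k *: map_poly intr Q).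
have [M1 h1] := interpolates_eval Q; have [M2 h2] := class_countM oddF eP Zq (q%:R ^+ k) t.
have [M3 h3] : eventually_eq (class_count (q%:R ^+ k)) (fun=> q%:R ^+ k).
  by rewrite -natrX; have [M h] := class_count_nat oddF eP Zq (q ^ k);
    exists M => m /h ->; rewrite natrX.
exists (maxn M1 (maxn M2 M3)) => m; rewrite !geq_max => /and3P[m1 m2 m3].
by rewrite hornerZ -h1 // -tQ h2 // h3 // mulrA -exprMn qinvK // expr1n mul1r.
Qed.

Definition count_hom (t : Theta V) : {poly Zq} := projT1 (cid (interpolation t)).

Lemma count_homP t : interpolates (count_hom t) t.
Proof. by rewrite /count_hom; case: cid. Qed.

Lemma count_homE t p : interpolates p t -> count_hom t = p.
Proof.
move=> tp; apply: (poly_eventually_eq q1); apply: eventually_trans tp.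
exact/eventually_sym/count_homP.
Qed.

Lemma count_hom_is_zmod_morphism : zmod_morphism count_hom.
Proof.
move=> t u; apply: count_homE; apply: eventually_trans (class_countD oddF eP Zq _ _) _.
have [M1 h1] := class_countN oddF eP Zq u; have [M2 h2] := count_homP u;
  have [M3 h3] := count_homP t.
exists (maxn M1 (maxn M2 M3)) => m; rewrite !geq_max => /and3P[m1 m2 m3].
by rewrite h1 // h2 // h3 // hornerD hornerN.
Qed.

Lemma count_hom_is_monoid_morphism : monoid_morphism count_hom.
Proof.
split=> [|t u]; apply: count_homE.
  apply: eventually_trans (class_count1 oddF eP Zq) _.
  by exists 0%N => m _; rewrite hornerE.
apply: eventually_trans (class_countM oddF eP Zq _ _) _.
have [M h] := eventually_M (count_homP t) (count_homP u).
by exists M => m /h ->; rewrite hornerM.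
Qed.

HB.instance Definition _ := GRing.isZmodMorphism.Build (Theta V) {poly Zq} count_hom
  count_hom_is_zmod_morphism.
HB.instance Definition _ := GRing.isMonoidMorphism.Build (Theta V) {poly Zq} count_hom
  count_hom_is_monoid_morphism.

Lemma count_hom_eval Q : count_hom (int_eval (sigma eP 0) Q) = map_poly intr Q.
Proof. exact/count_homE/interpolates_eval. Qed.

Lemma count_hom_sigma : count_hom (sigma eP 0) = 'X.
Proof. by rewrite -(int_evalX (sigma eP 0)) count_hom_eval map_polyX. Qed.

Lemma count_hom_eq0 t : count_hom t = 0 -> exists k, q%:R ^+ k * t = 0.
Proof.
move=> t0; have [k [Q tQ]] := generated_all oddF eP t; exists k.
have : map_poly intr Q = 0 :> {poly Zq}.
  by rewrite -count_hom_eval -tQ rmorphM /= t0 mulr0.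
rewrite tQ => Q0; suff -> : Q = 0 by rewrite rmorph0.
have inj := @map_inj_poly _ _ (intr : int -> Zq) (@zinv_intr_inj _) (rmorph0 _).
by apply: inj; rewrite Q0 rmorph0.
Qed.

(** The inverse maps the variable to sigma 0: both composites are the identity up to
    powers of q, by generated_all and count_hom_eval. *)
Lemma loc_count_hom_bij : bijective (loc_map count_hom (q%:R : Theta V)).
Proof.
have inj : injective (loc_map count_hom (q%:R : Theta V)).
  elim/loc_ind=> -[x n]; elim/loc_ind=> -[y m]; rewrite !loc_mapE.
  move/loc_fracP=> [k /= xy]; apply/loc_fracP => /=.
  have /count_hom_eq0[l lE] : count_hom (q%:R ^+ k * (q%:R ^+ m * x) - q%:R ^+ k *
    (q%:R ^+ n * y)) = 0.
    by rewrite rmorphB !rmorphM !rmorphXn /= xy subrr.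
  exists (l + k)%N; apply/eqP; rewrite -subr_eq0 exprD -!mulrA -mulrBr.
  by rewrite lE.
have surj y : exists x, loc_map count_hom (q%:R : Theta V) x = y.
  elim/loc_ind: y => -[p n]; have [k [Q pQ]] := poly_integral p.
  exists (loc_frac _ (int_eval (sigma eP 0) Q, (n + k)%N)); rewrite loc_mapE /=.
  apply/loc_fracP; exists 0%N; rewrite /= count_hom_eval -pQ rmorph_nat !mul1r exprD mulrA.
  by [].
exists (fun y => projT1 (cid (surj y))) => [x|y]; last by case: cid.
by apply: inj; case: cid.
Qed.

End CountingHomomorphism.

(** * Frames and restriction models *)

Section Frames.
Variables (F : finFieldType) (oddF : odd #|F|) (K : quadExt F).
Variables (V : hspace K) (e : nat -> V) (eP : orthonormal_basis e).
Local Notation q := #|F|.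
Local Notation tau := (qe_tau K : K -> K).
Local Notation "A ^*" := (ctr (qe_tau K) A) : ring_scope.
Implicit Types (v : V) (A B : seq V) (g h : unitary V) (X Y : smoothset V).

Lemma emb_factor (U W Z : hspace K) (u : embedding U Z) (k : embedding W Z) :
  (forall x, exists z, k z = u x) -> exists u' : embedding U W, emb_comp k u' = u.
Proof.
move=> ku; pose f x := projT1 (cid (ku x)).
have kf x : k (f x) = u x by rewrite /f; case: cid.
have lin : linear f by move=> c x y; apply: (@emb_inj _ _ _ _ k);
  rewrite emb_linear !kf emb_linear.
have inj : injective f by move=> x y /(congr1 k); rewrite !kf => /emb_inj.
have form x y : hform (f x) (f y) = hform x y by rewrite -(emb_form k) !kf emb_form.
by exists (Embedding lin inj form); apply/emb_eqP.
Qed.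

Lemma emb_comp_inj (U W Z : hspace K) (k : embedding W Z) :
  injective (@emb_comp _ _ U W Z k).
Proof.
move=> u u' /emb_eqP uu; apply/emb_eqP => x; apply: (@emb_inj _ _ _ _ k).
exact: uu.
Qed.

Definition emb_basis a b (w : Xset V a b) : seq V :=
  [seq w (delta_mx 0 i : 'rV[K]_(a + b)) | i <- enum 'I_(a + b)].

Lemma size_emb_basis a b (w : Xset V a b) : size (emb_basis w) = (a + b)%N.
Proof. by rewrite size_map size_enum_ord. Qed.

Lemma nth_emb_basis a b (w : Xset V a b) (i : 'I_(a + b)) :
  (emb_basis w)`_i = w (delta_mx 0 i : 'rV[K]_(a + b)).
Proof. by rewrite (nth_map i) ?size_enum_ord ?nth_ord_enum. Qed.

Lemma emb_basis_lincomb a b (w : Xset V a b) (c : nat -> K) :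
  lincomb (emb_basis w) c = w (\row_(i < a + b) c i : 'rV[K]_(a + b)).
Proof.
rewrite /lincomb size_emb_basis.
have -> : (\row_(i < a + b) c i : 'rV[K]_(a + b)) =
    \sum_(i < a + b) c i *: (delta_mx 0 i : 'rV[K]_(a + b)).
  by rewrite [LHS]row_sum_delta; apply: eq_bigr => i _; rewrite mxE.
rewrite [RHS](big_morph w (embD w) (emb0 w)); apply: eq_bigr => i _.
by rewrite nth_emb_basis embZ.
Qed.

Lemma span_emb_basis a b (w : Xset V a b) v :
  span (emb_basis w) v <-> exists x, w x = v.
Proof.
split=> [[c ->]|[x <-]].
  by exists (\row_(i < a + b) c i : 'rV[K]_(a + b)); rewrite emb_basis_lincomb.
exists (fun i => if insub i is Some j then (x : 'rV[K]_(a + b)) 0 j else 0).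
rewrite emb_basis_lincomb; congr (w _); apply/rowP=> i.
by rewrite mxE valK.
Qed.

Lemma fixes_emb_basis a b (w : Xset V a b) g :
  fixes (emb_basis w) g <-> emb_comp g w = w.
Proof.
split=> [gw|gw v vw].
  apply/emb_eqP => x; apply: fixes_span gw _.
  by apply/span_emb_basis; exists x.
have /span_emb_basis[x <-] := span_mem vw.
by rewrite -[in RHS]gw.
Qed.

Lemma emb_witt a b (w w' : Xset V a b) : exists g, emb_comp g w = w'.
Proof.
have [m wm] := inV_seq eP (emb_basis w ++ emb_basis w').
have ker (u : Xset V a b) c : lincomb (emb_basis u) c = 0 <->
    (\row_(i < a + b) c i : 'rV[K]_(a + b)) = 0.
  rewrite emb_basis_lincomb; split=> [u0|->]; last exact: emb0.
  by apply: (@emb_inj _ _ _ _ u); rewrite u0 emb0.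
have [|||||g [gw _]] := @witt _ oddF _ _ _ eP m (emb_basis w) (emb_basis w').
- by rewrite !size_emb_basis.
- by move=> v vw; apply: wm; rewrite mem_cat vw.
- by move=> v vw; apply: wm; rewrite mem_cat vw orbT.
- rewrite size_emb_basis => i j ia ja.
  rewrite -[i]/(val (Ordinal ia)) -[j]/(val (Ordinal ja)) !nth_emb_basis.
  by rewrite !emb_form.
- by move=> c; rewrite !ker.
exists g; apply/emb_eqP => x.
have /span_emb_basis[c] : exists y, w y = w x by exists x.
rewrite emb_basis_lincomb => /emb_inj ->.
by rewrite /= -!emb_basis_lincomb emb_lincomb gw.
Qed.

(** The classification of hermitian matrices, applied to the coordinates of A. *)
Lemma frame_exists A : exists a b (w : Xset V a b),
  forall v, span A v <-> span (emb_basis w) v.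
Proof.
have [m Am] := inV_seq eP A.
pose M : 'M[K]_(size A, m) := \matrix_(i < size A) coord e m A`_i.
have norm' (c : K) : tau c = c -> exists z : K, z * tau z = c := @norm_surj _ _ c.
have [a [b [W [R [WW RW RR fr spanM]]]]] :=
  hermitian_classification (@tauK _ K) norm' (@trace_nontriv _ K) M.
pose L := col_mx W R; exists a, b.
pose f (x : 'rV[K]_(a + b)) : V := vec e (x *m L).
have lin : linear f by move=> c x y; rewrite /f mulmxDl -scalemxAl linearP.
have inj : injective f by move=> x y /(vec_inj eP)/(row_free_inj fr).
have WR : W *m R^* = 0.
  by rewrite -[LHS](ctrK (@tauK _ K)) ctrM (ctrK (@tauK _ K)) RW ctr0.
have LL : L *m L^* = block_mx 1%:M 0 0 0.
  by rewrite /L ctr_col mul_col_row (eqP WW) RW RR WR.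
have form (x y : stdV K a b) : hform (f x) (f y) = hform x y.
  rewrite hform_vec (vecK eP) ctrM mulmxA -[y *m L *m _]mulmxA LL.
  rewrite -[y in LHS](@hsubmxK _ 1 a b) mul_row_block !mulmx0 !addr0 mulmx1.
  rewrite mxE big_split_ord /= [X in _ + X]big1 ?addr0; last first.
    by move=> i _; rewrite row_mxEr mxE mul0r.
  by apply: eq_bigr => i _; rewrite row_mxEl !mxE mulrC.
exists (@Embedding _ _ (stdV K a b) V f lin inj form) => v.
rewrite span_emb_basis; split=> [[c ->]|[x <-]] /=.
  have : (\row_(i < size A) c i *m M <= L)%MS by rewrite /L spanM submxMl.
  case/submxP=> x xE; exists x; rewrite /f -xE mulmx_sum_row linear_sum.
  apply: eq_bigr => i _; rewrite linearZ /= rowK mxE.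
  by rewrite (Am _ (mem_nth 0 (ltn_ord i))).
have : (x *m L <= M)%MS by rewrite -spanM submxMl.
case/submxP=> y yE; exists (fun i => if insub i is Some j then y 0 j else 0).
rewrite /f yE mulmx_sum_row linear_sum; apply: eq_bigr => i _.
by rewrite linearZ /= rowK valK (Am _ (mem_nth 0 (ltn_ord i))).
Qed.

Lemma stab_iso a b X (i : X -> Xset V a b) x : iso_Xset i -> stab x (emb_basis (i x)).
Proof.
move=> [[i' iK i'K] ie] g; rewrite fixes_emb_basis -[emb_comp g _]/(Xact g (i x)) -ie.
by split=> [->//|/(can_inj iK)].
Qed.

(** The embeddings of V_{a,b} in V form a single orbit by Witt's theorem, which is
    isomorphic to X when the stabilizers agree. *)
Lemma iso_of_stab a b X x (w : Xset V a b) : stab x (emb_basis w) ->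
  exists i : X -> Xset V a b, iso_Xset i /\ i x = w.
Proof.
move=> xw; pose f y := projT1 (cid (ss_trans x y)).
have fE y : ss_act (f y) x = y by rewrite /f; case: cid.
have actE g h : ss_act g x = ss_act h x <-> emb_comp g w = emb_comp h w.
  rewrite (stab_eq _ _ xw); split=> [gh|gh].
    apply/emb_eqP => z; have /span_emb_basis[c wz] : exists y, w y = w z by exists z.
    by rewrite /= wz !emb_lincomb gh.
  by rewrite -!map_comp; apply: eq_map => i /=;
    exact: (congr1 (fun k : embedding _ _ => k _) gh).
pose i y : Xset V a b := emb_comp (f y) w.
have iE g : i (ss_act g x) = emb_comp g w by apply/actE; rewrite fE.
exists i; split; last first.
  by rewrite -[x in LHS]ss_act1 iE; apply/emb_eqP.
split; last first.
  move=> g y; rewrite -{1}(fE y) -ss_actM iE /i.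
  by apply/emb_eqP.
pose i' (u : Xset V a b) := ss_act (projT1 (cid (emb_witt w u))) x.
exists i' => [y|u]; rewrite /i'; case: cid => /= g gu.
  by rewrite -[RHS]fE; apply/actE.
by rewrite iE.
Qed.

Lemma eq_fixes A B : (forall v, span A v <-> span B v) ->
  forall g, fixes A g <-> fixes B g.
Proof.
move=> AB; apply: fixes_span_eq => v vin; first by apply/AB/span_mem.
by apply/AB/span_mem.
Qed.

(** The stabilizers of y and of f y are those of the frames of two subspaces, and
    the second subspace is contained in the first one by span_of_fixed: j is this
    inclusion, read in the frames. *)
Lemma model_exists X Y (f : gmap Y X) :
  exists a b a' b' (j : embedding (stdV K a b) (stdV K a' b')),
    inhabited (restriction_model f j).
Proof.
case: (ss_nonempty Y) => y; have [B yB] := stab_exists y.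
have [A xA] := stab_exists (f y).
have [a [b [w wA]]] := frame_exists A; have [a' [b' [w' wB]]] := frame_exists B.
have yw := eq_stab (eq_fixes wB) yB; have xw := eq_stab (eq_fixes wA) xA.
have [i [iiso ix]] := iso_of_stab xw; have [i' [i'iso i'y]] := iso_of_stab yw.
have [j jE] : exists j, emb_comp w' j = w.
  apply: emb_factor => x; apply/span_emb_basis/wB.
  have AB : {in A, forall v, span B v}.
    by apply/(fixes_subP oddF eP); apply: stab_map yB xA.
  by apply: (span_sub AB); apply/wA/span_emb_basis; exists x.
exists a, b, a', b', j; constructor; apply: (@RestrictionModel _ _ _ _ _ f _ _ _ _ j i'
  i) => // z.
have [g <-] := ss_trans y z.
rewrite gm_equiv (proj2 iiso) (proj2 i'iso) ix i'y -jE.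
by apply/emb_eqP.
Qed.

End Frames.

Lemma counts_preimage T T' (P : T -> Prop) (P' : T' -> Prop) (f : T -> T') N :
  injective f -> (forall y, P' y <-> exists x, P x /\ f x = y) ->
  counts P' N -> counts P N.
Proof.
move=> fi fP [I [h [cI hi hP]]].
have ex i : {x | P x /\ f x = h i} by apply/cid/fP/hP; exists i.
rewrite -cI; apply: (counts_card (h := fun i => sval (ex i))) => [i j ij|x].
  by apply: hi; rewrite -(proj2 (svalP (ex i))) ij (proj2 (svalP (ex j))).
split=> [Px|[i <-]]; last by case: (svalP (ex i)).
have /hP[i hx] : P' (f x) by apply/fP; exists x.
by exists i; apply: fi; rewrite (proj2 (svalP (ex i))).
Qed.

Lemma counts_card_eq T (P : T -> Prop) N : counts P N ->
  ([set x | P x]%classic #= `I_N)%card.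
Proof.
move=> [I [h [cI hi hP]]]; apply/card_set_bijP.
pose f x := if pselect (exists i, h i = x) is left ex then
  val (enum_rank (projT1 (cid ex))) else 0%N.
have fh i : f (h i) = enum_rank i.
  rewrite /f; case: pselect => [ex|[]]; last by exists i.
  by case: (cid ex) => j /= /hi ->.
exists f; split.
- by move=> x /hP[i <-]; rewrite /= fh -cI.
- move=> x y /set_mem/hP[i <-] /set_mem/hP[j <-]; rewrite !fh => /val_inj.
  by move/enum_rank_inj ->.
- move=> n /= nN; rewrite -cI in nN.
  exists (h (enum_val (Ordinal nN))); last by rewrite fh enum_valK.
  by apply/hP; exists (enum_val (Ordinal nN)).
Qed.

Section RestrictionModels.
Variables (F : finFieldType) (oddF : odd #|F|) (K : quadExt F).
Variables (V : hspace K) (e : nat -> V) (eP : orthonormal_basis e).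
Local Notation q := #|F|.
Local Notation Kf := (finvect_type K).
Local Notation Zq := (Zinv #|F|).
Local Notation tau := (qe_tau K : K -> K).
Local Notation vec := (vec e).
Local Notation inV := (inV e).
Local Notation E := (basis e).
Local Notation mu := (mu eP).
Implicit Types (v : V) (A B : seq V) (g h : unitary V) (X Y : smoothset V).

Lemma level_embedding m : exists k : embedding (stdV K m 0) V,
  forall v, inV m v <-> exists x, k x = v.
Proof.
pose f (x : 'rV[K]_(m + 0)) : V := vec (lsubmx x).
have lin : linear f by move=> c x y; rewrite /f !linearP.
have inj : injective f.
  move=> x y /(vec_inj eP) xy; rewrite -[x]hsubmxK -[y]hsubmxK xy.
  by congr row_mx; apply/rowP=> -[].
have form (x y : stdV K m 0) : hform (f x) (f y) = hform x y.
  rewrite hform_vec (vecK eP) mxE; apply: eq_bigr => i _.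
  by rewrite !mxE mulrC.
exists (@Embedding _ _ (stdV K m 0) V f lin inj form) => v.
split=> [vm|[x <-]]; last exact: inV_vec.
by exists (row_mx (coord e m v) 0); rewrite /= /f row_mxKl.
Qed.

(** Through a model, the points in V_m are the embeddings into V_m. *)
Lemma model_nu X Y (f : gmap Y X) a b a' b'
    (j : embedding (stdV K a b) (stdV K a' b')) m N :
  restriction_model f j -> is_degree e m f N -> nu_is j m N.
Proof.
move=> [rY rX [[rY' rYK rYK'] rYe] [[rX' rXK rXK'] rXe] rm] [[x0 x0m] deg].
have isoX : iso_Xset rX by split=> //; exists rX'.
have isoY : iso_Xset rY by split=> //; exists rY'.
have [k kP] := level_embedding m.
have levE (Z : smoothset V) c d (i : Z -> Xset V c d) (z : Z) : iso_Xset i ->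
    in_level e m z <-> exists u, emb_comp k u = i z.
  move=> ii; rewrite (in_level_stab oddF eP _ (stab_iso z ii)); split=> [zm|[u uz] v vz].
    apply: emb_factor => y; apply/kP.
    by apply: (inV_span eP zm); apply/span_emb_basis; exists y.
  have /span_emb_basis[y <-] := span_mem vz; rewrite -uz; apply/kP.
  by exists (u y).
split; first by have /(levE _ _ _ _ _ isoX)[u _] := x0m; exists.
move=> u; apply: counts_card_eq.
pose x := rX' (emb_comp k u).
have xE : rX x = emb_comp k u by rewrite rXK'.
have xm : in_level e m x by apply/(levE _ _ _ _ _ isoX); exists u.
apply: (counts_preimage (f := fun w : embedding _ _ => rY' (emb_comp k w)) _ _ (deg x xm)).
  by move=> w w' /(congr1 rY); rewrite !rYK' => /emb_comp_inj.
have assoc (w : embedding (stdV K a' b') (stdV K m 0)) :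
    emb_comp (emb_comp k w) j = emb_comp k (emb_comp w j) by apply/emb_eqP.
move=> y; split=> [[ym fy]|[v [vj <-]]].
  have /(levE _ _ _ _ _ isoY)[v vy] := ym.
  exists v; split; last by rewrite vy rYK.
  by apply: (@emb_comp_inj _ _ _ _ _ k); rewrite -assoc vy -rm fy.
split; first by apply/(levE _ _ _ _ _ isoY); exists v; rewrite rYK'.
by apply: (can_inj rXK); rewrite rm rYK' assoc vj xE.
Qed.

Lemma count_hom_counting : is_counting_hom (count_hom oddF eP).
Proof.
move=> X Y f; split=> [|a b a' b' j rm]; first exact: (model_exists oddF eP).
have [M1 h1] := count_homP oddF eP (theta_sym f).
have [M2 h2] := class_count_sym oddF eP Zq f.
have [M3 h3] := level_nonempty oddF eP X.
exists (maxn M1 (maxn M2 M3)) => m; rewrite !geq_max => /and3P[m1 m2 m3].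
exists (degree e m f); last exact: etrans (esym (h1 m m1)) (h2 m m2).
by apply: (model_nu rm); apply: degreeP => //; apply: h3.
Qed.

End RestrictionModels.

(** * The standard copies of V_{a,b} and their classes *)

Section StandardFamily.
Variables (F : finFieldType) (K : quadExt F).
Variables (V : hspace K) (e : nat -> V) (eP : orthonormal_basis e).
Local Notation Kf := (finvect_type K).
Local Notation tau := (qe_tau K : K -> K).
Local Notation inV := (inV e).
Local Notation E := (basis e).
Implicit Types (v : V).

Definition zeta : K := sval (cid (norm_surj (rmorphN1 (qe_tau K)))).

Lemma zetaP : zeta * tau zeta = -1.
Proof. exact: svalP (cid (norm_surj (rmorphN1 (qe_tau K)))). Qed.

(** Isotropic, as zeta has norm -1. *)
Definition isotropic_vec a i : V := e (a + 2 * i) + zeta *: e (a + 2 * i).+1.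

Lemma form_isotropic_vec k a i : hform (e k) (isotropic_vec a i) =
  (k == a + 2 * i)%:R + zeta * (k == (a + 2 * i).+1)%:R.
Proof. by rewrite hformDr hformZr !basis_form. Qed.

Lemma isotropic_vec_form v a i : hform (isotropic_vec a i) v =
  hform (e (a + 2 * i)) v + tau zeta * hform (e (a + 2 * i).+1) v.
Proof. by rewrite hformDl hformZl. Qed.

Lemma isotropic_vec_even a i j : hform (e (a + 2 * i)) (isotropic_vec a j) = (i == j)%:R.
Proof.
rewrite form_isotropic_vec eqn_add2l eqn_pmul2l // -addnS eqn_add2l.
by rewrite (_ : (2 * i == (2 * j).+1) = false) ?mulr0 ?addr0 //; lia.
Qed.

Lemma isotropic_vec_odd a i j : hform (e (a + 2 * i).+1) (isotropic_vec a j) =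
  zeta * (i == j)%:R.
Proof.
rewrite form_isotropic_vec eqSS eqn_add2l eqn_pmul2l // -addnS eqn_add2l.
by rewrite (_ : ((2 * i).+1 == 2 * j) = false) ?add0r //; lia.
Qed.

Lemma isotropic_vec_low a i k : (k < a)%N -> hform (e k) (isotropic_vec a i) = 0.
Proof.
move=> ka; rewrite form_isotropic_vec !ltn_eqF ?mulr0 ?addr0 //; lia.
Qed.

Lemma isotropic_vec_form0 a i j : hform (isotropic_vec a i) (isotropic_vec a j) = 0.
Proof.
rewrite isotropic_vec_form isotropic_vec_even isotropic_vec_odd mulrA [_ * zeta]mulrC zetaP.
by rewrite mulN1r subrr.
Qed.

(** The standard copy of V_{a,b} in V_{a+2b}, listed from the last vector adjoined
    to the first ones. *)
Fixpoint std_family a b : seq V :=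
  if b is b'.+1 then isotropic_vec a b' :: std_family a b' else E a.

Lemma std_familyP a b v : v \in std_family a b <->
  (exists2 k, (k < a)%N & v = e k) \/ (exists2 i, (i < b)%N & v = isotropic_vec a i).
Proof.
elim: b v => [|b IH] v /=.
  split=> [/mapP[k]|[[k ka ->]|[]//]]; last by apply/mapP; exists k; rewrite ?mem_iota.
  by rewrite mem_iota => /andP[_ ka] ->; left; exists k.
rewrite inE; split=> [/predU1P[->|/IH[[k ka ->]|[i ib ->]]]|[[k ka ->]|[i ib ->]]].
- by right; exists b.
- by left; exists k.
- by right; exists i => //; apply: ltnW.
- by apply/orP; right; apply/IH; left; exists k.
- move: ib; rewrite ltnS leq_eqVlt => /predU1P[->|ib]; first by rewrite eqxx.
  by apply/orP; right; apply/IH; right; exists i.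
Qed.

Lemma isotropic_vec_inV a i n : (a + 2 * i.+1 <= n)%N -> inV n (isotropic_vec a i).
Proof.
move=> ain; apply/(inVP eP) => k nk; rewrite form_isotropic_vec !gtn_eqF ?mulr0 ?addr0
  //; lia.
Qed.

Lemma std_family_inV a b : {in std_family a b, forall v, inV (a + 2 * b) v}.
Proof.
move=> v /std_familyP[[k ka ->]|[i ib ->]]; first by apply/(inV_basis eP); lia.
by apply: isotropic_vec_inV; lia.
Qed.

Lemma coord_isotropic_vec a b : coord e (a + 2 * b) (isotropic_vec a b) = 0.
Proof.
apply/rowP=> k; rewrite !mxE form_isotropic_vec !ltn_eqF ?mulr0 ?addr0 //.
by apply: ltnW; rewrite ltnS.
Qed.

Lemma isotropic_vec_neq0 a b : isotropic_vec a b != 0.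
Proof.
apply/eqP=> r0; have := isotropic_vec_even a b b; rewrite r0 hform0r eqxx => /esym/eqP.
by rewrite oner_eq0.
Qed.

Definition isotropic_comb a b (c : 'rV[Kf]_b) : V :=
  \sum_(i < b) (c : 'rV[K]_b) 0 i *: isotropic_vec a i.

Lemma form_isotropic_comb k a b c (d : nat -> K) :
  (forall i, hform (e k) (isotropic_vec a i) = d i) ->
  hform (e k) (@isotropic_comb a b c) = \sum_(i < b) (c : 'rV[K]_b) 0 i * d i.
Proof.
by move=> kd; rewrite hform_sumr; apply: eq_bigr => i _; rewrite hformZr kd.
Qed.

Lemma isotropic_comb_even a b c (i : 'I_b) :
  hform (e (a + 2 * i)) (@isotropic_comb a b c) = (c : 'rV[K]_b) 0 i.
Proof.
rewrite (form_isotropic_comb _ (isotropic_vec_even a i)) (bigD1 i) //= eqxx mulr1 big1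
  ?addr0 // => j.
by rewrite eq_sym => /negPf; rewrite -val_eqE /= => ->; rewrite mulr0.
Qed.

Lemma isotropic_comb_odd a b c (i : 'I_b) :
  hform (e (a + 2 * i).+1) (@isotropic_comb a b c) = zeta * (c : 'rV[K]_b) 0 i.
Proof.
rewrite (form_isotropic_comb _ (isotropic_vec_odd a i)) (bigD1 i) //= eqxx mulr1 mulrC
  big1 ?addr0 // => j.
by rewrite eq_sym => /negPf; rewrite -val_eqE /= => ->; rewrite !mulr0.
Qed.

Lemma isotropic_comb_span a b c : span (std_family a b) (@isotropic_comb a b c).
Proof.
rewrite /isotropic_comb; elim/big_ind: _ => [|v w|i _]; [exact: span0|exact: spanD|].
by apply/spanZ/span_mem/std_familyP; right; exists i.
Qed.

(** Orthogonality to isotropic_vec a i is one equation between the coordinates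
    a + 2i and a + 2i + 1, solved by the multiples of isotropic_vec a i. Hence the
    orthogonal of V_{a,b} in V_{a+2b} is the radical of V_{a,b}. *)
Lemma std_family_perp a b v : inV (a + 2 * b) v ->
  (forall u, u \in std_family a b -> hform u v = 0) ->
  v = isotropic_comb a (\row_(i < b) hform (e (a + 2 * i)) v).
Proof.
move=> vN vperp; apply/eqP; rewrite -subr_eq0; apply/eqP/(basis_nondeg eP) => k.
rewrite hformDr -scaleN1r hformZr mulN1r; set c := \row_i _.
have cN : inV (a + 2 * b) (isotropic_comb a c).
  by apply: (inV_span eP (@std_family_inV a b)); apply: isotropic_comb_span.
have [Nk|kN] := leqP (a + 2 * b) k.
  by rewrite (inV_form eP vN) // (inV_form eP cN) // subrr.
have [ak|ka] := leqP a k; last first.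
  rewrite (form_isotropic_comb _ (d := fun=> 0)); last by move=> i;
    apply: isotropic_vec_low.
  rewrite big1 => [|i _]; last by rewrite mulr0.
  by rewrite vperp ?subr0 //; apply/std_familyP; left; exists k.
have ib : ((k - a)./2 < b)%N by lia.
have [i kE] : exists i : 'I_b, k = (a + 2 * i)%N \/ k = (a + 2 * i).+1.
  by exists (Ordinal ib) => /=; lia.
have /eqP : hform (isotropic_vec a i) v = 0.
  by apply: vperp; apply/std_familyP; right; exists i.
rewrite isotropic_vec_form addr_eq0 => /eqP rv.
case: kE => ->; first by rewrite isotropic_comb_even mxE subrr.
by rewrite isotropic_comb_odd mxE rv mulrN mulrA zetaP mulN1r opprK subrr.
Qed.

End StandardFamily.

Section StandardClasses.
Variables (F : finFieldType) (oddF : odd #|F|) (K : quadExt F).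
Variables (V : hspace K) (e : nat -> V) (eP : orthonormal_basis e).
Local Notation q := #|F|.
Local Notation Kf := (finvect_type K).
Local Notation Zq := (Zinv #|F|).
Local Notation tau := (qe_tau K : K -> K).
Local Notation vec := (vec e).
Local Notation inV := (inV e).
Local Notation E := (basis e).
Local Notation mu := (mu eP).
Implicit Types (v : V) (A B : seq V) (g h : unitary V) (X Y : smoothset V).

(** Only the q^(2b) vectors of the radical of V_{a,b} have a projection w to
    consider, and they are isotropic: each contributes the class of the nonzero
    isotropic vectors orthogonal to V_{a+2b}. *)
Lemma adjoin_isotropic a b :
  orbit_class (std_family e a b) (std_family e a b.+1) =
  q%:R ^+ (2 * b) * (mu (a + 2 * b) 0 - 1).
Proof.
set N := (a + 2 * b)%N; set A := std_family e a b; set r := isotropic_vec e a b.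
have AN : {in A, forall v, inV N v} by apply: (std_family_inV eP).
have rN : coord e N r = 0 by apply: (coord_isotropic_vec eP).
have rA : ~ span A r.
  move=> /(inV_span eP AN); rewrite -[r]add0r; apply: perp_notin => //;
    first exact: (isotropic_vec_neq0 eP).
  exact: inV0.
pose S := [pred w : 'rV[Kf]_N | same_products e A r w].
have typP (w : 'rV[Kf]_N) : same_products e A r w <->
    exists c, vec (w : 'rV[K]_N) = @isotropic_comb _ _ _ e a b c.
  split=> [/allP tw|[c wc]].
    exists (\row_(i < b) hform (e (a + 2 * i)) (vec (w : 'rV[K]_N))).
    apply: (std_family_perp eP) => [|u uA]; first exact: inV_vec.
    by rewrite (eqP (tw u uA)) (perp_form (AN u uA) rN).
  apply/allP=> u uA; rewrite wc (perp_form (AN u uA) rN) hform_sumr big1 // => i _.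
  rewrite hformZr; case/std_familyP: uA => [[k ka ->]|[l lb ->]].
    by rewrite (isotropic_vec_low eP) ?mulr0.
  by rewrite (isotropic_vec_form0 eP) mulr0.
have wS (w : 'rV[Kf]_N) : same_products e A r w -> vec_norm e w = 0 /\ in_span e A w.
  move=> /typP[c wc]; split; last by apply/asboolP; rewrite wc; apply: isotropic_comb_span.
  rewrite /vec_norm wc /isotropic_comb hform_suml big1 // => i _;
    rewrite hform_sumr big1 // => l _.
  by rewrite hformZl hformZr (isotropic_vec_form0 eP) !mulr0.
have cardS : #|S| = (q ^ (2 * b))%N.
  pose f (c : 'rV[Kf]_b) : 'rV[Kf]_N := coord e N (isotropic_comb e a c).
  have vf c : vec (f c : 'rV[K]_N) = isotropic_comb e a c.
    by apply: (inV_span eP AN); apply: isotropic_comb_span.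
  have fi : injective f.
    move=> c d cd; have vcd : isotropic_comb e a c =
      isotropic_comb e a d by rewrite -!vf cd.
    by apply/rowP=> i; rewrite -(isotropic_comb_even eP a c) vcd (isotropic_comb_even eP).
  rewrite expnM -(card_quad K) -[X in (_ ^ X)%N]mul1n -card_mx -(fintype.card_codom fi).
  apply: eq_card => w; rewrite inE; apply/idP/codomP => [/typP[c wc]|[c ->]].
    by exists c; apply: (vec_inj eP); rewrite vf.
  by apply/typP; exists c; apply: vf.
have rr : hform r r = 0 by apply: (isotropic_vec_form0 eP).
rewrite (one_point_classE oddF eP AN rA) rr.
rewrite (_ : #|[pred w | _ && (vec_norm e w == 0)]| = #|S|); last first.
  by apply: eq_card => w; rewrite !inE; case: (boolP (same_products _ _ _ _)) =>
    // /wS[-> _]; rewrite eqxx.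
rewrite (_ : #|[pred w | [&& _, _ & _]]| = #|S|); last first.
  by apply: eq_card => w; rewrite !inE; case: (boolP (same_products _ _ _ _)) =>
    // /wS[-> ->]; rewrite eqxx.
rewrite -/S cardS -natrX -mulrDr mulrBr mulr1; congr (_ * _ - _).
by rewrite /sigma addrC subrK.
Qed.

Lemma adjoin_unit a : orbit_class (E a) (E a.+1) = mu a 1.
Proof.
rewrite -(adjoin_basis oddF eP); have incl g : fixes (E a.+1) g -> fixes (E a) g.
  move=> ga v /mapP[k]; rewrite mem_iota => /andP[_ ka] ->; apply: ga.
  by apply/mapP; exists k; rewrite // mem_iota /=; lia.
apply: (eq_orbit_class eP) => //; apply: fixes_span_eq => v vE; apply: span_mem.
  move: vE => /mapP[k]; rewrite mem_iota => /andP[_];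
    rewrite add0n ltnS leq_eqVlt => /predU1P[->|ka] ->.
    exact: mem_head.
  by rewrite inE; apply/orP; right; apply/mapP; exists k; rewrite // mem_iota.
move: vE; rewrite inE => /predU1P[->|/mapP[k]].
  by apply/mapP; exists a; rewrite // mem_iota /=.
by rewrite mem_iota => /andP[_ ka] ->; apply/mapP; exists k; rewrite // mem_iota /=; lia.
Qed.

Local Notation Phi := (count_hom oddF eP).
Local Notation Q := (q%:R : {poly Zq}).

Lemma count_hom_sigmaN N : (- Q) ^+ N * Phi (sigma eP N) = 'X.
Proof.
have := congr1 Phi (sigma_scale oddF eP N); rewrite count_hom_sigma.
by rewrite [in LHS]rmorphM [in LHS]rmorphXn rmorphN rmorph_nat.
Qed.

Lemma count_hom_mu1 N : Q ^+ (2 * N).+1 * Phi (mu N 1) = 'X * ('X - (- Q) ^+ N).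
Proof.
have mor (f : {rmorphism Theta V -> {poly Zq}}) n k m s :
    q%:R ^+ n * m = s ^+ 2 - (- q%:R) ^+ k * s ->
    Q ^+ n * f m = f s * (f s - (- Q) ^+ k).
  rewrite -(rmorph_nat f q) -[- f _]rmorphN -!rmorphXn -rmorphB -!rmorphM => ->.
  by congr (f _); ring.
by rewrite (mor Phi _ _ _ _ (mu_one oddF eP N)) /= count_hom_sigma.
Qed.

Lemma count_hom_mu0 N : Q ^+ (2 * N).+1 * (Phi (mu N 0) - 1) =
  ('X - (- Q) ^+ N) * ('X - (- Q) ^+ N.+1).
Proof.
have -> : Phi (mu N 0) = Phi (mu N 1) + Phi (sigma eP N).
  by rewrite -rmorphD /sigma [mu N 1 + _]addrC subrK.
have Q2 : Q ^+ (2 * N) = (- Q) ^+ N * (- Q) ^+ N.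
  by rewrite -exprMn mulrNN mulnC exprM -expr2 exprAC.
have := count_hom_mu1 N; have := count_hom_sigmaN N; rewrite !exprS Q2.
move: ((- Q) ^+ N) (Phi (mu N 1)) (Phi (sigma eP N)) => s m p sE mE.
transitivity (Q * (s * s) * m + Q * s * (s * p) - Q * (s * s)); first by ring.
rewrite mE sE; ring.
Qed.

Lemma count_hom_chain A B C : (forall g, fixes B g -> fixes A g) ->
  (forall g, fixes C g -> fixes B g) ->
  Phi (orbit_class A C) = Phi (orbit_class A B) * Phi (orbit_class B C).
Proof. by move=> AB BC; rewrite (orbit_class_comp eP AB BC) [LHS]rmorphM. Qed.

(** Adjoining one after the other the vectors of the standard copy of V_{a,b}
    produces the factors of P_{a,b}. *)
Lemma count_hom_std_family a b :
  Q ^+ ((a + b) ^ 2) * Phi (orbit_class [::] (std_family e a b)) =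
  'X^a * \prod_(i < a + 2 * b) ('X - (- Q) ^+ i).
Proof.
elim: b => [|b IHb].
  rewrite !addn0 /=; elim: a => [|a IHa].
    rewrite (orbit_class_iso eP) ?rmorph1 ?big_ord0 //.
  rewrite (@count_hom_chain _ (E a)) //; last first.
    move=> g ga v /mapP[k]; rewrite mem_iota => /andP[_ ka] ->; apply: ga.
    by apply/mapP; exists k; rewrite // mem_iota /=; lia.
  rewrite adjoin_unit big_ord_recr /= exprSr.
  have -> : (a.+1 ^ 2 = a ^ 2 + (2 * a).+1)%N by lia.
  rewrite exprD mulrACA IHa count_hom_mu1; ring.
rewrite (@count_hom_chain _ (std_family e a b)) //; last by move=> g /fixes_cons[].
have mor (f : {rmorphism Theta V -> {poly Zq}}) n m :
    f (q%:R ^+ n * (m - 1)) = Q ^+ n * (f m - 1).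
  by rewrite rmorphM rmorphXn rmorph_nat rmorphB rmorph1.
rewrite adjoin_isotropic (mor Phi) /=.
have -> : ((a + b.+1) ^ 2 = (a + b) ^ 2 + (2 * (a + b)).+1)%N by lia.
rewrite exprD mulrACA IHb [Q ^+ _ * (Q ^+ _ * _)]mulrA -exprD.
have -> : ((2 * (a + b)).+1 + 2 * b = (2 * (a + 2 * b)).+1)%N by lia.
rewrite count_hom_mu0; have -> : (a + 2 * b.+1 = (a + 2 * b).+2)%N by lia.
rewrite !big_ord_recr /=; ring.
Qed.

Lemma count_hom_Ppoly a b : Phi (orbit_class [::] (std_family e a b)) = Ppoly q a b.
Proof.
rewrite /Ppoly; under eq_bigr => i _ do rewrite rmorphXn rmorphN rmorph_nat.
rewrite -count_hom_std_family -natrX -[_%:R](rmorph_nat polyC) mul_polyC scalerA natrX.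
by rewrite -exprMn qinvK ?expr1n ?scale1r // finNzRing_gt1.
Qed.

Lemma std_embedding a b : exists w : Xset V a b,
  forall v, span (emb_basis w) v <-> span (std_family e a b) v.
Proof.
pose f (x : 'rV[K]_(a + b)) : V := vec (lsubmx x) + isotropic_comb e a (rsubmx x).
have comb_lin : linear (fun c : 'rV[K]_b => isotropic_comb e a c).
  move=> c x y; rewrite /isotropic_comb scaler_sumr -big_split; apply: eq_bigr => i _.
  by rewrite !mxE scalerDl scalerA.
have lin : linear f.
  by move=> c x y; rewrite /f !linearP comb_lin scalerDr addrACA.
have low i c : (i < a)%N -> hform (e i) (@isotropic_comb _ _ _ e a b c) = 0.
  move=> ia; rewrite (form_isotropic_comb _ (d := fun=> 0)).
    by rewrite big1 // => k _; rewrite mulr0.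
  by move=> k /=; rewrite (isotropic_vec_low eP).
have inj : injective f.
  move=> x y xy; rewrite -[x]hsubmxK -[y]hsubmxK; congr row_mx; apply/rowP=> i.
    have := congr1 (hform (e i)) xy; rewrite !hformDr !low // !addr0.
    by rewrite !(hform_basis_vec eP) valK.
  have := congr1 (hform (e (a + 2 * i))) xy; rewrite !hformDr !(isotropic_comb_even eP).
  by rewrite !(inV_form eP (inV_vec eP _)) ?add0r // leq_addr.
have perp (c : 'rV[K]_a) d : hform (vec c) (@isotropic_comb _ _ _ e a b d) = 0.
  by rewrite hform_suml big1 // => i _; rewrite hformZl low ?mulr0.
have perp' (c : 'rV[K]_a) d : hform (@isotropic_comb _ _ _ e a b d) (vec c) = 0.
  by rewrite -hform_herm perp raddf0.
have form (x y : stdV K a b) : hform (f x) (f y) = hform x y.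
  rewrite hformDl !hformDr perp perp' addr0 add0r.
  rewrite [X in _ + X](_ : _ = 0) ?addr0; last first.
    rewrite /isotropic_comb hform_suml big1 // => i _; rewrite hform_sumr big1 // => l _.
    by rewrite hformZl hformZr (isotropic_vec_form0 eP) !mulr0.
  rewrite hform_vec (vecK eP) mxE; apply: eq_bigr => i _.
  by rewrite !mxE mulrC.
exists (@Embedding _ _ (stdV K a b) V f lin inj form) => v.
rewrite span_emb_basis; split=> [[x <-]|vspan].
  apply: spanD; last exact: isotropic_comb_span.
  rewrite vecE; elim/big_ind: _ => [|y z|i _]; [exact: span0|exact: spanD|].
  by apply/spanZ/span_mem/std_familyP; left; exists i.
apply/(@span_emb_basis _ _ _ _ _ (@Embedding _ _ (stdV K a b) V f lin inj form)).
apply: span_sub vspan => u uE; apply/span_emb_basis => /=.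
case/std_familyP: uE => [[k ka ->]|[i ib ->]].
  exists (row_mx (delta_mx 0 (Ordinal ka)) 0); rewrite /f row_mxKl row_mxKr.
  rewrite /isotropic_comb big1 ?addr0 => [|l _]; last by rewrite mxE scale0r.
  rewrite vecE (bigD1 (Ordinal ka)) //= mxE !eqxx scale1r big1 ?addr0 // => l.
  by move=> /negPf lk; rewrite mxE lk andbF scale0r.
exists (row_mx 0 (delta_mx 0 (Ordinal ib))); rewrite /f row_mxKl row_mxKr linear0 add0r.
rewrite /isotropic_comb (bigD1 (Ordinal ib)) //= mxE !eqxx scale1r big1 ?addr0 // => l.
by move=> /negPf lk; rewrite mxE lk andbF scale0r.
Qed.

Lemma count_hom_Xset a b X (i : X -> Xset V a b) : iso_Xset i ->
  Phi (theta_sym (to_pt X)) = Ppoly q a b.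
Proof.
move=> iiso; have [w wspan] := std_embedding a b.
have [[i' iK i'K] ie] := iiso; have := stab_iso (i' w) iiso; rewrite i'K => xw.
have ptx : stab (to_pt X (i' w)) [::] by move=> g; split.
rewrite -(orbit_classE (eq_stab (eq_fixes wspan) xw) ptx); exact: count_hom_Ppoly.
Qed.

Lemma Xset_exists a b : exists (X : smoothset V) (i : X -> Xset V a b), iso_Xset i.
Proof.
have [w _] := std_embedding a b; have [X [x xw]] := orbit_exists eP (emb_basis w).
by have [i [iiso _]] := iso_of_stab oddF eP xw; exists X, i.
Qed.

End StandardClasses.

Theorem theorem10p9 (F : finFieldType) (oddF : odd #|F|) (K : quadExt F)
    (V : hspace K) (e : nat -> V) (eP : orthonormal_basis e) :
  exists phi : {rmorphism Theta V -> {poly Zinv #|F|}},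
    [/\ is_counting_hom phi,
        forall a b : nat,
          (exists (X : smoothset V) (i : X -> Xset V a b), iso_Xset i) /\
          (forall (X : smoothset V) (i : X -> Xset V a b), iso_Xset i ->
            phi (theta_sym (to_pt X)) = Ppoly #|F| a b)
      & bijective (loc_map phi (#|F|%:R : Theta V))].
Proof.
exists (count_hom oddF eP); split.
- exact: count_hom_counting.
- move=> a b; split; first exact: (Xset_exists oddF eP).
  by move=> X i; apply: count_hom_Xset.
- exact: loc_count_hom_bij.
Qed.
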